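(* Let $\Omega''$ be an open set with $\Omega\Subset\Omega''\subset\Omega'$. Let $u$ be the solution to the obstacle problem in $\mathcal K_{g,h}(\Omega,\Omega')$ and let $v$ be a weak supersolution to $\mathcal Lv=0$ in $\Omega''$ such that $\min\{u,v\}\in\mathcal K_{g,h}(\Omega,\Omega')$. Then $u\le v$ almost everywhere.
   Context: Fix $s\in(0,1)$, $p\in(1,\infty)$, $\Lambda\ge 1$, and a measurable symmetric kernel $K:\mathbb R^n\times\mathbb R^n\to[0,\infty)$, $K(x,y)=K(y,x)$, with $\Lambda^{-1}\le K(x,y)|x-y|^{n+sp}\le\Lambda$ for a.e. $x,y\in\mathbb R^n$. Write $L(a,b):=|a-b|^{p-2}(a-b)$ for $a,b\in\mathbb R$ (with $L(a,a)=0$). Formally, $\mathcal L u(x)=\mathrm{p.v.}\int_{\mathbb R^n}K(x,y)L(u(x),u(y))\,dy$. For open $U\subset\mathbb R^n$, $W^{s,p}(U)$ is the fractional Sobolev space with norm $\|v\|_{L^p(U)}+\left(\int_U\int_U\frac{|v(x)-v(y)|^p}{|x-y|^{n+sp}}\,dx\,dy\right)^{1/p}$. The tail space is $L^{p-1}_{sp}(\mathbb R^n):=\{f\in L^{p-1}_{\rm loc}(\mathbb R^n):\int_{\mathbb R^n}|f(x)|^{p-1}(1+|x|)^{-n-sp}\,dx<\infty\}$. For an open set $U$, a function $u\in W^{s,p}_{\rm loc}(U)\cap L^{p-1}_{sp}(\mathbb R^n)$ is a weak supersolution to $\mathcal Lu=0$ in $U$ if $\int_{\mathbb R^n}\int_{\mathbb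 R^n}L(u(x),u(y))(\eta(x)-\eta(y))K(x,y)\,dx\,dy\ge0$ for every nonnegative $\eta\in C_0^\infty(U)$. (Equivalently, $\eta$ may be any nonnegative function in $W^{s,p}_0(U')$ with $U'\Subset U$, where $W_0^{s,p}(U')$ is the closure of $C_0^\infty(U')$ in $W^{s,p}(\mathbb R^n)$.) Obstacle problem. Let $\Omega\Subset\Omega'$ be open bounded subsets of $\mathbb R^n$, let $h:\mathbb R^n\to[-\infty,\infty)$ be an extended real-valued function (the obstacle), and let $g\in W^{s,p}(\Omega')\cap L^{p-1}_{sp}(\mathbb R^n)$ (the boundary values). Define $$\mathcal K_{g,h}(\Omega,\Omega'):=\{u\in W^{s,p}(\Omega'): u\ge h\text{ a.e. in }\Omega,\ u=g\text{ a.e. on }\mathbb R^n\setminus\Omega\}.$$ For $u\in\mathcal K_{g,h}(\Omega,\Omega')$ and $v\in W^{s,p}(\Omega')$ let $$\mathcal Au(v):=\int_{\Omega'}\int_{\Omega'}L(u(x),u(y))(v(x)-v(y))K(x,y)\,dx\,dy+2\int_{\mathbb R^n\setminus\Omega'}\int_\Omega L(u(x),g(y))v(x)K(x,y)\,dx\,dy,$$ where in the second term $x\in\Omega$ and $y\in\mathbb R^n\setminus\Omega'$. A function $u\in\mathcal K_{g,h}(\Omega,\Omega')$ is a solution to the obstacle problem in $\mathcal K_{g,h}(\Omega,\Omega')$ if $\mathcal Au(v-u)\ge0$ whenever $v\in\mathcal K_{g,h}(\Omega,\Omega')$; the set $\mathcal K_{g,h}(\Omega,\Omega')$ is assumed non-empty.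 *)

(* Defs.v *)
From HB Require Import structures.
From mathcomp Require Import all_boot all_order all_algebra.
From mathcomp Require Import all_classical all_reals all_analysis.
From mathcomp Require Import measurable_realfun.

Set Implicit Arguments.
Unset Strict Implicit.
Unset Printing Implicit Defensive.

Import Order.TTheory GRing.Theory Num.Theory.
Import numFieldNormedType.Exports.

Local Open Scope classical_set_scope.
Local Open Scope ring_scope.

(* ['rV[R]_n] carries the product (equivalently, Borel) sigma-algebra, exactly
   as the library does for [n.-tuple T]. *)

Fact rV_display : measure_display.
Proof. exact: default_measure_display. Qed.

Section measurable_rV.
Context (R : realType) (n : nat).

Let coors : 'I_n -> 'rV[R]_n -> R := fun i x => x ord0 i.

Let rV_set0 : g_sigma_preimage coors set0.
Proof. exact: sigma_algebra0. Qed.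

Let rV_setC A : g_sigma_preimage coors A -> g_sigma_preimage coors (~` A).
Proof. exact: sigma_algebraC. Qed.

Let rV_bigcup (F : _^nat) : (forall i, g_sigma_preimage coors (F i)) ->
  g_sigma_preimage coors (\bigcup_i (F i)).
Proof. exact: sigma_algebra_bigcup. Qed.

HB.instance Definition _ := @isMeasurable.Build rV_display
  'rV[R]_n (g_sigma_preimage coors) rV_set0 rV_setC rV_bigcup.

End measurable_rV.

Section rV_cons.
Context (R : realType).

Lemma measurable_coord n (i : 'I_n) :
  measurable_fun [set: 'rV[R]_n] (fun x : 'rV[R]_n => x ord0 i).
Proof.
move=> _ Y mY; rewrite setTI; apply: sub_sigma_algebra => /=.
rewrite -bigcup_seq/=; exists i => /=; first by rewrite mem_index_enum.
by exists Y => //; rewrite setTI.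
Qed.

Lemma measurable_fun_rVP d (T : measurableType d) n (f : T -> 'rV[R]_n) :
  measurable_fun [set: T] f <->
  forall i, measurable_fun [set: T] (fun x => f x ord0 i).
Proof.
split=> [mf i|mf]; first exact: (measurableT_comp (@measurable_coord n i)).
move=> _ Y; rewrite setTI.
have sP : sigma_algebra setT [set Z : set 'rV[R]_n | measurable (f @^-1` Z)].
  split => /=; first by rewrite preimage_set0.
    by move=> A mA; rewrite setTD preimage_setC; exact: measurableC.
  by move=> F mF; rewrite preimage_bigcup; exact: bigcupT_measurable.
move=> mY; apply: (smallest_sub sP _ mY) => Z.
rewrite -bigcup_seq/= => -[i _ [W mW <-]].
by rewrite setTI /=; rewrite -[X in measurable X]setTI; exact: (mf i).
Qed.

Definition rV_cons n (z : measurableTypeR R * 'rV[R]_n) : 'rV[R]_n.+1 :=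
  \row_i oapp (z.2 ord0) z.1 (unlift ord0 i).

Lemma rV_cons0 n (z : measurableTypeR R * 'rV[R]_n) : rV_cons z ord0 ord0 = z.1.
Proof. by rewrite mxE unlift_none. Qed.

Lemma rV_consS n (z : measurableTypeR R * 'rV[R]_n) i :
  rV_cons z ord0 (lift ord0 i) = z.2 ord0 i.
Proof. by rewrite mxE liftK. Qed.

Lemma measurable_rV_cons n :
  measurable_fun [set: measurableTypeR R * 'rV[R]_n] (@rV_cons n).
Proof.
apply/measurable_fun_rVP => i.
case: (unliftP ord0 i) => [j|] ->.
  under eq_fun do rewrite rV_consS.
  exact: (measurableT_comp (measurable_coord j)).
by under eq_fun do rewrite rV_cons0; exact: measurable_fst.
Qed.

Definition rV_uncons n (x : 'rV[R]_n.+1) : measurableTypeR R * 'rV[R]_n :=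
  (x ord0 ord0, \row_(i < n) x ord0 (lift ord0 i)).

Lemma rV_consK n : cancel (@rV_cons n) (@rV_uncons n).
Proof.
case=> a x; rewrite /rV_uncons rV_cons0; congr pair.
by apply/rowP => i; rewrite mxE rV_consS.
Qed.

Lemma measurable_rV_uncons n :
  measurable_fun [set: 'rV[R]_n.+1]
    (@rV_uncons n).
Proof.
apply/measurable_fun_pairP; split; first exact: measurable_coord.
apply/measurable_fun_rVP => i; rewrite /rV_uncons/=.
by under eq_fun do rewrite mxE; exact: measurable_coord.
Qed.

End rV_cons.

Section lebesgue_rV_step.
Context (R : realType) (n : nat).
Variable nu : {sigma_finite_measure set 'rV[R]_n -> \bar R}.
Local Open Scope ereal_scope.

Definition lebesgue_rV_step : set 'rV[R]_n.+1 -> \bar R :=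
  pushforward (product_measure1 (@lebesgue_measure R) nu) (@rV_cons R n).

Let leb1 : {sigma_finite_measure set (measurableTypeR R) -> \bar R} :=
  @lebesgue_measure R.

Local Notation prod := (product_measure1 (@lebesgue_measure R) nu).

Let step0 : lebesgue_rV_step set0 = 0.
Proof. by rewrite /lebesgue_rV_step /pushforward preimage_set0 measure0. Qed.

Let mpre A : measurable A -> 
    @measurable _ (measurableTypeR R * 'rV[R]_n)%type (@rV_cons R n @^-1` A).
Proof.
by move=> mA; rewrite -[X in measurable X]setTI; exact: measurable_rV_cons.
Qed.

Let step_ge0 A : 0 <= lebesgue_rV_step A.
Proof. exact: (@measure_ge0 _ _ _ prod). Qed.

Let step_sigma_additive : semi_sigma_additive lebesgue_rV_step.
Proof.
move=> F mF tF mUF; rewrite /lebesgue_rV_step /pushforward preimage_bigcup.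
apply: (@measure_semi_sigma_additive _ _ _ prod).
- by move=> i; exact: mpre.
- apply/trivIsetP => /= i j _ _ ij; rewrite -preimage_setI.
  by move/trivIsetP : tF => /(_ _ _ _ _ ij) ->//; rewrite preimage_set0.
- by rewrite -preimage_bigcup; exact: mpre.
Qed.

HB.instance Definition _ := isMeasure.Build _ _ _ lebesgue_rV_step
  step0 step_ge0 step_sigma_additive.

Let step_sigma_finite : sigma_finite setT lebesgue_rV_step.
Proof.
have /sigma_finiteP[F [TF ndF Foo]] := sigma_finiteT leb1.
have /sigma_finiteP[G [TG ndG Goo]] := sigma_finiteT nu.
exists (fun k => @rV_uncons R n @^-1` (F k `*` G k)).
  rewrite predeqE => x; split => // _.
  have [k _ Fk] : (\bigcup_i F i) (x ord0 ord0) by rewrite -TF.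
  have [l _ Gl] : (\bigcup_i G i) (rV_uncons x).2 by rewrite -TG.
  exists (maxn k l) => //; split => /=.
  - by have /subsetPset := ndF _ _ (leq_maxl k l); exact.
  - by have /subsetPset := ndG _ _ (leq_maxr k l); exact.
move=> k; have [mFk Fk] := Foo k; have [mGk Gk] := Goo k.
split.
  rewrite -[X in measurable X]setTI; apply: measurable_rV_uncons => //.
  exact: measurableX.
rewrite /lebesgue_rV_step /pushforward -comp_preimage.
rewrite (_ : _ \o _ = id); last by apply/funext => z; exact: rV_consK.
by rewrite preimage_id product_measure1E// lte_mul_pinfty// ge0_fin_numE.
Qed.

HB.instance Definition _ := Measure_isSigmaFinite.Build _ _ _ lebesgue_rV_step
  step_sigma_finite.

End lebesgue_rV_step.

(* n-dimensional Lebesgue measure, as an iterated product measure;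
   see [lebesgue_rV_box]. *)
Fixpoint lebesgue_rV (R : realType) (n : nat) :
    {sigma_finite_measure set 'rV[R]_n -> \bar R} :=
  match n with
  | 0%N => [the sigma_finite_measure _ _ of \d_(0 : 'rV[R]_0)]
  | m.+1 => [the sigma_finite_measure _ _ of lebesgue_rV_step (lebesgue_rV R m)]
  end.

Lemma lebesgue_rV_box (R : realType) (n : nat) (A : 'I_n -> set R) :
    (forall i, measurable (A i)) ->
  lebesgue_rV R n [set x | forall i, A i (x ord0 i)] =
  (\prod_(i < n) lebesgue_measure (A i))%E.
Proof.
elim: n A => [|n IH] A mA.
  by rewrite big_ord0/= diracE mem_set// => -[].
have mB : measurable
    [set x : 'rV[R]_n | forall i, A (lift ord0 i) (x ord0 i)].
  rewrite (_ : mkset _ = \bigcap_(i in [set: 'I_n])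
      ((fun x : 'rV[R]_n => x ord0 i) @^-1` A (lift ord0 i))).
    apply: fin_bigcap_measurable => // i _.
    by rewrite -[X in measurable X]setTI; exact: measurable_coord.
  by apply/seteqP; split => x /= Ax i; [move=> _; exact: Ax|exact: Ax].
rewrite big_ord_recl -IH//.
rewrite -(@product_measure1E _ _ (measurableTypeR R) _ R (@lebesgue_measure R)
  (lebesgue_rV R n) _ _ (mA ord0) mB).
rewrite /= /lebesgue_rV_step /pushforward.
congr (product_measure1 _ _ _); apply/seteqP; split => -[a x] /=.
  move=> H; split => /=; first by have := H ord0; rewrite rV_cons0.
  by move=> i; have := H (lift ord0 i); rewrite rV_consS.
move=> [/= H0 HS] i; case: (unliftP ord0 i) => [j|] ->.
  by rewrite rV_consS; exact: HS.
by rewrite rV_cons0.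
Qed.

(* Measurability w.r.t. the completion of [mu], i.e., Lebesgue measurability
   when [mu] is [lebesgue_rV R n] or [lebesgue_rV R n \x lebesgue_rV R n].
   Such an [f] is [mu]-a.e. equal to a measurable function, and the library
   integral (defined through measurable simple functions below [f]) is the
   Lebesgue integral also for these [f]. *)
Definition completed_measurable_fun d (T : measurableType d) (R : realType)
    (mu : set T -> \bar R) (D : set T) (f : T -> R) :=
  forall Y : set R, measurable Y -> completed_algebra_gen mu (D `&` f @^-1` Y).

Definition compactly_contained (T : topologicalType) (U V : set T) :=
  compact (closure U) /\ closure U `<=` V.

(* The library norm of ['rV[R]_n] is the sup norm. *)
Definition enorm (R : realType) (n : nat) (x : 'rV[R]_n) : R :=
  Num.sqrt (\sum_(i < n) x ord0 i ^+ 2).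

Section smooth.
Context (R : realType) (n : nat).
Implicit Types (k : nat) (f : 'rV[R]_n -> R) (U : set 'rV[R]_n).

Fixpoint Ck k f : Prop :=
  match k with
  | 0%N => continuous f
  | k'.+1 => continuous f /\ forall i : 'I_n,
      (forall x, derivable f x (delta_mx ord0 i)) /\
      Ck k' (fun x => 'D_(delta_mx ord0 i) f x)
  end.

Definition Cinfty f := forall k, Ck k f.

Definition tsupport f := closure [set x | f x != 0].

Definition Cinfty0 U : set ('rV[R]_n -> R) :=
  [set f | [/\ Cinfty f, compact (tsupport f) & tsupport f `<=` U]].

End smooth.

Section fractional_spaces.
Context (R : realType) (n : nat).
Implicit Types (s p : R) (U : set 'rV[R]_n) (v : 'rV[R]_n -> R).
Local Open Scope ereal_scope.

Local Notation mu := (lebesgue_rV R n).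

(* On the diagonal the integrand is [0 / 0 = 0]. *)
Definition gagliardo s p U v : \bar R :=
  \int[mu \x mu]_(z in U `*` U)
    (`|v z.1 - v z.2| `^ p / enorm (z.1 - z.2) `^ (n%:R + s * p))%R%:E.

Definition Wsp_norm s p U v : \bar R :=
  (\int[mu]_(x in U) (`|v x| `^ p)%R%:E) `^ p^-1 + gagliardo s p U v `^ p^-1.

Definition Wsp s p U : set ('rV[R]_n -> R) :=
  [set v | completed_measurable_fun mu U v /\ Wsp_norm s p U v < +oo].

Definition Wsp_loc s p U : set ('rV[R]_n -> R) :=
  [set v | forall V, open V -> compactly_contained V U -> Wsp s p V v].

Definition Lq_loc (q : R) : set ('rV[R]_n -> R) :=
  [set f | completed_measurable_fun mu setT f /\
    forall C : set 'rV[R]_n, compact C ->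
      \int[mu]_(x in C) (`|f x| `^ q)%R%:E < +oo].

Definition tail_space s p : set ('rV[R]_n -> R) :=
  [set f | Lq_loc (p - 1)%R f /\
    \int[mu]_x (`|f x| `^ (p - 1) * (1 + enorm x) `^ (- n%:R - s * p))%R%:E
      < +oo].

End fractional_spaces.

Definition Lpow (R : realType) (p a b : R) : R := `|a - b| `^ (p - 2) * (a - b).

Section nonlocal_operator.
Context (R : realType) (n : nat).
Implicit Types (s p Lambda : R) (K : 'rV[R]_n -> 'rV[R]_n -> R).
Implicit Types (U Omega : set 'rV[R]_n) (u v g : 'rV[R]_n -> R).
Local Open Scope ereal_scope.

Local Notation mu := (lebesgue_rV R n).

Definition admissible_kernel s p Lambda K : Prop :=
  [/\ completed_measurable_fun (mu \x mu) setT (fun z => K z.1 z.2),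
      forall x y, (0 <= K x y)%R,
      forall x y, K x y = K y x &
      {ae mu \x mu, forall z : 'rV[R]_n * 'rV[R]_n,
        (Lambda^-1 <= K z.1 z.2 * enorm (z.1 - z.2) `^ (n%:R + s * p)
                   <= Lambda)%R}].

Definition weak_supersolution s p K U u : Prop :=
  [/\ Wsp_loc s p U u, tail_space s p u &
    forall eta, Cinfty0 U eta -> (forall x, (0 <= eta x)%R) ->
      0 <= \int[mu \x mu]_z
        (Lpow p (u z.1) (u z.2) * (eta z.1 - eta z.2) * K z.1 z.2)%R%:E].

Definition obstacle_class s p Omega Omega' g (h : 'rV[R]_n -> \bar R) :
    set ('rV[R]_n -> R) :=
  [set u | [/\ Wsp s p Omega' u,
    {ae mu, forall x, Omega x -> h x <= (u x)%:E} &
    {ae mu, forall x, ~ Omega x -> u x = g x}]].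

Definition obstacle_form p K Omega Omega' g u v : \bar R :=
  \int[mu \x mu]_(z in Omega' `*` Omega')
    (Lpow p (u z.1) (u z.2) * (v z.1 - v z.2) * K z.1 z.2)%R%:E +
  2%:E * \int[mu \x mu]_(z in Omega `*` ~` Omega')
    (Lpow p (u z.1) (g z.2) * v z.1 * K z.1 z.2)%R%:E.

Definition obstacle_solution s p K Omega Omega' g h u : Prop :=
  obstacle_class s p Omega Omega' g h u /\
  forall v, obstacle_class s p Omega Omega' g h v ->
    0 <= obstacle_form p K Omega Omega' g u (fun x => v x - u x)%R.

End nonlocal_operator.

(* Main.v *)
Require Import Defs.
From HB Require Import structures.
From mathcomp Require Import all_boot all_order all_algebra.
From mathcomp Require Import all_classical all_reals all_analysis.
From mathcomp Require Import measurable_realfun.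
From mathcomp Require Import ring lra.

(** The two inequalities are tested with the same function, the truncated excess
    [eta = min (max (u - v) 0) 1]. It vanishes outside [Omega], where
    [u = g = min u v] almost everywhere, and [min u v <= u - eta <= u], so
    [u - eta] is a competitor in the obstacle problem and the form of [u] against
    [eta] is nonpositive. The form of [v] against [eta] is nonnegative because
    [v] is a supersolution. Subtracting, the integral over all pairs [(x, y)] of
    [(L (u x, u y) - L (v x, v y)) * (eta x - eta y) * K (x, y)] is nonpositive.
    But this integrand is nonnegative, and positive where [eta x != eta y]: if
    [eta y < eta x] then [v x - v y < u x - u y] (lemma [excess_le]), and [L]
    increases strictly with the difference of its arguments ([Lpow_lt]). Hence
    [eta x = eta y] for almost every pair. As [eta] vanishes on the complement
    of [Omega], a set of positive measure, it vanishes almost everywhere, which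
    is the claim ([form_comparison]).

    Truncating at 1 makes [eta] bounded. Away from the support of [eta] the
    kernel decays like the weight of the tail space, so there the integrand is
    at most [|w x|^(p-1) + |w y|^(p-1)] times this weight, up to a constant; near it
    Young's inequality bounds it by the Gagliardo densities of [w] and [eta]
    ([form_density_le]). Both forms are therefore absolutely convergent
    ([integrable_form_density]), which the subtraction and the splitting of the
    obstacle form ([integral_split_symmetric]) require.

    A supersolution is tested with smooth functions, and [eta] is not smooth. It
    is mollified ([smooth_approximation]): the averages [eta_k] are smooth with
    support close to [Omega], converge to [eta] almost everywhere along suitable
    scales, and their Gagliardo energies stay bounded, by Jensen's inequality.
    These bounds suffice to pass to the limit ([form_density_limit]), as long as
    only an inequality is wanted. Young's inequality with a parameter [t] bounds the
    form density of [eta_k] by a fixed integrable function plus [t^(1-p)] times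
    a Gagliardo density whose integral is bounded in [k]; Fatou's lemma then
    shows that the limit form is at least [- C * t^(1-p)], and [t] is arbitrary.

    The functions and the kernel are only measurable for the completed measure.
    Each is replaced by a measurable function that agrees with it almost everywhere
    ([completed_measurable_ae], [kernel_version]); integrals do not see the
    difference ([ae_eq_integral_gen]). *)

Set Implicit Arguments.
Unset Strict Implicit.
Unset Printing Implicit Defensive.

Import Order.TTheory GRing.Theory Num.Theory.
Import numFieldNormedType.Exports.

Local Open Scope classical_set_scope.
Local Open Scope ring_scope.

(** * Integration modulo null sets, without measurability *)

Section ae_nonmeasurable.
Context d (T : measurableType d) (R : realType) (mu : {measure set T -> \bar R}).
Local Open Scope ereal_scope.
Import HBNNSimple.

(** The integral is a supremum over the simple functions below the integrand.
    Killing such a function on the exceptional null set preserves its integral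
    and brings it below [g], so neither function has to be measurable. *)
Lemma ge0_ae_le_integralT (f g : T -> \bar R) :
    (forall x, 0 <= f x) -> (forall x, 0 <= g x) ->
  {ae mu, forall x, f x = g x} -> \int[mu]_x f x <= \int[mu]_x g x.
Proof.
move=> f0 g0 [N [mN N0 fgN]].
rewrite [leLHS]ge0_integralTE// [leRHS]ge0_integralTE//.
apply/ge_ereal_sup => /= _ [h hf <-].
have mNC : measurable (~` N) by exact: measurableC.
pose h' := mul_nnsfun h (indic_nnsfun R mNC).
have -> : sintegral mu h = sintegral mu h'.
  rewrite -!integralT_nnsfun; apply: ge0_ae_eq_integral => //.
  - exact/measurable_EFinP.
  - exact/measurable_EFinP.
  - by move=> x _; rewrite lee_fin.
  - by move=> x _; rewrite lee_fin.
  - exists N; split => // x /= /not_implyP[_].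
    apply: contra_notP => Nx.
    by rewrite /= /mindic indicE mem_set ?mulr1.
apply: ereal_sup_ubound; exists h' => // x /=; rewrite /mindic.
rewrite indicE; have [xN|xN] := boolP (x \in ~` N).
  rewrite mulr1 (le_trans (hf x))//.
  have -> // : f x = g x.
  by apply: contrapT => fg; move: xN; rewrite inE; apply; exact: fgN.
by rewrite mulr0.
Qed.

Lemma ge0_ae_eq_integralT (f g : T -> \bar R) :
    (forall x, 0 <= f x) -> (forall x, 0 <= g x) ->
  {ae mu, forall x, f x = g x} -> \int[mu]_x f x = \int[mu]_x g x.
Proof.
move=> f0 g0 fg; apply/eqP; rewrite eq_le !ge0_ae_le_integralT//.
by apply: filterS fg => x ->.
Qed.

Lemma ae_eq_integral_gen (D : set T) (f g : T -> \bar R) :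
  {ae mu, forall x, D x -> f x = g x} ->
  \int[mu]_(x in D) f x = \int[mu]_(x in D) g x.
Proof.
move=> fg; rewrite integralE [RHS]integralE.
rewrite !(integral_mkcond D).
by congr (_ - _); apply: ge0_ae_eq_integralT => [x|x|];
  rewrite ?erestrict_ge0//; apply: filterS fg => x fg;
  rewrite /patch; case: ifPn => // /set_mem/fg; rewrite ?funeposE ?funenegE => ->.
Qed.

End ae_nonmeasurable.

Section completion.
Context d (T : measurableType d) (R : realType) (mu : {measure set T -> \bar R}).

(** [f x] is the supremum of the rationals [q] below it, that is, of those with
    [x] in [{f > q}]. Replacing each of these countably many sets by its
    measurable part gives a measurable supremum, which can differ from [f] only
    on the union of the negligible parts. *)
Lemma completed_measurable_ae (D : set T) (f : T -> R) :
    measurable D -> completed_measurable_fun mu D f ->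
  exists2 f' : T -> R, measurable_fun [set: T] f' &
    {ae mu, forall x, D x -> f x = f' x}.
Proof.
move=> mD mf.
have ex (q : rat) : exists A, measurable A /\
    exists2 N, mu.-negligible N & A `|` N = D `&` f @^-1` `]ratr q, +oo[%classic.
  by have [A mA [N Nn AN]] := mf `]ratr q, +oo[%classic (measurable_itv _); exists A; split => //; exists N.
have /choice[A HA] := ex.
have mA q : measurable (A q) by have [] := HA q.
have /choice[N HN] : forall q, exists N, mu.-negligible N /\
     A q `|` N = D `&` f @^-1` `]ratr q, +oo[%classic.
  by move=> q; have [_ [N ? ?]] := HA q; exists N.
(* enumerating the rationals; [-oo] is the neutral value for the supremum *)
pose a (k : nat) (x : T) : \bar R :=
  if unpickle k is Some q then (if x \in A q then (ratr q)%:E else -oo)%E else -oo%E.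
pose F x := ereal_sup (range (a ^~ x)).
have ma k : measurable_fun [set: T] (a k).
  rewrite /a; case: unpickle => [q|]; last exact: measurable_cst.
  apply: measurable_fun_ifT => //; try exact: measurable_cst.
  apply: (measurable_fun_bool true).
  rewrite setTI [X in measurable X](_ : _ = A q)//.
  by apply/seteqP; split=> x /=; [exact: set_mem|exact: mem_set].
have mF : measurable_fun [set: T] F.
  rewrite (_ : F = (fun x => esups (a ^~ x) 0%N)); last first.
    apply/funext => x; rewrite /F /esups/= /sdrop; congr ereal_sup.
    by apply/seteqP; split => y [k kk <-]; exists k.
  exact: measurable_fun_esups.
exists (fine \o F); first exact: (measurableT_comp (@fine_measurable _ setT measurableT)).
have NN : mu.-negligible (\bigcup_(k : nat) (if unpickle k is Some q then N q else set0)).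
  apply: negligible_bigcup => k; case: unpickle => [q|]; last exact: negligible_set0.
  by have [] := HN q.
apply: negligibleS NN => x /= /not_implyP[Dx fx].
apply: contrapT => nN; apply: fx.
have unp (q : rat) : exists k : nat, unpickle k = Some q.
  by exists (pickle q); rewrite pickleK.
have nNq q : ~ N q x.
  by move=> Nq; have [k kq] := unp q; apply: nN; exists k => //; rewrite kq.
have Aq q : x \in A q = (ratr q < f x).
  apply/idP/idP => [/set_mem Ax|qx].
    have [_ e] := HN q; have : (A q `|` N q) x by left.
    by rewrite e => -[_] /=; rewrite in_itv/= andbT.
  have [_ e] := HN q; apply/mem_set.
  have : (A q `|` N q) x by rewrite e; split => //=; rewrite in_itv/= andbT.
  by case=> // /nNq.
suff -> : F x = (f x)%:E by [].
apply/eqP; rewrite eq_le; apply/andP; split.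
  apply/ge_ereal_sup => _ [k _ <-]; rewrite /a; case: unpickle => [q|]; last exact: leNye.
  by rewrite Aq; case: ifPn => [/ltW|_]; [rewrite lee_fin|exact: leNye].
apply/lee_subgt0Pr => e e0.
have /rat_in_itvoo[q] : f x - e < f x by rewrite ltrBlDr ltrDl.
rewrite in_itv/= => /andP[q1 q2].
rewrite -EFinB; apply: (@le_trans _ _ (ratr q)%:E); first by rewrite lee_fin ltW.
have [k kq] := unp q.
by apply: ereal_sup_ubound; exists k => //; rewrite /a kq Aq q2.
Qed.

Lemma ae_completed_measurable (D : set T) (f f' : T -> R) :
    measurable D -> measurable_fun [set: T] f' ->
    {ae mu, forall x, D x -> f x = f' x} ->
  completed_measurable_fun mu D f.
Proof.
move=> mD mf' [N [mN N0 ff']] Y mY.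
exists ((D `&` f' @^-1` Y) `\` N).
  apply: measurableD => //; apply: measurableI => //.
  by rewrite -[X in measurable X]setTI; exact: mf'.
exists (D `&` f @^-1` Y `&` N).
  by apply: (negligibleS (@subIsetr _ _ N)); exact/negligibleP.
have ffx x : D x -> ~ N x -> f x = f' x.
  by move=> Dx nN; apply: contrapT => nff; apply/nN/ff' => /(_ Dx).
apply/seteqP; split => x /=.
  move=> [[[Dx Yx] nN]|[]//]; split => //.
  by rewrite ffx.
move=> [Dx Yx]; have [Nx|nN] := pselect (N x); [by right|left; split => //; split => //].
by rewrite -ffx.
Qed.

End completion.

(** * Translation invariance of Lebesgue measure *)

Section translation.
Context (R : realType).

Lemma measurable_rV_shift n (c : 'rV[R]_n) :
  measurable_fun [set: 'rV[R]_n] (fun x => x + c).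
Proof.
apply/measurable_fun_rVP => i; under eq_fun do rewrite mxE.
by apply: measurable_funD; [exact: measurable_coord|exact: measurable_cst].
Qed.

Lemma lebesgue_measure_shift (c : R) (A : set R) : measurable A ->
  lebesgue_measure ((fun x : R => x + c) @^-1` A) = lebesgue_measure A.
Proof.
have mf : measurable_fun [set: measurableTypeR R] (fun x : measurableTypeR R => (x + c : measurableTypeR R)).
  by apply: measurable_funD => //; exact: measurable_cst.
pose m' := [the measure _ _ of pushforward (@lebesgue_measure R) (fun x : measurableTypeR R => (x + c : measurableTypeR R))].
move=> mA; apply/esym.
rewrite -[RHS]/(m' mf A).
apply: lebesgue_measure_unique mA => _ [[a b]] _ <-.
rewrite /m' /= /pushforward.
rewrite [X in _ = _ X](_ : _ = `]a - c, b - c]%classic).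
  rewrite !lebesgue_measure_itv/= !lte_fin ltrD2r.
  by case: ifPn => // _; rewrite -!EFinB opprB addrA subrK.
by apply/seteqP; split => x /=; rewrite !in_itv/= ltrBlDr lerBrDr.
Qed.

(** By induction on the dimension: the image of a product measure under a shift
    takes the same values on rectangles, hence is the same measure. *)
Lemma lebesgue_rV_shift n (c : 'rV[R]_n) (A : set 'rV[R]_n) : measurable A ->
  lebesgue_rV R n ((fun x => x + c) @^-1` A) = lebesgue_rV R n A.
Proof.
elim: n c A => [|n IH] c A mA.
  by congr (lebesgue_rV R 0 _); apply/seteqP; split => x /=; rewrite (thinmx0 (x + c)) (thinmx0 x).
pose c' := \row_(i < n) c ord0 (lift ord0 i).
pose S (z : measurableTypeR R * 'rV[R]_n) : measurableTypeR R * 'rV[R]_n := (z.1 + c ord0 ord0, z.2 + c').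
have mS : measurable_fun setT S.
  apply/measurable_fun_pairP; split.
    by apply: measurable_funD; [exact: measurable_fst|exact: measurable_cst].
  exact: (measurableT_comp (@measurable_rV_shift n c') measurable_snd).
pose P := product_measure1 (@lebesgue_measure R) (lebesgue_rV R n).
pose m' := [the measure _ _ of pushforward P S].
have PE X : measurable X -> P X = m' mS X.
  apply: (@product_measure_unique _ _ (measurableTypeR R) _ R (@lebesgue_measure R)
    (lebesgue_rV R n)) => B C mB mC.
  rewrite /m' /= /pushforward.
  rewrite (_ : S @^-1` (B `*` C) = ((fun x : R => x + c ord0 ord0) @^-1` B) `*` ((fun x => x + c') @^-1` C))//.
  rewrite /P product_measure1E.
  - by congr (_ * _)%E; [exact: lebesgue_measure_shift|exact: IH].
  - rewrite -[X in measurable X]setTI.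
    by apply: (measurable_funD (@measurable_id _ _ setT) (measurable_cst (c ord0 ord0))).
  - by rewrite -[X in measurable X]setTI; apply: measurable_rV_shift.
have mC : measurable (@rV_cons R n @^-1` A).
  by rewrite -[X in measurable X]setTI; exact: measurable_rV_cons.
rewrite /= /lebesgue_rV_step /pushforward.
rewrite -/P [RHS]PE// /m' /= /pushforward; congr (P _).
apply/seteqP; split => -[a x] /=; rewrite /S/=.
  suff -> : rV_cons (a, x) + c = rV_cons (a + c ord0 ord0, x + c') by [].
  apply/rowP => i; rewrite !mxE; case: (unliftP ord0 i) => [j|] -> /=; last by [].
  by rewrite !mxE.
suff -> : rV_cons (a, x) + c = rV_cons (a + c ord0 ord0, x + c') by [].
apply/rowP => i; rewrite !mxE; case: (unliftP ord0 i) => [j|] -> /=; last by [].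
by rewrite !mxE.
Qed.

Context (n : nat).
Local Notation mu := (lebesgue_rV R n).
Local Open Scope ereal_scope.

Lemma ge0_integral_shift (c : 'rV[R]_n) (f : 'rV[R]_n -> \bar R) :
  measurable_fun [set: 'rV[R]_n] f -> (forall x, 0 <= f x) ->
  \int[mu]_x f (x + c)%R = \int[mu]_x f x.
Proof.
move=> mf f0.
transitivity (\int[pushforward mu (fun x => x + c)%R]_x f x).
  by rewrite ge0_integral_pushforward//; exact: measurable_rV_shift.
apply: (eq_measure_integral mu) => [|? A mA _]; first exact: measurable_rV_shift.
exact: lebesgue_rV_shift.
Qed.

(** Moving both variables together is a shift in each of the two iterated
    integrals. *)
Lemma ge0_integral_shift2 (c : 'rV[R]_n) (f : 'rV[R]_n * 'rV[R]_n -> \bar R) :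
  measurable_fun setT f -> (forall z, 0 <= f z) ->
  \int[mu \x mu]_z f (z.1 + c, z.2 + c)%R = \int[mu \x mu]_z f z.
Proof.
move=> mf f0.
have mS : measurable_fun [set: 'rV[R]_n * 'rV[R]_n] (fun z => (z.1 + c, z.2 + c)%R).
  apply/measurable_fun_pairP; split.
    exact: (measurableT_comp (@measurable_rV_shift n c) measurable_fst).
  exact: (measurableT_comp (@measurable_rV_shift n c) measurable_snd).
rewrite fubini_tonelli1//; last exact: (measurableT_comp mf mS).
rewrite fubini_tonelli1//.
rewrite -(@ge0_integral_shift c (fubini_F mu f)).
- apply: eq_integral => x _; rewrite /fubini_F/=.
  rewrite (@ge0_integral_shift c (fun y => f (x + c, y)%R))//.
  exact: measurable_fun_pair2.
- exact: measurable_fun_fubini_tonelli_F.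
- by move=> x; exact: integral_ge0.
Qed.

Lemma ge0_integral_swap (f : 'rV[R]_n * 'rV[R]_n -> \bar R) :
  measurable_fun setT f -> (forall z, 0 <= f z) ->
  \int[mu \x mu]_z f (z.2, z.1) = \int[mu \x mu]_z f z.
Proof.
move=> mf f0.
have mS : measurable_fun [set: 'rV[R]_n * 'rV[R]_n] (fun z => (z.2, z.1)) by exact: measurable_swap.
rewrite fubini_tonelli1//; last exact: (measurableT_comp mf mS).
by rewrite fubini_tonelli1// [RHS]fubini_tonelli.
Qed.

Lemma ae_swap (P : 'rV[R]_n * 'rV[R]_n -> Prop) :
  {ae mu \x mu, forall z, P z} -> {ae mu \x mu, forall z, P (z.2, z.1)}.
Proof.
move=> [N [mN N0 PN]].
have mS : measurable ((fun z : 'rV[R]_n * 'rV[R]_n => (z.2, z.1)) @^-1` N).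
  by rewrite -[X in measurable X]setTI; exact: measurable_swap.
exists ((fun z => (z.2, z.1)) @^-1` N); split => //.
  transitivity (\int[mu \x mu]_z (\1_((fun z => (z.2, z.1)) @^-1` N) z)%:E).
    by rewrite integral_indic// setIT.
  rewrite -[RHS]N0 -[in RHS](setIT N) -integral_indic//.
  rewrite -[RHS]ge0_integral_swap//.
  exact/measurable_EFinP/measurable_indic.
by move=> z /= Pz; apply: PN.
Qed.

Lemma ae_fst (P : 'rV[R]_n -> Prop) :
  {ae mu, forall x, P x} -> {ae mu \x mu, forall z, P z.1}.
Proof.
move=> [N [mN N0 PN]]; exists (N `*` setT); split.
- exact: measurableX.
- by rewrite product_measure1E// [X in X * _]N0 mul0e.
- by move=> z /= Pz; split => //=; exact: PN.
Qed.

Lemma ae_snd (P : 'rV[R]_n -> Prop) :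
  {ae mu, forall x, P x} -> {ae mu \x mu, forall z, P z.2}.
Proof. by move=> /ae_fst/ae_swap. Qed.

End translation.

(** * Norms, cubes and neighbourhoods of sets *)

Section norms.
Context (R : realType) (n : nat).
Implicit Types (x y : 'rV[R]_n) (r : R).

Lemma coord_le_norm x (i : 'I_n) : `|x ord0 i| <= `|x|.
Proof.
rewrite [leRHS]/Num.norm /= mx_normrE; apply/bigmax_geP; right => /=.
by exists (ord0, i).
Qed.

Lemma norm_le_coord x r : 0 <= r -> (forall i, `|x ord0 i| <= r) -> `|x| <= r.
Proof.
move=> r0 xr; rewrite [leLHS]/Num.norm /= mx_normrE; apply/bigmax_leP; split => //.
by move=> [i j] _ /=; rewrite (ord1 i).
Qed.

Lemma norm_lt_coord x r : 0 < r -> (`|x| < r) <-> (forall i, `|x ord0 i| < r).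
Proof.
move=> r0; split => [xr i|xr]; first by rewrite (le_lt_trans (coord_le_norm _ _)).
rewrite [ltLHS]/Num.norm /= mx_normrE; apply/bigmax_ltP; split => //.
by move=> [i j] _ /=; rewrite (ord1 i).
Qed.

Lemma norm_le_enorm x : `|x| <= enorm x.
Proof.
apply: norm_le_coord => [|i]; first exact: sqrtr_ge0.
rewrite -sqrtr_sqr ler_wsqrtr// (bigD1 i)//= lerDl sumr_ge0// => j _.
exact: sqr_ge0.
Qed.

Lemma enorm_le_norm x : enorm x <= n%:R * `|x|.
Proof.
have n0 : 0 <= n%:R * `|x| by rewrite mulr_ge0.
rewrite -[leRHS]ger0_norm// -sqrtr_sqr ler_wsqrtr//.
apply: (@le_trans _ _ (\sum_(i < n) `|x| ^+ 2)).
  apply: ler_sum => i _; rewrite -[leLHS]real_normK ?num_real//.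
  by rewrite ler_sqr ?nnegrE// coord_le_norm.
rewrite sumr_const card_ord -[leLHS]mulr_natl exprMn ler_wpM2r ?sqr_ge0//.
by rewrite -natrX ler_nat; case: (n) => // k; rewrite expnS expn1 leq_pmulr.
Qed.

Lemma enorm_ge0 x : 0 <= enorm x.
Proof. exact: sqrtr_ge0. Qed.

Lemma enormN x : enorm (- x) = enorm x.
Proof. by congr Num.sqrt; apply: eq_bigr => i _; rewrite mxE sqrrN. Qed.

Lemma measurable_enorm : measurable_fun [set: 'rV[R]_n] (@enorm R n).
Proof.
have ms : measurable_fun [set: R] (@Num.sqrt R).
  exact: (continuous_measurable_fun (@sqrt_continuous R)).
apply: (measurableT_comp ms).
by apply: measurable_sum => i; apply: measurable_funX; exact: measurable_coord.
Qed.

End norms.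

Section open_measurable.
Context (R : realType) (n : nat).

Definition cube (c : 'rV[R]_n) (r : R) : set 'rV[R]_n :=
  [set x | forall i, `]c ord0 i - r, c ord0 i + r[%classic (x ord0 i)].

Lemma measurable_cube c r : measurable (cube c r).
Proof.
rewrite (_ : cube c r = \bigcap_(i in [set: 'I_n])
    ((fun x : 'rV[R]_n => x ord0 i) @^-1` `]c ord0 i - r, c ord0 i + r[%classic)).
  apply: fin_bigcap_measurable => // i _.
  by rewrite -[X in measurable X]setTI; exact: measurable_coord.
by apply/seteqP; split => x /= Ax i; [move=> _; exact: Ax|exact: Ax].
Qed.

Lemma cubeE c r : 0 < r -> cube c r = [set x | `|x - c| < r].
Proof.
move=> r0; apply/seteqP; split => x /=.
  move=> cx; apply/norm_lt_coord => // i; rewrite !mxE ltr_distl.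
  by move: (cx i); rewrite /= in_itv/=.
move=> /(norm_lt_coord _ r0) xc i; rewrite /= in_itv/=.
by have := xc i; rewrite !mxE ltr_distl.
Qed.

Lemma lebesgue_cube c r : 0 <= r ->
  lebesgue_rV R n (cube c r) = ((r *+ 2) ^+ n)%:E.
Proof.
move=> r0; rewrite /cube (@lebesgue_rV_box R n (fun i => `]c ord0 i - r, c ord0 i + r[%classic))//.
under eq_bigr do rewrite lebesgue_measure_itv/= lte_fin.
rewrite (eq_bigr (fun=> (r *+ 2)%:E)); last first.
  move=> i _; case: ifPn => [_|]; first by rewrite -EFinB; congr EFin; ring.
  rewrite -leNgt => h; congr EFin; apply/eqP; rewrite eq_le mulrn_wge0//=; lra.
by rewrite prodEFin prodr_const card_ord.
Qed.

(** The sigma-algebra is generated by the coordinates; an open set belongs to it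
    as the union of the countably many rational cubes that it contains. *)
Lemma open_measurable_rV (U : set 'rV[R]_n) : open U -> measurable U.
Proof.
move=> oU.
pose c (q : 'rV[rat]_n) : 'rV[R]_n := \row_i ratr (q ord0 i).
pose F (qk : 'rV[rat]_n * nat) : set 'rV[R]_n :=
  if pselect (cube (c qk.1) qk.2.+1%:R^-1 `<=` U) then cube (c qk.1) qk.2.+1%:R^-1 else set0.
have -> : U = \bigcup_qk F qk.
  apply/seteqP; split => x; last first.
    by move=> [qk _]; rewrite /F; case: pselect => // h /h.
  move=> Ux.
  have /nbhs_ballP[e /= e0 eU] : nbhs x U by exact: open_nbhs_nbhs.
  have [k ke] : exists k : nat, k.+1%:R^-1 < e / 2.
    have [k _ hk] := near_infty_natSinv_lt (PosNum (divr_gt0 e0 (ltr0n _ 2))).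
    by exists k; exact: (hk k (leqnn k)).
  have k0 : 0 < k.+1%:R^-1 :> R by rewrite invr_gt0.
  have /choice[q Hq] : forall i : 'I_n, exists q : rat, `|x ord0 i - ratr q| < k.+1%:R^-1.
    move=> i; have /rat_in_itvoo[q] : x ord0 i - k.+1%:R^-1 < x ord0 i + k.+1%:R^-1.
      by rewrite ltrBlDr -addrA ltrDl addr_gt0.
    by rewrite in_itv/= => /andP[h1 h2]; exists q; rewrite ltr_distlC h1.
  have xq : `|x - c (\row_i q i)| < k.+1%:R^-1.
    by apply/norm_lt_coord => // i; rewrite !mxE; exact: Hq.
  have qU : cube (c (\row_i q i)) k.+1%:R^-1 `<=` U.
    rewrite cubeE// => y /= yq; apply: eU.
    rewrite -ball_normE /ball_/=.
    rewrite -(subrK (c (\row_i q i)) x) -addrA (le_lt_trans (ler_normD _ _))//.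
    rewrite [X in _ + X](_ : _ = `|y - c (\row_i q i)|); last by rewrite distrC.
    move: ke xq yq; move: (k.+1%:R^-1) => d; lra.
  exists (\row_i q i, k) => //; rewrite /F /=.
  by case: pselect => [h|//] /=; rewrite cubeE.
apply: countable_bigcupT_measurable; first exact: countableP.
by move=> qk; rewrite /F; case: pselect => [h|h] //=; exact: measurable_cube.
Qed.

Lemma continuous_measurable_rV (f : 'rV[R]_n -> R) :
  continuous f -> measurable_fun [set: 'rV[R]_n] f.
Proof.
move=> cf; apply: (measurability _ (RGenOInfty.measurableE R)) => //.
move=> _ [_ [a ->] <-]; rewrite setTI; apply: open_measurable_rV.
by move/continuousP : cf; apply; exact: interval_open.
Qed.

End open_measurable.

Section thickening.
Context (R : realType) (n : nat).
Implicit Types (A U : set 'rV[R]_n) (r M : R).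

Definition thicken A r : set 'rV[R]_n := [set x | exists2 y, A y & `|x - y| < r].

Lemma open_thicken A r : open (thicken A r).
Proof.
rewrite openE => x [y Ay xyr]; rewrite /interior.
apply/nbhs_ballP; exists (r - `|x - y|); first by rewrite /= subr_gt0.
move=> z; rewrite -ball_normE /ball_/= => xz; exists y => //.
by rewrite -(subrK x z) -addrA (le_lt_trans (ler_normD _ _))// distrC; lra.
Qed.

Lemma sub_thicken A r : 0 < r -> A `<=` thicken A r.
Proof. by move=> r0 x Ax; exists x => //; rewrite subrr normr0. Qed.

Lemma thickenS A r r' : r <= r' -> thicken A r `<=` thicken A r'.
Proof. by move=> rr' x [y Ay xy]; exists y => //; rewrite (lt_le_trans xy). Qed.

Lemma thicken_shift A r r' x z : thicken A r x -> `|z| <= r' -> thicken A (r + r') (x + z).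
Proof.
move=> [y Ay xy] zr; exists y => //.
by rewrite addrAC (le_lt_trans (ler_normD _ _))// ltr_leD.
Qed.

Lemma closure_thicken A r r' : r < r' -> closure (thicken A r) `<=` thicken A r'.
Proof.
move=> rr' x clx.
have [z [[y Ay zy]]] : thicken A r `&` ball x (r' - r) !=set0.
  by apply: clx; apply: nbhsx_ballx; rewrite subr_gt0.
rewrite -ball_normE /ball_/= => xz; exists y => //.
by rewrite -(subrK z x) -addrA (le_lt_trans (ler_normD _ _))//; lra.
Qed.

Lemma compact_closure_thicken A r M : (forall x, A x -> `|x| <= M) ->
  compact (closure (thicken A r)).
Proof.
move=> AM; apply: bounded_closed_compact; last exact: closed_closure.
exists (M + (r + 1)); split; first exact: num_real.
move=> N MN x /(@closure_thicken _ _ (r + 1)) h.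
have [|y Ay xy] := h; first by lra.
rewrite /= -(subrK y x) (le_trans (ler_normD _ _))//.
by have := AM _ Ay; lra.
Qed.

(** Compactness makes the radius uniform. *)
Lemma thicken_sub A U : compact (closure A) -> closure A `<=` U -> open U ->
  exists2 r, 0 < r & thicken A r `<=` U.
Proof.
move=> cA AU oU.
have /compact_near_coveringP nc := cA.
have := nc R (0^'+) (fun r x => forall y, `|y - x| < r -> U y) _.
case.
  move=> x Ax.
  have /nbhs_ballP[e /= e0 eU] : nbhs x U by apply: open_nbhs_nbhs; split => //; exact: AU.
  exists (ball x (e / 2), [set r | r < e / 2]) => /=.
    split; first by apply: nbhsx_ballx; rewrite divr_gt0.
    by apply: nbhs_right_lt; rewrite divr_gt0.
  move=> [x' r] /= [xx' re] y yx; apply: eU.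
  move: xx'; rewrite -!ball_normE /ball_/= => xx'.
  rewrite -(subrK x' x) -addrA (le_lt_trans (ler_normD _ _))//.
  by rewrite (distrC x' y); lra.
move=> e /= e0 h; exists (e / 2); first by rewrite divr_gt0.
move=> x [y Ay xy].
apply: (h (e / 2) _ _ y) => //.
- by rewrite /= sub0r normrN gtr0_norm ?divr_gt0//; lra.
- by rewrite divr_gt0.
- exact: subset_closure.
Qed.

(** While [x] stays in a bounded set and [y] stays at distance at least [r] from
    it, [1 + |y|] grows at most linearly in [|x - y|]. This turns the decay of
    the kernel in [|x - y|] into the decay of the tail weight in [|y|]. *)
Lemma far_enorm A r M : 0 < r -> 0 <= M -> (forall x, A x -> `|x| <= M) ->
  exists2 c, 0 < c & forall x y, thicken A r x -> ~ thicken A (2 * r) y ->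
    1 + enorm y <= c * enorm (x - y).
Proof.
move=> r0 M0 AM; exists ((n%:R + 1) * ((1 + M + r) / r + 1)).
  have q0 : 0 <= (1 + M + r) / r by apply: divr_ge0; lra.
  have n0 : 0 <= n%:R :> R by [].
  by apply: mulr_gt0; lra.
move=> x y [a Aa xa] nAy.
have ya : 2 * r <= `|y - a| by rewrite leNgt; apply/negP => h; apply: nAy; exists a.
have xy : r <= `|x - y|.
  have : `|y - a| <= `|x - y| + `|x - a|.
    by rewrite (distrC x y); exact: ler_distD.
  lra.
have yM : `|y| <= M + r + `|x - y|.
  have : `|y| <= `|x - y| + (`|x - a| + `|a|).
    rewrite (distrC x y) -{1}(subrK x y) (le_trans (ler_normD _ _))// lerD2l.
    by rewrite -{1}(subrK a x) (le_trans (ler_normD _ _)).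
  have := AM _ Aa; lra.
have n0 : 0 <= n%:R :> R by [].
have q0 : 0 <= (1 + M + r) / r by apply: divr_ge0; lra.
apply: (@le_trans _ _ ((n%:R + 1) * (1 + `|y|))).
  by have := enorm_le_norm y; have := normr_ge0 y; nra.
apply: (@le_trans _ _ ((n%:R + 1) * ((1 + M + r) / r + 1) * `|x - y|)); last first.
  by rewrite ler_wpM2l ?norm_le_enorm// mulr_ge0//; lra.
rewrite -mulrA; apply: ler_wpM2l; first by rewrite addr_ge0.
rewrite mulrDl mul1r.
have : 1 + M + r <= (1 + M + r) / r * `|x - y|.
  rewrite -mulrA ler_peMr//; [lra|].
  by rewrite mulrC ler_pdivlMr// mul1r.
lra.
Qed.

Lemma measurable_thicken A r : measurable (thicken A r).
Proof. by apply: open_measurable_rV; exact: open_thicken. Qed.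

Lemma thicken_lty A r M : 0 < r -> 0 <= M -> (forall x, A x -> `|x| <= M) ->
  (lebesgue_rV R n (thicken A r) < +oo)%E.
Proof.
move=> r0 M0 AM.
apply: (@le_lt_trans _ _ (lebesgue_rV R n (cube 0 (M + r)))).
  apply: le_measure; rewrite ?inE; [exact: measurable_thicken|exact: measurable_cube|].
  rewrite cubeE; last lra.
  move=> x [y Ay xy]; rewrite /= subr0 -(subrK y x) (le_lt_trans (ler_normD _ _))//.
  by have := AM _ Ay; lra.
by rewrite lebesgue_cube ?ltry//; lra.
Qed.

End thickening.

(** * Integrability of the tail weight *)

Section weight.
Context (R : realType) (n : nat).
Local Notation mu := (lebesgue_rV R n).

Lemma measurable_powR_fun d (T : measurableType d) (f : T -> R) (a : R) :
  measurable_fun setT f -> measurable_fun setT (fun x => f x `^ a).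
Proof. by move=> mf; exact: (measurableT_comp (measurable_powR a) mf). Qed.

Lemma measurable_weight (q : R) :
  measurable_fun [set: 'rV[R]_n] (fun y => (1 + enorm y) `^ q).
Proof.
apply: measurable_powR_fun; apply: measurable_funD => //.
exact: measurable_enorm.
Qed.

(** On the shell [2^(k-1) <= |y| < 2^k] the weight is at most
    [(2^k / 2)^(- n - a)], while the cube of radius [2^k] has volume
    [2^n * 2^(k n)]; the sum over [k] is geometric with ratio [2^(- a)]. *)
Lemma integral_weight_lty (a : R) : 0 < a ->
  (\int[mu]_y ((1 + enorm y) `^ (- n%:R - a))%:E < +oo)%E.
Proof.
move=> a0; pose q := n%:R + a.
have q0 : 0 < q by rewrite ltr_wpDl.
have qE : - n%:R - a = - q by rewrite /q opprD.
pose z := (2 : R) `^ (- q).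
have z0 : 0 < z by exact: powR_gt0.
pose B k := @cube R n 0 (2 ^+ k).
pose f k (y : 'rV[R]_n) : \bar R := ((2 `^ q) * z ^+ k * \1_(B k) y)%:E.
have mB k : measurable (B k) by exact: measurable_cube.
have mf k : measurable_fun setT (f k).
  by apply/measurable_EFinP; apply: measurable_funM => //; exact: measurable_indic.
have c0 k : 0 <= (2 : R) `^ q * z ^+ k by rewrite mulr_ge0 ?powR_ge0// exprn_ge0// ltW.
have f0 k y : (0 <= f k y)%E by rewrite lee_fin mulr_ge0.
have le k0 y : (f k0 y <= \sum_(0 <= k <oo) f k y)%E.
  rewrite (@nneseriesD1 _ _ k0) ?leeDl//; apply: nneseries_ge0 => *; exact: f0.
apply: (@le_lt_trans _ _ (\int[mu]_y (\sum_(0 <= k <oo) f k y))%E).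
  apply: ge0_le_integral => //.
  - by move=> y _; rewrite lee_fin powR_ge0.
  - by apply/measurable_EFinP; exact: measurable_weight.
  - by apply: ge0_emeasurable_sum => // k y _ _; exact: f0.
  move=> y _.
  have [k /= yk kmin] : exists2 k : nat, `|y| < 2 ^+ k & forall j, `|y| < 2 ^+ j -> (k <= j)%N.
    have ex : exists k : nat, `|y| < 2 ^+ k.
      exists (Num.trunc `|y|).+1.
      by rewrite (lt_trans (truncnS_gt _))// -natrX ltr_nat ltn_expl.
    by exists (ex_minn ex); case: ex_minnP.
  apply: le_trans (le k y).
  rewrite lee_fin indicE mem_set ?mulr1; last first.
    by rewrite /B cubeE ?exprn_gt0//= subr0.
  have pe : 1 + `|y| <= 1 + enorm y by rewrite lerD2l norm_le_enorm.
  have kE : (2 : R) `^ q * z ^+ k = (2 ^+ k / 2) `^ (- q).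
    rewrite powRM ?exprn_ge0// mulrC; congr (_ * _).
      by rewrite -(powR_mulrn k (ltW z0)) -(powR_mulrn k (ler0n R 2)) -!powRrM mulrC.
    by rewrite -powR_inv1// -powRrM mulN1r opprK.
  have kpos : 0 < (2 : R) ^+ k / 2 by rewrite divr_gt0// exprn_gt0.
  have ye : 2 ^+ k / 2 <= 1 + enorm y.
    apply: le_trans pe; case: (k) kmin => [_|j jmin].
      by rewrite expr0; have := normr_ge0 y; lra.
    rewrite exprS mulrC mulKf//; have [/jmin|] := ltP `|y| (2 ^+ j); first by rewrite ltnn.
    by have := @ler01 R; lra.
  rewrite kE qE !powRN lef_pV2 ?posrE ?powR_gt0//; last exact: lt_le_trans ye.
  by apply: ge0_ler_powR; rewrite ?nnegrE ?(ltW q0)// ltW// (lt_le_trans kpos).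
rewrite integral_nneseries//.
have zn : z * 2 ^+ n = (2 : R) `^ (- a).
  rewrite -powR_mulrn// -powRD ?pnatr_eq0 ?implybT//; congr (_ `^ _); rewrite /q; ring.
pose b := (2 : R) `^ (- a).
have b0 : 0 < b by exact: powR_gt0.
have b1 : b < 1.
  rewrite /b powRN invf_lt1 ?powR_gt0//.
  have h : (1 : R) `^ a < 2 `^ a by apply: gt0_ltr_powR; rewrite ?nnegrE// ltr1n.
  by move: h; rewrite powR1.
pose D := (2 : R) `^ q * 2 ^+ n.
have fE k : (\int[mu]_y f k y = (geometric D b k)%:E)%E.
  rewrite /f; under eq_integral do rewrite EFinM.
  rewrite ge0_integralZl//; last 2 first.
  - exact/measurable_EFinP/measurable_indic.
  - by rewrite lee_fin.
  have cB : mu (B k) = (((2 ^+ k) *+ 2) ^+ n)%:E by rewrite /B lebesgue_cube// exprn_ge0.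
  rewrite integral_indic// setIT [X in (_ * X)%E]cB -EFinM; congr EFin.
  have -> : (((2 : R) ^+ k) *+ 2) ^+ n = 2 ^+ n * (2 ^+ n) ^+ k.
    by rewrite -mulr_natl exprMn -!exprM mulnC.
  by rewrite /geometric/= /D /b -zn exprMn; ring.
apply: (@le_lt_trans _ _ (D / (1 - b))%:E); last exact: ltry.
apply: lime_le; first by apply: is_cvg_nneseries => k _ _; exact: integral_ge0.
apply: nearW => m; rewrite (eq_bigr (fun k => (geometric D b k)%:E)) => [|k _]; last exact: fE.
rewrite sumEFin lee_fin; apply: geometric_le_lim => //.
  by rewrite mulr_ge0 ?powR_ge0// exprn_ge0.
by rewrite gtr0_norm.
Qed.

End weight.

(** A unit cube centred at [(M + 1, .., M + 1)] misses [A]. In dimension 0 there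
    is no such room, hence the hypothesis on [n]. *)
Lemma setC_bounded_pos (R : realType) n (A : set 'rV[R]_n) (M : R) : (0 < n)%N ->
  measurable A -> (forall x, A x -> `|x| <= M) -> (0 < lebesgue_rV R n (~` A))%E.
Proof.
move=> n0 mA AM; pose c : 'rV[R]_n := const_mx (M + 1).
have sub : cube c 1 `<=` ~` A.
  move=> x xc /AM xM; have := xc (Ordinal n0); rewrite /= in_itv/= mxE => /andP[h _].
  have := le_trans (ler_norm _) (le_trans (coord_le_norm x (Ordinal n0)) xM).
  lra.
apply: (@lt_le_trans _ _ (lebesgue_rV R n (cube c 1))).
  by rewrite lebesgue_cube// lte_fin exprn_gt0// mulrn_wgt0.
apply: le_measure sub; rewrite inE; [exact: measurable_cube|exact: measurableC].
Qed.

(** * Pointwise inequalities *)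

Section pointwise.
Context (R : realType).
Implicit Types (a b p t : R).

Lemma normr_Lpow p a b : 1 < p -> `|Lpow p a b| = `|a - b| `^ (p - 1).
Proof.
move=> p1; rewrite /Lpow normrM ger0_norm ?powR_ge0// mulrC.
have -> : p - 2 = (p - 1) - 1 by ring.
by rewrite mulr_powRB1// subr_gt0.
Qed.

(** The sum is at most twice the larger term. *)
Lemma powR_normD_le p a b : 1 < p ->
  (`|a| + `|b|) `^ (p - 1) <= 2 `^ (p - 1) * (`|a| `^ (p - 1) + `|b| `^ (p - 1)).
Proof.
move=> p1; have p0 : 0 <= p - 1 by lra.
wlog ab : a b / `|a| <= `|b|.
  move=> h; have [/h//|/ltW/h] := leP `|a| `|b|.
  by rewrite addrC [X in _ * X]addrC.
apply: (@le_trans _ _ ((2 * `|b|) `^ (p - 1))).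
  by apply: ge0_ler_powR => //; rewrite ?nnegrE ?addr_ge0//; lra.
by rewrite powRM// ler_wpM2l ?powR_ge0// lerDr powR_ge0.
Qed.

(** A crude form of Young's inequality, by comparing [b] with [t * a]. What
    matters is that the factor of [b `^ p] tends to 0 as [t] grows. *)
Lemma young_split p t a b : 1 < p -> 0 < t -> 0 <= a -> 0 <= b ->
  a `^ (p - 1) * b <= t * a `^ p + t `^ (1 - p) * b `^ p.
Proof.
move=> p1 t0 a0 b0; have p0 : 0 < p by lra.
have [bta|tab] := leP b (t * a).
  apply: (@le_trans _ _ (t * a `^ p)); last by rewrite lerDl mulr_ge0 ?powR_ge0.
  by rewrite -(mulr_powRB1 a0 p0) mulrA [leLHS]mulrC; apply: ler_wpM2r; rewrite ?powR_ge0.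
apply: (@le_trans _ _ (t `^ (1 - p) * b `^ p)); last by rewrite lerDr mulr_ge0 ?powR_ge0// ltW.
rewrite -(mulr_powRB1 b0 p0) mulrCA [leLHS]mulrC; apply: ler_wpM2l => //.
have -> : 1 - p = - (p - 1) by ring.
rewrite powRN mulrC ler_pdivlMr ?powR_gt0// -powRM//; last exact: ltW.
by apply: ge0_ler_powR; rewrite ?nnegrE ?mulr_ge0 ?(ltW t0)//; [lra|rewrite mulrC ltW].
Qed.

(** As a function of [a - b], [Lpow p a b] is the odd power of exponent
    [p - 1]. *)
Lemma Lpow_lt p (a b c d : R) : 1 < p -> a - b < c - d -> Lpow p a b < Lpow p c d.
Proof.
move=> p1; rewrite /Lpow; move: (a - b) (c - d) => {a b c d}x y xy.
have p0 : 0 < p - 1 by lra.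
have ge0E z : 0 <= z -> `|z| `^ (p - 2) * z = z `^ (p - 1).
  move=> z0; rewrite ger0_norm// mulrC (_ : p - 2 = (p - 1) - 1); last by ring.
  exact: mulr_powRB1.
have le0E z : z <= 0 -> `|z| `^ (p - 2) * z = - (- z) `^ (p - 1).
  move=> z0; rewrite -normrN -[X in _ * X]opprK mulrN ge0E//; lra.
have [x0|x0] := leP 0 x.
  by rewrite !ge0E//; [apply: gt0_ltr_powR; rewrite ?nnegrE//; lra|lra].
have [y0|y0] := leP 0 y.
  rewrite le0E ?(ltW x0)// ge0E// (@lt_le_trans _ _ 0) ?powR_ge0// oppr_lt0 powR_gt0//; lra.
rewrite !le0E ?ltW// ltrN2; apply: gt0_ltr_powR; rewrite ?nnegrE//; lra.
Qed.

End pointwise.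

Lemma le_limn_einf (R : realType) (u v : (\bar R)^nat) :
  (forall k, u k <= v k)%E -> (limn_einf u <= limn_einf v)%E.
Proof.
move=> uv; rewrite !limn_einf_lim; apply: lee_lim; try exact: is_cvg_einfs.
apply: nearW => m; apply: le_ereal_inf_tmp => _ [k /= mk <-].
by apply: le_trans (uv k); apply: ereal_inf_lbound; exists k.
Qed.

(** * Absolute convergence and limits of the nonlocal form *)

Section integrable_helpers.
Context d (T : measurableType d) (R : realType) (mu : {measure set T -> \bar R}).

Lemma ge0_integrable (D : set T) (f : T -> R) : measurable_fun D f ->
  (forall x, D x -> 0 <= f x) -> (\int[mu]_(x in D) (f x)%:E < +oo)%E ->
  mu.-integrable D (EFin \o f).
Proof.
move=> mf f0 foo; apply/integrableP; split; first exact/measurable_EFinP.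
rewrite (eq_integral (fun x => (f x)%:E))// => x /set_mem Dx /=.
by rewrite ger0_norm ?f0.
Qed.

Lemma indic_mul_patch (D : set T) (f : T -> R) :
  (fun x => (\1_D x * f x)%:E) = (EFin \o f) \_ D.
Proof.
apply/funext => x; rewrite /patch indicE.
by case: ifPn => _; rewrite ?mul1r ?mul0r.
Qed.

Lemma integrable_indic_mul (D : set T) (f : T -> R) : measurable D ->
  mu.-integrable D (EFin \o f) -> mu.-integrable setT (fun x => (\1_D x * f x)%:E).
Proof. by move=> mD iD; rewrite indic_mul_patch -integrable_mkcond. Qed.

Lemma integral_indic_mul (D : set T) (f : T -> R) :
  (\int[mu]_x (\1_D x * f x)%:E = \int[mu]_(x in D) (f x)%:E)%E.
Proof. by rewrite [RHS]integral_mkcond -indic_mul_patch. Qed.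

Lemma integrable_eqT (f g : T -> \bar R) : mu.-integrable setT f -> f =1 g ->
  mu.-integrable setT g.
Proof. by move=> fi /funext <-. Qed.

Lemma integrable_RintegralE (f : T -> R) : mu.-integrable setT (EFin \o f) ->
  (\int[mu]_x (f x)%:E)%E = (Rintegral mu setT f)%:E.
Proof. by move=> fi; rewrite /Rintegral fineK//; exact: integrable_fin_num. Qed.

End integrable_helpers.

Lemma integrable_tensor d1 d2 (T1 : measurableType d1) (T2 : measurableType d2)
    (R : realType) (m1 : {sigma_finite_measure set T1 -> \bar R})
    (m2 : {sigma_finite_measure set T2 -> \bar R}) (a : T1 -> R) (b : T2 -> R) :
  (forall x, 0 <= a x) -> (forall x, 0 <= b x) ->
  m1.-integrable setT (EFin \o a) -> m2.-integrable setT (EFin \o b) ->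
  (m1 \x m2)%E.-integrable setT (fun z => (a z.1 * b z.2)%:E).
Proof.
move=> a0 b0 ia ib.
have /measurable_EFinP ma := measurable_int _ ia.
have /measurable_EFinP mb := measurable_int _ ib.
have mab : measurable_fun setT (fun z : T1 * T2 => a z.1 * b z.2).
  by apply: measurable_funM; apply: measurableT_comp.
apply: ge0_integrable => //; first by move=> z _; rewrite mulr_ge0.
rewrite fubini_tonelli1//; last 2 first.
- exact/measurable_EFinP.
- by move=> z; rewrite lee_fin mulr_ge0.
have E x : fubini_F m2 (fun z => (a z.1 * b z.2)%:E) x = ((a x * Rintegral m2 setT b)%:E)%E.
  rewrite /fubini_F/=; under eq_integral do rewrite EFinM.
  rewrite ge0_integralZl//; last 3 first.
  - exact/measurable_EFinP.
  - by move=> y _; rewrite lee_fin.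
  - by rewrite lee_fin.
  by rewrite integrable_RintegralE// EFinM.
under eq_integral do rewrite E EFinM.
rewrite ge0_integralZr//; last 3 first.
- exact/measurable_EFinP.
- by move=> y _; rewrite lee_fin.
- by rewrite lee_fin; apply: Rintegral_ge0.
by rewrite integrable_RintegralE// -EFinM ltry.
Qed.

Section energy.
Context (R : realType) (n : nat).
Local Notation mu := (lebesgue_rV R n).
Local Notation V := ('rV[R]_n).
Implicit Types (w zeta : V -> R) (z : V * V).

Definition gagliardo_density (s p : R) w z : R :=
  `|w z.1 - w z.2| `^ p / enorm (z.1 - z.2) `^ (n%:R + s * p).

Definition form_density (p : R) (k : V * V -> R) w zeta z : R :=
  Lpow p (w z.1) (w z.2) * (zeta z.1 - zeta z.2) * k z.

Lemma gagliardo_density_ge0 s p w z : 0 <= gagliardo_density s p w z.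
Proof. by rewrite divr_ge0 ?powR_ge0. Qed.

Lemma measurable_comp1 w : measurable_fun setT w -> measurable_fun setT (fun z => w z.1).
Proof. by move=> mw; apply: measurableT_comp. Qed.

Lemma measurable_comp2 w : measurable_fun setT w -> measurable_fun setT (fun z => w z.2).
Proof. by move=> mw; apply: measurableT_comp. Qed.

Lemma measurable_enorm_diff :
  measurable_fun setT (fun z : V * V => enorm (z.1 - z.2)).
Proof.
apply: (measurableT_comp (@measurable_enorm R n)).
apply/measurable_fun_rVP => i.
under eq_fun do rewrite !mxE.
apply: measurable_funB.
  exact: (measurable_comp1 (measurable_coord i)).
exact: (measurable_comp2 (measurable_coord i)).
Qed.

Lemma measurable_gagliardo_density s p w : measurable_fun setT w ->
  measurable_fun setT (gagliardo_density s p w).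
Proof.
move=> mw; rewrite /gagliardo_density.
under eq_fun do rewrite -powRN.
apply: measurable_funM; apply: measurable_powR_fun; last exact: measurable_enorm_diff.
apply: measurableT_comp => //; apply: measurable_funB.
  exact: measurable_comp1.
exact: measurable_comp2.
Qed.

Lemma measurable_form_density p k w zeta : measurable_fun setT k ->
  measurable_fun setT w -> measurable_fun setT zeta ->
  measurable_fun setT (form_density p k w zeta).
Proof.
move=> mk mw mz; have mwz : measurable_fun setT (fun z => w z.1 - w z.2).
  by apply: measurable_funB; [exact: measurable_comp1|exact: measurable_comp2].
rewrite /form_density /Lpow; apply: measurable_funM => //; apply: measurable_funM.
  apply: measurable_funM => //; apply: measurable_powR_fun.
  exact: measurableT_comp.
by apply: measurable_funB; [exact: measurable_comp1|exact: measurable_comp2].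
Qed.

Section tail.
Variables (s p Lambda c : R) (k : V * V -> R) (C U : set V).
Hypotheses (s0 : 0 < s) (p1 : 1 < p) (Lambda0 : 0 < Lambda) (c0 : 0 < c).
Hypothesis k0 : forall z, 0 <= k z.
Hypothesis mk : measurable_fun setT k.
Hypothesis kle : forall z, k z <= Lambda / enorm (z.1 - z.2) `^ (n%:R + s * p).
Hypotheses (mC : measurable C) (mU : measurable U) (CU : C `<=` U).
Hypothesis far : forall x y, C x -> ~ U y -> 1 + enorm y <= c * enorm (x - y).
Hypothesis Coo : (mu C < +oo)%E.

Let wt (y : V) : R := (1 + enorm y) `^ (- n%:R - s * p).

(** The interaction of a point of [C] with a point outside [U], where the kernel
    is bounded by a weight in the far variable alone. *)
Definition tail_density w z : R :=
  \1_C z.1 * \1_(~` U) z.2 * (`|w z.1| `^ (p - 1) + `|w z.2| `^ (p - 1)) * wt z.2.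

Lemma tail_density_ge0 w z : 0 <= tail_density w z.
Proof. by rewrite /tail_density !mulr_ge0// ?addr_ge0 ?powR_ge0// /wt powR_ge0. Qed.

Let near z : R := \1_(U `*` U) z.
Let D := Lambda * 2 `^ (p - 1) * c `^ (n%:R + s * p).

Let q0 : 0 < n%:R + s * p.
Proof. by rewrite ltr_wpDl// mulr_gt0// (lt_trans ltr01). Qed.

Let far_le w x y : C x -> ~ U y -> forall b : R, `|b| <= 1 ->
  `|Lpow p (w x) (w y)| * `|b| * (Lambda / enorm (x - y) `^ (n%:R + s * p)) <=
  D * tail_density w (x, y).
Proof.
move=> Cx Uy b b1; rewrite (normr_Lpow _ _ p1).
have iC : \1_C x = 1 :> R by rewrite indicE mem_set.
have iU : \1_(~` U) y = 1 :> R by rewrite indicE mem_set.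
rewrite /tail_density/= iC iU !mul1r.
have e0 : 0 < enorm (x - y).
  have := lt_le_trans (ltr_wpDr (enorm_ge0 y) ltr01) (far Cx Uy).
  by rewrite pmulr_rgt0.
have dle : (enorm (x - y) `^ (n%:R + s * p))^-1 <= c `^ (n%:R + s * p) * wt y.
  rewrite /wt -opprD powRN.
  have y1 : 0 < 1 + enorm y by exact: (ltr_wpDr (enorm_ge0 y) ltr01).
  have P1 : 0 < (1 + enorm y) `^ (n%:R + s * p) by exact: powR_gt0.
  have P2 : 0 < enorm (x - y) `^ (n%:R + s * p) by exact: powR_gt0.
  rewrite ler_pdivlMr// mulrC ler_pdivrMr// -powRM ?(ltW c0) ?(ltW e0)//.
  apply: ge0_ler_powR; last exact: far.
  - exact: ltW.
  - by rewrite nnegrE ltW.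
  - by rewrite nnegrE mulr_ge0 ?ltW.
have Lle : `|w x - w y| `^ (p - 1) * `|b| <=
    2 `^ (p - 1) * (`|w x| `^ (p - 1) + `|w y| `^ (p - 1)).
  apply: le_trans (powR_normD_le _ _ p1).
  apply: (@le_trans _ _ (`|w x - w y| `^ (p - 1))).
    by rewrite ler_piMr// powR_ge0.
  have p1' := p1; apply: ge0_ler_powR; first lra.
  - by rewrite nnegrE.
  - by rewrite nnegrE addr_ge0.
  - exact: ler_normB.
rewrite [leRHS](_ : _ = (2 `^ (p - 1) * (`|w x| `^ (p - 1) + `|w y| `^ (p - 1))) *
  (Lambda * (c `^ (n%:R + s * p) * wt y))); last by rewrite /D; ring.
apply: ler_pM => //.
- by rewrite divr_ge0 ?powR_ge0// ltW.
- by rewrite ler_wpM2l// ltW.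
Qed.

(** If both points lie in [U], Young's inequality applies; if one of them lies
    outside [U], the test function vanishes there and the other point must lie
    in [C], so the far decay of the kernel applies. *)
Lemma form_density_le w zeta t z : 0 < t -> (forall x, `|zeta x| <= 1) ->
  (forall x, ~ C x -> zeta x = 0) ->
  `|form_density p k w zeta z| <=
    Lambda * t * (near z * gagliardo_density s p w z) +
    Lambda * t `^ (1 - p) * (near z * gagliardo_density s p zeta z) +
    D * (tail_density w z + tail_density w (z.2, z.1)).
Proof.
move=> t0 z1 zC; case: z => x y /=.
have D0 : 0 <= D by rewrite /D !mulr_ge0 ?powR_ge0// ltW.
have g0 := gagliardo_density_ge0; have l0 := tail_density_ge0.
have near0 z : 0 <= near z by [].
have A1 : 0 <= Lambda * t * (near (x, y) * gagliardo_density s p w (x, y)).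
  by apply: mulr_ge0; apply: mulr_ge0 => //; exact: ltW.
have A2 : 0 <= Lambda * t `^ (1 - p) * (near (x, y) * gagliardo_density s p zeta (x, y)).
  by apply: mulr_ge0; apply: mulr_ge0; rewrite ?powR_ge0//; exact: ltW.
have A3 : 0 <= D * tail_density w (x, y) by rewrite mulr_ge0.
have A4 : 0 <= D * tail_density w (y, x) by rewrite mulr_ge0.
rewrite mulrDr /form_density/= normrM normrM (ger0_norm (k0 _)).
have L0 : 0 <= `|Lpow p (w x) (w y)| * `|zeta x - zeta y| by rewrite mulr_ge0.
have step := ler_wpM2l L0 (kle (x, y)).
apply: (le_trans step) => {step}/=.
have [Ux|Ux] := pselect (U x); have [Uy|Uy] := pselect (U y).
- have E : 0 <= Lambda / enorm (x - y) `^ (n%:R + s * p).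
    by rewrite divr_ge0 ?powR_ge0// ltW.
  have := young_split p1 t0 (normr_ge0 (w x - w y)) (normr_ge0 (zeta x - zeta y)).
  rewrite normr_Lpow// => /(ler_wpM2r E) h; apply: (le_trans h).
  rewrite /near indicE mem_set//= !mul1r /gagliardo_density/=.
  set e := enorm _ `^ _; rewrite [leLHS](_ : _ =
    Lambda * t * (`|w x - w y| `^ p / e) + Lambda * t `^ (1 - p) * (`|zeta x - zeta y| `^ p / e)); last by ring.
  by rewrite lerDl addr_ge0.
- rewrite (zC y) ?subr0; last by move=> /CU.
  have [Cx|Cx] := pselect (C x); last first.
    by rewrite zC// normr0 mulr0 mul0r !addr_ge0.
  by apply: (le_trans (far_le w Cx Uy (z1 x))); lra.
- rewrite (zC x) ?sub0r; last by move=> /CU.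
  have [Cy|Cy] := pselect (C y); last first.
    by rewrite zC// oppr0 normr0 mulr0 mul0r !addr_ge0.
  rewrite normrN.
  have -> : `|Lpow p (w x) (w y)| = `|Lpow p (w y) (w x)|.
    by rewrite !normr_Lpow// distrC.
  rewrite -[enorm _]enormN opprB.
  by apply: (le_trans (far_le w Cy Ux (z1 y))); lra.
- rewrite (zC x) ?(zC y) ?subr0 ?normr0 ?mulr0 ?mul0r ?addr_ge0//.
  + by move=> /CU.
  + by move=> /CU.
Qed.

Section integrability.
Variable w : V -> R.
Hypothesis mw : measurable_fun setT w.
Hypothesis wg : (gagliardo s p U w < +oo)%E.
Hypothesis wC : (\int[mu]_(x in C) (`|w x| `^ (p - 1))%:E < +oo)%E.
Hypothesis wU : (\int[mu]_(y in ~` U) (`|w y| `^ (p - 1) * wt y)%:E < +oo)%E.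

Let mwp : measurable_fun setT (fun x => `|w x| `^ (p - 1)).
Proof. by apply: measurable_powR_fun; apply: measurableT_comp. Qed.

Let iwt : mu.-integrable setT (EFin \o wt).
Proof.
apply: ge0_integrable; first exact: measurable_weight.
  by move=> x _; rewrite powR_ge0.
by apply: integral_weight_lty; rewrite mulr_gt0// (lt_trans ltr01).
Qed.

Lemma integrable_tail_density : (mu \x mu)%E.-integrable setT (EFin \o tail_density w).
Proof.
have mUC : measurable (~` U) by exact: measurableC.
have i1 : mu.-integrable setT (fun x => (\1_C x * `|w x| `^ (p - 1))%:E).
  apply: integrable_indic_mul => //; apply: ge0_integrable => //.
  exact: measurable_funTS.
have i2 : mu.-integrable setT (fun y => (\1_(~` U) y * wt y)%:E).
  by apply: integrable_indic_mul => //; exact: integrableS iwt.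
have i3 : mu.-integrable setT (fun x => (\1_C x)%:E).
  have ic : measurable_fun setT (\1_C : V -> R) by exact: measurable_indic.
  by apply: (ge0_integrable ic) => //; rewrite integral_indic// setIT.
have i4 : mu.-integrable setT (fun y => (\1_(~` U) y * (`|w y| `^ (p - 1) * wt y))%:E).
  apply: integrable_indic_mul => //; apply: ge0_integrable => //.
    by apply: measurable_funTS; apply: measurable_funM => //; exact: measurable_weight.
  by move=> x _; rewrite mulr_ge0 ?powR_ge0.
have wt0 y : 0 <= wt y by rewrite powR_ge0.
have ic0 (A : set V) x : 0 <= \1_A x :> R by [].
have t1 := integrable_tensor (fun x => mulr_ge0 (ic0 _ _) (powR_ge0 _ _)) (fun y => mulr_ge0 (ic0 _ _) (wt0 y)) i1 i2.
have t2 := integrable_tensor (fun x => ic0 _ _) (fun y => mulr_ge0 (ic0 _ _) (mulr_ge0 (powR_ge0 _ _) (wt0 y))) i3 i4.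
apply: (integrable_eqT (integrableD measurableT t1 t2)) => z /=.
by rewrite -EFinD /tail_density; congr EFin; ring.
Qed.

Lemma integrable_tail_swap :
  (mu \x mu)%E.-integrable setT (fun z => (tail_density w (z.2, z.1))%:E).
Proof.
have it := integrable_tail_density.
have /measurable_EFinP mt := measurable_int _ it.
have ms : measurable_fun setT (fun z : V * V => tail_density w (z.2, z.1)).
  have mS : measurable_fun [set: V * V] (fun z => (z.2, z.1)) by exact: measurable_swap.
  exact: (measurableT_comp mt mS).
apply: (ge0_integrable ms) => [z _|]; first exact: tail_density_ge0.
rewrite (@ge0_integral_swap _ _ (EFin \o tail_density w)); last 2 first.
- exact/measurable_EFinP.
- by move=> z; rewrite lee_fin tail_density_ge0.
by rewrite integrable_RintegralE// ltry.
Qed.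

Lemma integrable_near (zeta : V -> R) : measurable_fun setT zeta ->
  (gagliardo s p U zeta < +oo)%E ->
  (mu \x mu)%E.-integrable setT (fun z => (near z * gagliardo_density s p zeta z)%:E).
Proof.
move=> mz zg; apply: integrable_indic_mul; first exact: measurableX.
apply: ge0_integrable => //.
- by apply: measurable_funTS; exact: measurable_gagliardo_density.
- by move=> z _; exact: gagliardo_density_ge0.
Qed.

Let H t z := Lambda * t * (near z * gagliardo_density s p w z) +
   D * (tail_density w z + tail_density w (z.2, z.1)).

Let iH t : (mu \x mu)%E.-integrable setT (EFin \o H t).
Proof.
have i1 := integrableZl measurableT (Lambda * t) (integrable_near mw wg).
have i2 := integrableZl measurableT D
  (integrableD measurableT integrable_tail_density integrable_tail_swap).
apply: (integrable_eqT (integrableD measurableT i1 i2)) => z /=.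
by rewrite /H !EFinD !EFinM !EFinD.
Qed.

Lemma integrable_form_density (zeta : V -> R) :
  measurable_fun setT zeta -> (forall x, `|zeta x| <= 1) ->
  (forall x, ~ C x -> zeta x = 0) -> (gagliardo s p U zeta < +oo)%E ->
  (mu \x mu)%E.-integrable setT (EFin \o form_density p k w zeta).
Proof.
move=> mz z1 zC zg.
have i2 := integrableZl measurableT Lambda (integrable_near mz zg).
have i3 := integrableD measurableT (iH 1) i2.
apply: (le_integrable measurableT) i3.
  by apply/measurable_EFinP; exact: measurable_form_density.
move=> z _; rewrite lee_fin [X in _ <= X]/=.
apply: le_trans (ler_norm _).
apply: le_trans (form_density_le w z ltr01 z1 zC) _.
rewrite /H powR1 !mulr1; lra.
Qed.

(** Fatou's lemma for the dominating functions of [form_density_le] minus the form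
    densities. The part of the dominating function that varies with [j] has an
    integral of at most [Lambda * t^(1-p) * B], and this is all that the limit
    form can lose; as [t] grows it tends to 0. *)
Lemma form_density_limit (zeta : V -> R) (zk : nat -> V -> R) (B : R) :
  measurable_fun setT zeta -> (forall x, `|zeta x| <= 1) ->
  (forall x, ~ C x -> zeta x = 0) -> (gagliardo s p U zeta < +oo)%E ->
  (forall j, measurable_fun setT (zk j)) -> (forall j x, `|zk j x| <= 1) ->
  (forall j x, ~ C x -> zk j x = 0) ->
  (forall j, (gagliardo s p U (zk j) <= B%:E)%E) ->
  {ae mu, forall x, zk j x @[j --> \oo] --> zeta x} ->
  (forall j, 0 <= \int[mu \x mu]_z (form_density p k w (zk j) z)%:E)%E ->
  (0 <= \int[mu \x mu]_z (form_density p k w zeta z)%:E)%E.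
Proof.
move=> mz z1 zC zg mzk zk1 zkC zkg cvz fk0.
have ifz := integrable_form_density mz z1 zC zg.
have zkg' j : (gagliardo s p U (zk j) < +oo)%E by rewrite (le_lt_trans (zkg j))// ltry.
have ifk j := integrable_form_density (mzk j) (zk1 j) (zkC j) (zkg' j).
rewrite integrable_RintegralE// lee_fin.
set I := Rintegral _ _ _.
have key t : 0 < t -> - I <= Lambda * t `^ (1 - p) * B.
  move=> t0.
  pose a := Lambda * t `^ (1 - p).
  have a0 : 0 <= a by rewrite mulr_ge0 ?powR_ge0// ltW.
  pose h j z := H t z + a * (near z * gagliardo_density s p (zk j) z)
    - form_density p k w (zk j) z.
  have h0 j z : 0 <= h j z.
    rewrite subr_ge0 (le_trans (ler_norm _))//.
    by apply: le_trans (form_density_le w z t0 (zk1 j) (zkC j)) _; rewrite /H /a; lra.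
  have iN j := integrableZl measurableT a (integrable_near (mzk j) (zkg' j)).
  have ih j : (mu \x mu)%E.-integrable setT (EFin \o h j).
    have i3 := integrableB measurableT (integrableD measurableT (iH t) (iN j)) (ifk j).
    apply: (integrable_eqT i3) => z /=.
    by rewrite /h EFinB !EFinD !EFinM.
  have inth j : (\int[mu \x mu]_z (h j z)%:E <= (Rintegral (mu \x mu)%E setT (H t) + a * B)%:E)%E.
    under eq_integral do rewrite /h EFinB EFinD EFinM.
    rewrite integralB; [|by []|exact: (integrableD measurableT (iH t) (iN j))|exact: (ifk j)].
    rewrite integralD; [|by []|exact: iH|exact: iN].
    apply: (@le_trans _ _ (\int[mu \x mu]_z (H t z)%:E +
        \int[mu \x mu]_z (a%:E * (near z * gagliardo_density s p (zk j) z)%:E))%E).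
      by rewrite leeBlDr ?leeDl// (integrable_RintegralE (ifk j)).
    rewrite (integrable_RintegralE (iH t)) EFinD leeD2l//.
    rewrite integralZl; [|by []|exact: (integrable_near (mzk j) (zkg' j))].
    by rewrite (EFinM a B) integral_indic_mul; apply: lee_wpmul2l; [rewrite lee_fin|exact: zkg].
  have mh j := measurable_int _ (ih j).
  have := @fatou _ _ _ (mu \x mu)%E setT measurableT (fun j z => (h j z)%:E) mh
    (fun j z _ => h0 j z).
  have ub : (limn_einf (fun j => \int[mu \x mu]_z (h j z)%:E) <=
      (Rintegral (mu \x mu)%E setT (H t) + a * B)%:E)%E.
    apply: le_trans (le_limn_einf inth) _.
    by rewrite (cvg_limn_einf_sup (cvg_cst _)).1.
  move=> /le_trans/(_ ub) {}ub.
  have lb : (\int[mu \x mu]_z (H t z - form_density p k w zeta z)%:E <=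
      \int[mu \x mu]_z limn_einf (fun j => (h j z)%:E))%E.
    have mlim : measurable_fun setT (fun z => limn_einf (fun j => (h j z)%:E)).
      rewrite (_ : (fun _ => _) = (fun z => - limn_esup (fun j => - (h j z)%:E))%E); last first.
        apply/funext => z; rewrite -limn_einfN; congr limn_einf.
        by apply/funext => j; rewrite /comp oppeK.
      apply: measurableT_comp => //; apply: measurable_fun_limn_esup => j.
      by apply: measurableT_comp => //; exact: mh.
    have iHf : (mu \x mu)%E.-integrable setT
        (fun z => (H t z - form_density p k w zeta z)%:E).
      apply: (integrable_eqT (integrableB measurableT (iH t) ifz)) => z /=.
      by rewrite EFinB.
    pose f0 z := Num.max (H t z - form_density p k w zeta z) 0.
    have mf0 : measurable_fun setT f0.
      have /measurable_EFinP mHf := measurable_int _ iHf.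
      exact: measurable_maxr.
    have i0 : (mu \x mu)%E.-integrable setT (EFin \o f0).
      apply: (le_integrable measurableT) iHf; first exact/measurable_EFinP.
      move=> z _ /=; rewrite lee_fin ger0_norm ?le_max ?lexx ?orbT//.
      by rewrite ge_max ler_norm normr_ge0.
    apply: (@le_trans _ _ (\int[mu \x mu]_z (f0 z)%:E)%E).
      by apply: le_integral => // z _; rewrite lee_fin le_max lexx.
    have L0 z : (0 <= limn_einf (fun j => (h j z)%:E))%E.
      rewrite -[leLHS](cvg_limn_einf_sup (cvg_cst _)).1.
      by apply: le_limn_einf => j; rewrite lee_fin.
    apply: ae_ge0_le_integral => //.
    - by move=> z _; rewrite lee_fin le_max lexx orbT.
    - exact/measurable_EFinP.
    apply: filterS2 (ae_fst cvz) (ae_snd cvz) => z c1 c2 _.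
    rewrite EFin_max ge_max L0 andbT.
    have cf : (H t z - form_density p k w (zk j) z)%:E @[j --> \oo] -->
        (H t z - form_density p k w zeta z)%:E.
      apply: cvg_EFin; first exact: nearW.
      apply: cvgB; first exact: cvg_cst.
      apply: cvgM; last exact: cvg_cst.
      by apply: cvgM; [exact: cvg_cst|exact: cvgB].
    rewrite -(cvg_limn_einf_sup cf).1.
    apply: le_limn_einf => j; rewrite lee_fin /h lerD2r lerDl.
    by rewrite mulr_ge0// mulr_ge0// gagliardo_density_ge0.
  have := le_trans lb ub.
  under eq_integral do rewrite EFinB.
  rewrite integralB; [|by []|exact: iH|exact: ifz].
  rewrite (integrable_RintegralE (iH t)) (integrable_RintegralE ifz).
  by rewrite -EFinB lee_fin -/I /a; lra.
rewrite leNgt; apply/negP => I0.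
(* with [t] chosen so that [t^(1-p) = - I / (2 Lambda B')], the bound reads [- I <= - I / 2] *)
pose B' := Num.max B 1; have B'0 : 0 < B' by rewrite lt_max ltr01 orbT.
pose x : R := (- I) / (2 * Lambda * B').
have x0 : 0 < x by rewrite divr_gt0 ?oppr_gt0 ?mulr_gt0.
have p1' := p1.
have := key (x `^ (1 - p)^-1) (powR_gt0 _ x0).
have q1 : 1 - p != 0 by rewrite lt_eqF// subr_lt0.
rewrite -powRrM (mulVf q1).
rewrite powRr1 ?(ltW x0)// leNgt => /negP; apply.
apply: (@le_lt_trans _ _ (Lambda * x * B')).
  apply: ler_wpM2l; first by apply: mulr_ge0; exact: ltW.
  by rewrite /B' le_max lexx.
rewrite [X in X < _](_ : _ = - I / 2); first by lra.
by rewrite /x; field; rewrite ?gt_eqF.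
Qed.

End integrability.
End tail.
End energy.

(** * A smooth bump on the line *)

Lemma is_deriv_eq (R : realType) (f : R -> R) (x df df' : R) :
  is_derive x 1 f df -> df = df' -> is_derive x 1 f df'.
Proof. by move=> h <-. Qed.

Section bump.
Context (R : realType).
Implicit Types (P : {poly R}) (t : R).

(** The functions [P(1/t) exp(-1/t)] extended by 0. They are closed under
    differentiation, so they contain all derivatives of the flat function
    [exp(-1/t)]. *)
Definition flat P t : R := if 0 < t then P.[t^-1] * expR (- t^-1) else 0.

(** From [exp (y / k) >= y / k]. *)
Lemma expR_ge_pow (k : nat) (y : R) : 0 <= y -> (0 < k)%N ->
  y ^+ k <= k%:R ^+ k * expR y.
Proof.
move=> y0 k0; have kR : 0 < k%:R :> R by rewrite ltr0n.
have -> : expR y = expR (y / k%:R) ^+ k.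
  by rewrite -expRM_natl mulrC divfK ?gt_eqF.
rewrite -exprMn lerXn2r ?nnegrE ?mulr_ge0 ?expR_ge0 ?ler0n//.
rewrite -ler_pdivrMl// mulrC (le_trans _ (expR_ge1Dx _))//; lra.
Qed.

(** A quadratic bound at the origin is enough for the derivative there to exist
    and be 0. *)
Lemma flat_le P : exists2 A, 0 <= A & forall t, t <= 1 -> `|flat P t| <= A * t ^+ 2.
Proof.
pose S := \sum_(i < size P) `|P`_i|; pose k := (size P).+2.
have S0 : 0 <= S by exact: sumr_ge0.
exists (S * k%:R ^+ k) => [|t t1]; first by rewrite mulr_ge0// exprn_ge0.
rewrite /flat; case: ifPn => [t0|_]; last by rewrite normr0 mulr_ge0 ?sqr_ge0// mulr_ge0// exprn_ge0.
set y := t^-1; have y0 : 0 < y by rewrite invr_gt0.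
have y1 : 1 <= y by rewrite invf_ge1.
have Py : `|P.[y]| <= S * y ^+ size P.
  rewrite horner_coef (le_trans (ler_norm_sum _ _ _))// /S mulr_suml ler_sum// => i _.
  rewrite normrM ler_wpM2l// ger0_norm ?exprn_ge0 ?(ltW y0)//.
  by rewrite ler_weXn2l// ltnW.
rewrite normrM (ger0_norm (expR_ge0 _)) -[t]invrK -/y exprVn.
apply: (@le_trans _ _ (S * y ^+ size P * expR (- y))).
  by rewrite ler_wpM2r ?expR_ge0.
rewrite expRN ler_pdivrMr ?expR_gt0//.
rewrite [leRHS](_ : _ = S * (k%:R ^+ k * expR y / y ^+ 2)); last by ring.
rewrite ler_wpM2l// ler_pdivlMr ?exprn_gt0//.
rewrite -exprD addn2; apply: expR_ge_pow => //; exact: ltW.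
Qed.

Lemma is_derive_flat P t : is_derive t 1 (flat P) (flat ('X ^+ 2 * (P - P^`())) t).
Proof.
have [t0|t0|t0] := ltgtP 0 t.
- have -> : flat ('X ^+ 2 * (P - P^`())) t = P.[t^-1] * (t ^- 2 * expR (- t^-1)) +
      (- t ^- 2 * P^`().[t^-1]) * expR (- t^-1).
    rewrite /flat t0 hornerM hornerXn hornerD hornerN -exprVn; ring.
  have tn0 : t != 0 by rewrite gt_eqF.
  have dV : is_derive t 1 (fun x : R => x^-1) (- t ^- 2).
    apply: is_deriv_eq (is_deriveV tn0 (is_derive_id t 1)) _.
    by rewrite scaler1.
  have dP : is_derive t 1 (fun x => P.[x^-1]) (P^`().[t^-1] * - t ^- 2).
    exact: (is_derive1_comp (is_derive_poly P (t^-1)) dV).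
  have dN : is_derive t 1 (fun x : R => - x^-1) (t ^- 2).
    by apply: is_deriv_eq (is_deriveN dV) _; rewrite opprK.
  have dE : is_derive t 1 (fun x => expR (- x^-1)) (expR (- t^-1) * t ^- 2).
    exact: (is_derive1_comp (is_derive_expR _) dN).
  have dPE : is_derive t 1 (fun x => P.[x^-1] * expR (- x^-1))
      (P.[t^-1] * (t ^- 2 * expR (- t^-1)) +
      (- t ^- 2 * P^`().[t^-1]) * expR (- t^-1)).
    apply: is_deriv_eq (is_deriveM dP dE) _.
    by rewrite /GRing.scale/=; ring.
  apply: near_eq_is_derive dPE.
  near=> x; rewrite /flat ifT//; near: x; exact: lt_nbhsr.
- rewrite [X in is_derive _ _ _ X](_ : _ = 0); last by rewrite /flat ltNge ltW.
  apply: near_eq_is_derive (is_derive_cst (0 : R) t 1).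
  near=> x; rewrite /flat ifF//; apply/negbTE; rewrite -leNgt ltW//.
  near: x; exact: lt_nbhsl.
- rewrite -{}t0 [X in is_derive _ _ _ X](_ : _ = 0); last by rewrite /flat ltxx.
  have [A A0 HA] := flat_le P.
  have lim : h^-1 *: (flat P (h *: 1 + 0) - flat P 0) @[h --> 0^'] --> (0 : R).
    apply/cvgrPdist_le => e e0.
    exists (Num.min 1 (e / (A + 1))) => /=.
      by rewrite lt_min ltr01 divr_gt0//; lra.
    move=> h /=; rewrite sub0r normrN lt_min => /andP[h1 he] h0.
    have hp : 0 < `|h| by rewrite normr_gt0.
    rewrite {2}/flat ltxx subr0 sub0r normrN addr0 /GRing.scale/= mulr1 normrM normfV.
    rewrite ler_pdivrMl//.
    apply: (@le_trans _ _ (A * `|h| ^+ 2)).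
      by rewrite real_normK ?num_real// HA// (le_trans (ler_norm _)) ?ltW.
    rewrite mulrC expr2 -mulrA ler_wpM2l// mulrC.
    by move: he; rewrite ltr_pdivlMr; [nra|lra].
  split; first by apply/cvg_ex; exists 0; exact: lim.
  by apply/cvg_lim => //; exact: lim.
Unshelve. all: by end_near. Qed.

(** If [F a] and [G b] denote the derivatives of order [a] and [b] of two
    functions, this is the derivative of order [j] of [F a * G b], the sum in
    Leibniz' rule being left unexpanded. *)
Fixpoint leibniz (F G : nat -> R -> R) (j a b : nat) (t : R) : R :=
  if j is j'.+1 then leibniz F G j' a.+1 b t + leibniz F G j' a b.+1 t
  else F a t * G b t.

Lemma is_derive_leibniz (F G : nat -> R -> R) :
  (forall j t, is_derive t 1 (F j) (F j.+1 t)) ->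
  (forall j t, is_derive t 1 (G j) (G j.+1 t)) ->
  forall j a b t, is_derive t 1 (leibniz F G j a b) (leibniz F G j.+1 a b t).
Proof.
move=> dF dG; elim => [a b t|j IH a b t] /=.
  apply: is_deriv_eq (is_deriveM (dF a t) (dG b t)) _.
  by rewrite /GRing.scale/=; ring.
exact: is_deriveD (IH a.+1 b t) (IH a b.+1 t).
Qed.

Definition flat_poly (j : nat) : {poly R} := iter j (fun P => 'X ^+ 2 * (P - P^`())) 1.

Definition bump_left (j : nat) (t : R) : R := flat (flat_poly j) (t + 1).
Definition bump_right (j : nat) (t : R) : R := (-1) ^+ j * flat (flat_poly j) (- t + 1).
(** The derivatives of [exp (- 1 / (1 + t)) * exp (- 1 / (1 - t))], which is
    supported in [[-1, 1]]. *)
Definition bump_deriv (j : nat) (t : R) : R := leibniz bump_left bump_right j 0 0 t.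

Lemma is_derive_bump j t : is_derive t 1 (bump_deriv j) (bump_deriv j.+1 t).
Proof.
apply: is_derive_leibniz => {}j {}t; rewrite /bump_left /bump_right.
  have d1 : is_derive t 1 (fun x : R => x + 1) 1.
    by apply: is_deriv_eq (is_deriveD (is_derive_id t 1) (is_derive_cst (1 : R) t 1)) _; rewrite addr0.
  apply: is_deriv_eq (is_derive1_comp (is_derive_flat _ _) d1) _.
  by rewrite mulr1.
have d1 : is_derive t 1 (fun x : R => - x + 1) (-1).
  by apply: is_deriv_eq (is_deriveD (is_deriveN (is_derive_id t 1)) (is_derive_cst (1 : R) t 1)) _; rewrite addr0.
apply: is_deriv_eq (is_deriveZ ((-1) ^+ j) (is_derive1_comp (is_derive_flat _ _) d1)) _.
rewrite -[flat_poly j.+1]/('X ^+ 2 * (flat_poly j - (flat_poly j)^`())) [(-1) ^+ j.+1]exprS.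
by move: ((-1) ^+ j) (flat _ _) => a v; rewrite /GRing.scale/=; ring.
Qed.

Lemma bump_out j t : 1 <= `|t| -> bump_deriv j t = 0.
Proof.
move=> t1.
suff H a b : leibniz bump_left bump_right j a b t = 0 by exact: H.
have LR x y : bump_left x t * bump_right y t = 0.
  rewrite /bump_left /bump_right /flat.
  have [t0|t0] := leP 0 t.
    by rewrite (ifF _ _ (_ : 0 < - t + 1 = false)) ?mulr0//; move: t1; rewrite ger0_norm// => t1; apply/negbTE; rewrite -leNgt; lra.
  by rewrite ifF ?mul0r//; move: t1; rewrite ltr0_norm// => t1; apply/negbTE; rewrite -leNgt; lra.
by elim: j a b => [|j IH] a b /=; [exact: LR|rewrite !IH addr0].
Qed.

Lemma bump_gt0 t : `|t| < 1 -> 0 < bump_deriv 0 t.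
Proof.
rewrite ltr_norml => /andP[t1 t2].
rewrite /bump_deriv/= /bump_left /bump_right /flat/= /flat_poly/= expr0 mul1r.
rewrite !ifT ?hornerE ?mul1r ?mulr_gt0 ?expR_gt0//; lra.
Qed.

Lemma bump_ge0 t : 0 <= bump_deriv 0 t.
Proof.
have [/bump_out -> //|/bump_gt0/ltW//] := leP 1 `|t|.
Qed.

(** A continuous function with compact support. *)
Lemma bounded_bump j : exists M, forall t, `|bump_deriv j t| <= M.
Proof.
have cb : continuous (bump_deriv j).
  move=> t; apply: differentiable_continuous; apply/derivable1_diffP.
  by have [] := is_derive_bump j t.
have cn : {within `[-1, 1], continuous (fun t => `|bump_deriv j t|)}.
  by apply: continuous_subspaceT => t; apply: (continuous_comp (cb t)); exact: norm_continuous.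
have N11 : -1 <= 1 :> R by lra.
have [c _ Hc] := EVT_max N11 cn.
exists `|bump_deriv j c| => t; have [t1|t1] := leP 1 `|t|; first by rewrite bump_out// normr0.
by apply: Hc; rewrite in_itv/=; move: t1; rewrite ltr_norml => /andP[? ?]; apply/andP; split; exact: ltW.
Qed.

End bump.

(** * Convolution with smooth tensor products *)

Section convolution.
Context (R : realType) (n : nat).
Local Notation mu := (lebesgue_rV R n).
Local Notation V := ('rV[R]_n).
Variables (chi : nat -> R -> R) (M : nat -> R).
Hypothesis dchi : forall j (t : R), is_derive t 1 (chi j) (chi j.+1 t).
Hypothesis bchi : forall j t, `|chi j t| <= M j.
Variable eta : V -> R.
Hypothesis ieta : mu.-integrable setT (EFin \o eta).
Implicit Types (m : 'I_n -> nat) (x y : V).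

(** The multi-index [m] records how often each factor has been
    differentiated. *)
Definition tensor m x : R := \prod_i chi (m i) (x ord0 i).
Definition incr m (i : 'I_n) : 'I_n -> nat := fun j => (m j + (j == i))%N.
Definition convolve m x : R := Rintegral mu setT (fun y => eta y * tensor m (x - y)).

Let meta : measurable_fun setT eta.
Proof. by have /measurable_EFinP := measurable_int _ ieta. Qed.

Let cchi j : continuous (chi j).
Proof.
move=> t; apply: differentiable_continuous; apply/derivable1_diffP.
by have [] := dchi j t.
Qed.

Lemma norm_tensor_le m x : `|tensor m x| <= \prod_i M (m i).
Proof. by rewrite normr_prod; apply: ler_prod => i _; rewrite normr_ge0/=. Qed.

Lemma continuous_tensor m : continuous (tensor m).
Proof.
rewrite /tensor; elim: (index_enum _) => [|i r IH] x.
  have -> : (fun y : V => \prod_(j <- [::]) chi (m j) (y ord0 j)) = cst 1.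
    by apply/funext => y; rewrite big_nil.
  exact: cst_continuous.
have -> : (fun y : V => \prod_(j <- i :: r) chi (m j) (y ord0 j)) =
    (fun y => chi (m i) (y ord0 i)) \* (fun y => \prod_(j <- r) chi (m j) (y ord0 j)).
  by apply/funext => y; rewrite big_cons.
apply: continuousM; last exact: IH.
apply: (@continuous_comp _ _ _ (fun y : V => y ord0 i) (chi (m i))).
  exact: coord_continuous.
exact: cchi.
Qed.

Lemma measurable_tensor_sub m x : measurable_fun setT (fun y => tensor m (x - y)).
Proof.
apply: continuous_measurable_rV => y.
apply: (@continuous_comp _ _ _ (fun y => x - y) (tensor m)).
  apply: (@continuousB _ _ _ (cst x : V -> V) id); [exact: cst_continuous|exact: cvg_id].
exact: continuous_tensor.
Qed.

Let integrand m x y := eta y * tensor m (x - y).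

Lemma integrable_conv m x : mu.-integrable setT (EFin \o integrand m x).
Proof.
apply: (le_integrable measurableT) (integrableZr measurableT (\prod_i M (m i)) ieta).
  by apply/measurable_EFinP/measurable_funM => //; exact: measurable_tensor_sub.
move=> y _ /=; rewrite lee_fin !normrM ler_wpM2l//.
exact: le_trans (norm_tensor_le _ _) (ler_norm _).
Qed.

(** Dominated convergence gives sequential continuity. *)
Lemma continuous_conv m : continuous (convolve m).
Proof.
have seqc (u : nat -> V) x : u k @[k --> \oo] --> x -> convolve m (u k) @[k --> \oo] --> convolve m x.
  move=> ux; apply: fine_cvg; rewrite fineK; last exact: (integrable_fin_num measurableT (integrable_conv m x)).
  apply: (@dominated_cvg _ _ _ mu _ measurableT (fun k y => (integrand m (u k) y)%:E) _
     (fun y => (`|eta y * \prod_i M (m i)|)%:E)).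
  - by move=> k; exact: (measurable_int _ (integrable_conv m (u k))).
  - move=> y _; apply: cvg_EFin; first exact: nearW.
    apply: cvgM; first exact: cvg_cst.
    apply: (@continuous_cvg _ _ _ _ _ (fun k => u k - y) (tensor m)).
      exact: continuous_tensor.
    by apply: cvgB; [exact: ux|exact: cvg_cst].
  - by [].
  - have := integrable_abse (integrableZr measurableT (\prod_i M (m i)) ieta).
    by move=> iabs; exact: (integrable_eqT iabs (fun=> erefl)).
  - move=> k y _ /=; rewrite lee_fin !normrM ler_wpM2l//.
    exact: le_trans (norm_tensor_le _ _) (ler_norm _).
move=> x; apply/(@cvgrPdist_le _ _ _ (nbhs x) (nbhs_filter x)) => e e0; apply: contrapT => nx.
have ex (k : nat) : exists u, `|x - u| < k.+1%:R^-1 /\ ~ `|convolve m x - convolve m u| <= e.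
  apply: contrapT => /forallNP h; apply: nx.
  apply/nbhs_ballP; exists k.+1%:R^-1; first by rewrite /= invr_gt0.
  move=> u; rewrite -ball_normE /ball_/= => xu.
  by have /not_andP[//|/contrapT] := h u.
have /choice[u Hu] := ex.
have ux : u k @[k --> \oo] --> x.
  apply/cvgrPdist_lt => d d0.
  near=> k; apply: lt_trans (Hu k).1 _.
  by near: k; exact: (near_infty_natSinv_lt (PosNum d0)).
have /cvgrPdist_le/(_ _ e0)[k _ /(_ k (leqnn k))] := seqc u x ux.
exact: (Hu k).2.
Unshelve. all: by end_near. Qed.

(** A partial derivative increments one entry of the multi-index. *)
Lemma is_derive_tensor m (i : 'I_n) x (h : R) :
  is_derive h 1 (fun t : R => tensor m (t *: delta_mx ord0 i + x))
    (tensor (incr m i) (h *: delta_mx ord0 i + x)).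
Proof.
pose c : R := \prod_(j | j != i) chi (m j) (x ord0 j).
have coord t j : (t *: delta_mx ord0 i + x) ord0 j = t * (j == i)%:R + x ord0 j :> R.
  by rewrite !mxE eqxx.
have E t : tensor m (t *: delta_mx ord0 i + x) = chi (m i) (t + x ord0 i) * c.
  rewrite /tensor (bigD1 i)//= coord eqxx mulr1; congr (_ * _).
  by apply: eq_bigr => j ji; rewrite coord (negbTE ji) mulr0 add0r.
have E' : tensor (incr m i) (h *: delta_mx ord0 i + x) = chi (m i).+1 (h + x ord0 i) * c.
  rewrite /tensor (bigD1 i)//= coord eqxx mulr1 /incr eqxx addn1; congr (_ * _).
  by apply: eq_bigr => j ji; rewrite coord (negbTE ji) mulr0 add0r addn0.
under eq_fun do rewrite E.
rewrite E'.
have d1 : is_derive h 1 (fun t : R => t + x ord0 i) 1.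
  by apply: is_deriv_eq (is_deriveD (is_derive_id h 1) (is_derive_cst (x ord0 i) h 1)) _; rewrite addr0.
have d2 := is_derive1_comp (dchi (m i) _) d1.
apply: is_deriv_eq (is_deriveM d2 (is_derive_cst c h 1)) _.
by rewrite /GRing.scale/= mulr0 add0r mulr1 mulrC.
Qed.

Section partial_derivative.
Variables (m : 'I_n -> nat) (i : 'I_n) (x : V).
Let e : V := delta_mx ord0 i.
Let f (h : R) y := integrand m (h *: e + x) y.

Let df (h : R) y : is_derive h 1 (f ^~ y) (integrand (incr m i) (h *: e + x) y).
Proof.
have d := is_derive_tensor m i (x - y) h.
have E k t : integrand k (t *: e + x) y = eta y * tensor k (t *: e + (x - y)).
  by rewrite /integrand addrA.
rewrite /f; under eq_fun do rewrite E.
rewrite E.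
exact: (is_deriveZ (eta y) d).
Qed.

Let pE h y : partial1of2 f h y = integrand (incr m i) (h *: e + x) y.
Proof. by rewrite partial1of2E; have [] := df h y. Qed.

Let G y := `|eta y * \prod_j M (incr m i j)|.

Let iG : mu.-integrable setT (EFin \o G).
Proof.
have := integrable_abse (integrableZr measurableT (\prod_j M (incr m i j)) ieta).
by move=> iabs; exact: (integrable_eqT iabs (fun=> erefl)).
Qed.

Let Gub h y : `|partial1of2 f h y| <= G y.
Proof.
rewrite pE /G /integrand !normrM ler_wpM2l//.
exact: le_trans (norm_tensor_le _ _) (ler_norm _).
Qed.

Let I0 : (`]-1, 1[%classic : set R) 0.
Proof. by rewrite /= in_itv/= oppr_lt0 ltr01. Qed.

Lemma derivable_conv : derivable (convolve m) x e.
Proof.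
apply/derivable1P.
apply: (@derivable_under_integral _ _ _ mu f setT measurableT 0 (-1) 1 I0 _ _ G) => //.
- by move=> h _; exact: integrable_conv.
- by move=> h y _ _; have [] := df h y.
- by move=> y; exact: normr_ge0.
Qed.

Lemma derive_conv : 'D_e (convolve m) x = convolve (incr m i) x.
Proof.
have := @differentiation_under_integral _ _ _ mu f setT measurableT 0 (-1) 1 I0
  (fun h _ => integrable_conv m _) (fun h y _ _ => @ex_derive _ _ _ _ _ _ _ (df h y))
  G (fun y => normr_ge0 _) iG (fun h y _ _ => Gub h y).
have -> : Rintegral mu setT (fun y => partial1of2 f 0 y) = convolve (incr m i) x.
  by apply: eq_Rintegral => y _; rewrite pE scale0r add0r.
move=> <-; rewrite /derive1 /derive; apply: (f_equal (fun q : R -> R => lim (q @ 0^'))); apply/funext => h /=.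
by rewrite addr0 /f scale0r add0r.
Qed.

End partial_derivative.

(** Differentiating under the integral sign stays within the family [convolve],
    so continuity of all its members gives smoothness. *)
Lemma Ck_conv k m : Ck k (convolve m).
Proof.
elim: k m => [m|k IH m] /=; first exact: continuous_conv.
split; first exact: continuous_conv.
move=> i; split => [x|]; first exact: derivable_conv.
by under eq_fun do rewrite derive_conv.
Qed.

End convolution.

(** * Continuity of translations in mean *)

Lemma ler_dist3 (R : realDomainType) (a b c d : R) :
  `|a - b| <= `|c - d| + `|a - c| + `|b - d|.
Proof.
have -> : a - b = (c - d) + (a - c) - (b - d) by ring.
by rewrite (le_trans (ler_normB _ _))// lerD2r ler_normD.
Qed.

Lemma ge0_integralD_EFin d (T : measurableType d) (R : realType)
    (mu : {measure set T -> \bar R}) (D : set T) (f g : T -> R) :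
  measurable D -> measurable_fun setT f -> measurable_fun setT g ->
  (forall x, 0 <= f x) -> (forall x, 0 <= g x) ->
  (\int[mu]_(x in D) (f x + g x)%:E =
    \int[mu]_(x in D) (f x)%:E + \int[mu]_(x in D) (g x)%:E)%E.
Proof.
move=> mD mf mg f0 g0; under eq_integral do rewrite EFinD.
apply: ge0_integralD => //.
- by move=> x _; rewrite lee_fin.
- by apply/measurable_EFinP; exact: measurable_funTS.
- by move=> x _; rewrite lee_fin.
- by apply/measurable_EFinP; exact: measurable_funTS.
Qed.

Lemma ge0_le_integral_EFin d (T : measurableType d) (R : realType)
    (mu : {measure set T -> \bar R}) (D : set T) (f g : T -> R) :
  measurable D -> measurable_fun setT f -> measurable_fun setT g ->
  (forall x, 0 <= f x) -> (forall x, D x -> f x <= g x) ->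
  (\int[mu]_(x in D) (f x)%:E <= \int[mu]_(x in D) (g x)%:E)%E.
Proof.
move=> mD mf mg f0 fg; apply: ge0_le_integral => //.
- by move=> x _; rewrite lee_fin.
- by apply/measurable_EFinP; exact: measurable_funTS.
- by apply/measurable_EFinP; exact: measurable_funTS.
Qed.

Section translation_continuity.
Context (R : realType) (n : nat).
Local Notation mu := (lebesgue_rV R n).
Local Notation V := ('rV[R]_n).
Implicit Types (f g h : V -> R) (A : set V).

Lemma measurable_shift_fun f (z : V) : measurable_fun setT f ->
  measurable_fun setT (fun x : V => f (x + z)).
Proof. by move=> mf; exact: (measurableT_comp mf (@measurable_rV_shift _ _ z)). Qed.

Definition tdiff f (N : R) (z : V) : \bar R :=
  (\int[mu]_(x in cube 0 N) `|f (x + z) - f x|%:E)%E.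

(** Translations act continuously in mean on every cube. The sequential form lets
    dominated convergence apply. *)
Definition tcont f := forall (N : R) (z : nat -> V), 0 < N ->
  z k @[k --> \oo] --> (0 : V) ->
  forall e : R, 0 < e -> \forall k \near \oo, (tdiff f N (z k) <= e%:E)%E.

Lemma measurable_tdiff f (z : V) : measurable_fun setT f ->
  measurable_fun setT (fun x : V => `|f (x + z) - f x|).
Proof.
move=> mf; apply: measurableT_comp => //; apply: measurable_funB => //.
exact: measurable_shift_fun.
Qed.

Lemma integral_cube_shift f (N : R) (z : V) : 0 < N -> measurable_fun setT f ->
    (forall x, 0 <= f x) -> `|z| < 1 ->
  (\int[mu]_(x in cube 0 N) (f (x + z))%:E <= \int[mu]_(x in cube 0 (N + 1)) (f x)%:E)%E.
Proof.
move=> N0 mf f0 z1.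
rewrite -[leLHS]integral_indic_mul -[leRHS]integral_indic_mul.
have mN r : measurable (cube (0 : V) r) by exact: measurable_cube.
have mi r : measurable_fun setT (\1_(cube 0 r) : V -> R) by exact: measurable_indic.
rewrite -[leRHS](@ge0_integral_shift _ _ z); last 2 first.
- by apply/measurable_EFinP; exact: measurable_funM.
- by move=> x; rewrite lee_fin mulr_ge0.
apply: ge0_le_integral_EFin => //.
- by apply: measurable_funM => //; exact: measurable_shift_fun.
- by apply: measurable_funM; exact: measurable_shift_fun.
- by move=> x; rewrite mulr_ge0.
move=> x _; rewrite ler_wpM2r// !indicE.
case: (boolP (x \in cube 0 N)) => // /set_mem; rewrite cubeE//= subr0 => xN.
rewrite mem_set//= cubeE/= ?subr0; last lra.
by rewrite (le_lt_trans (ler_normD _ _))// ltrD.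
Qed.

Lemma near_norm_lt1 (z : nat -> V) : z k @[k --> \oo] --> (0 : V) ->
  \forall k \near \oo, `|z k| < 1.
Proof.
move=> /cvgrPdist_lt/(_ 1 ltr01); apply: filterS => k; by rewrite sub0r normrN.
Qed.

Lemma tcont_le f g h : measurable_fun setT f -> measurable_fun setT g ->
  measurable_fun setT h ->
  (forall x y, `|h x - h y| <= `|f x - f y| + `|g x - g y|) ->
  tcont f -> tcont g -> tcont h.
Proof.
move=> mf mg mh hfg cf cg N z N0 z0 e e0.
have e20 : 0 < e / 2 by rewrite divr_gt0.
apply: filterS2 (cf N z N0 z0 _ e20) (cg N z N0 z0 _ e20) => k fk gk.
rewrite [e]splitr EFinD; apply: le_trans (leeD fk gk).
have mN : measurable (cube (0 : V) N) by exact: measurable_cube.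
have m1 := measurable_tdiff (z k) mf; have m2 := measurable_tdiff (z k) mg.
rewrite /tdiff -ge0_integralD_EFin//; apply: ge0_le_integral_EFin => //.
- exact: measurable_tdiff.
- exact: measurable_funD.
Qed.

(** The functions whose translations are continuous in mean are closed under
    local approximation in mean: three terms of size [e / 3], one of which is
    translated back into a slightly larger cube. *)
Lemma tcont_approx h : measurable_fun setT h ->
  (forall (N e : R), 0 < N -> 0 < e -> exists f, [/\ measurable_fun setT f, tcont f &
     (\int[mu]_(x in cube 0 N) `|h x - f x|%:E <= e%:E)%E]) ->
  tcont h.
Proof.
move=> mh H N z N0 z0 e e0.
have e30 : 0 < e / 3 by rewrite divr_gt0.
have N1 : 0 < N + 1 by lra.
have [f [mf cf hf]] := H _ _ N1 e30.
apply: filterS2 (cf N z N0 z0 _ e30) (near_norm_lt1 z0) => k fk zk.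
have mN r : measurable (cube (0 : V) r) by exact: measurable_cube.
pose d (x : V) : R := `|h x - f x|.
have md : measurable_fun setT d by apply: measurableT_comp => //; exact: measurable_funB.
have t1 : (\int[mu]_(x in cube 0 N) (d (x + z k))%:E <= (e / 3)%:E)%E.
  by apply: le_trans hf; apply: integral_cube_shift => // x; exact: normr_ge0.
have t2 : (\int[mu]_(x in cube 0 N) (d x)%:E <= (e / 3)%:E)%E.
  apply: le_trans hf; apply: ge0_subset_integral => //.
  - by apply: measurable_funTS; apply/measurable_EFinP.
  - by move=> x _; rewrite lee_fin /d.
  - rewrite (cubeE _ N0) (cubeE _ N1) => x /= xN; by rewrite (lt_trans xN)// ltrDl.
have e3 : e / 3 + e / 3 + e / 3 = e by field.
rewrite -[in leRHS]e3 !EFinD.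
apply: le_trans (leeD (leeD fk t1) t2).
have m1 := measurable_tdiff (z k) mf.
have m2 := measurable_shift_fun (z k) md.
have d0 x : 0 <= d x by rewrite /d.
rewrite /tdiff.
rewrite -(@ge0_integralD_EFin _ _ _ mu _ _ _ (mN N) m1 m2 (fun=> normr_ge0 _) (fun=> d0 _)).
rewrite -(@ge0_integralD_EFin _ _ _ mu _ _ _ (mN N) (measurable_funD m1 m2) md
  (fun=> addr_ge0 (normr_ge0 _) (d0 _)) d0).
apply: ge0_le_integral_EFin => //.
- exact: measurable_tdiff.
- by apply: measurable_funD => //; exact: measurable_funD.
- by move=> x _; exact: ler_dist3.
Qed.

(** A pi-system that generates the sigma-algebra and whose members have null
    boundaries. The value [-oo] makes half-spaces and the whole space members
    too. *)
Definition orthant (a : 'I_n -> \bar R) : set V :=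
  [set x | forall i, (a i < (x ord0 i)%:E)%E].

Let orthants : set (set V) := range orthant.

Lemma measurable_halfspace (i : 'I_n) (a : \bar R) :
  measurable [set x : V | (a < (x ord0 i)%:E)%E].
Proof.
rewrite -[X in measurable X]setTI.
have mf : measurable_fun setT (fun x : V => (x ord0 i)%:E).
  by apply/measurable_EFinP; exact: measurable_coord.
rewrite (_ : [set _ | _] = (fun x : V => (x ord0 i)%:E) @^-1` `]a, +oo[%classic).
  exact: (mf measurableT _ (emeasurable_itv _)).
by apply/seteqP; split => x /=; rewrite in_itv/= andbT.
Qed.

Lemma measurable_orthant a : measurable (orthant a).
Proof.
rewrite (_ : orthant a = \bigcap_(i in [set: 'I_n]) [set x : V | (a i < (x ord0 i)%:E)%E]).
  by apply: fin_bigcap_measurable => // i _; exact: measurable_halfspace.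
by apply/seteqP; split => x /= Ax i; [move=> _; exact: Ax|exact: Ax].
Qed.

Lemma orthant_generate : @measurable _ V = <<s orthants >>.
Proof.
apply/seteqP; split; last first.
  apply: smallest_sub; first exact: sigma_algebra_measurable.
  by move=> _ [a _ <-]; exact: measurable_orthant.
have sG := smallest_sigma_algebra setT orthants.
apply: smallest_sub; first exact: smallest_sigma_algebra.
rewrite -bigcup_seq/= => A [i _ [W mW <-]]; rewrite setTI.
have {}mW : (@RGenOInfty.G R).-sigma.-measurable W by rewrite -RGenOInfty.measurableE.
have sP : sigma_algebra setT
    [set Z : set R | <<s orthants >> ((fun x : V => x ord0 i) @^-1` Z)].
  split => /=; first by rewrite preimage_set0; exact: sigma_algebra0.
    by move=> Z mZ; rewrite setTD preimage_setC; exact: sigma_algebraC.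
  by move=> F mF; rewrite preimage_bigcup; exact: sigma_algebra_bigcup.
apply: (smallest_sub sP _ mW) => _ [r ->] /=.
apply: sub_sigma_algebra; exists (fun j => if j == i then r%:E else -oo%E) => //.
apply/seteqP; split => x /=.
  by move=> /(_ i); rewrite eqxx lte_fin in_itv/= andbT.
by rewrite in_itv/= andbT => rx j; case: eqP => [->|_]; [rewrite lte_fin|exact: ltNyr].
Qed.

Lemma setI_closed_orthants : setI_closed orthants.
Proof.
move=> _ _ [a _ <-] [b _ <-]; exists (fun i => maxe (a i) (b i)) => //.
apply/seteqP; split => x /=.
  by move=> h; split => i; have := h i; rewrite gt_max => /andP[].
by move=> [ha hb] i; rewrite gt_max ha hb.
Qed.

Lemma lebesgue_hyperplane (i : 'I_n) (a : R) : mu [set x : V | x ord0 i = a] = 0%E.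
Proof.
pose A (j : 'I_n) : set R := if j == i then [set a] else setT.
have mA j : measurable (A j) by rewrite /A; case: ifP.
rewrite (_ : [set _ | _] = [set x : V | forall j, A j (x ord0 j)]).
  rewrite lebesgue_rV_box// (bigD1 i)//= {1}/A eqxx.
  by rewrite lebesgue_measure_set1 mul0e.
apply/seteqP; split => x /=.
  by move=> xi j; rewrite /A; case: eqP => // ->.
by move=> /(_ i); rewrite /A eqxx.
Qed.

Lemma near_orthant (a : 'I_n -> \bar R) (x : V) (z : nat -> V) :
  (forall i, (x ord0 i)%:E != a i) -> z k @[k --> \oo] --> (0 : V) ->
  \forall k \near \oo, (\1_(orthant a) (x + z k) : R) = \1_(orthant a) x.
Proof.
move=> xa z0.
have zc (i : 'I_n) (d : R) : 0 < d -> \forall k \near \oo, `|z k ord0 i| < d.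
  move=> d0; move/cvgrPdist_lt : z0 => /(_ d d0); apply: filterS => k.
  by rewrite sub0r normrN; apply: le_lt_trans; exact: coord_le_norm.
have [xo|xo] := pselect (orthant a x).
  have : \forall k \near \oo, forall i, (a i < ((x + z k) ord0 i)%:E)%E.
    apply: filter_forall => i; have := xo i.
    case: (a i) => [r||]; rewrite ?lte_fin; last 2 first.
    - by rewrite ltNge leey.
    - by move=> _; apply: nearW => k; exact: ltNyr.
    move=> rx; apply: filterS (zc i (x ord0 i - r) _); last by rewrite subr_gt0.
    by move=> k; rewrite lte_fin mxE ltr_norml => /andP[]; lra.
  by apply: filterS => k ko; rewrite !indicE !mem_set.
have /existsNP[i nai] := xo.
have : \forall k \near \oo, ~ (a i < ((x + z k) ord0 i)%:E)%E.
  have := xa i; move: nai.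
  case: (a i) => [r||]; rewrite ?lte_fin ?eqe; last 2 first.
  - by move=> _ _; apply: nearW => k; rewrite ltNge leey.
  - by move=> h; exfalso; apply: h; exact: ltNyr.
  move=> /negP; rewrite -leNgt => xr xnr.
  have {xr xnr}xr : x ord0 i < r by rewrite lt_neqAle xnr.
  apply: filterS (zc i (r - x ord0 i) _); last by rewrite subr_gt0.
  by move=> k; rewrite lte_fin mxE ltr_norml => /andP[_ h1]; apply/negP; rewrite -leNgt; lra.
apply: filterS => k ko; rewrite !indicE !memNset// => h; exact: (ko (h i)).
Qed.

(** Off the finitely many hyperplanes that bound the orthant, the translated
    indicators are eventually constant; dominated convergence concludes. *)
Lemma tcont_orthant a : tcont (\1_(orthant a)).
Proof.
move=> N z N0 z0 e e0.
pose I : V -> R := \1_(orthant a).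
have mI : measurable_fun setT I by apply: measurable_indic; exact: measurable_orthant.
have mN : measurable (cube (0 : V) N) by exact: measurable_cube.
have bad0 : mu.-negligible (\bigcup_(i in [set: 'I_n]) [set x : V | (x ord0 i)%:E = a i]).
  have -> : \bigcup_(i in [set: 'I_n]) [set x : V | (x ord0 i)%:E = a i] =
      \bigcup_k [set x : V | exists2 i : 'I_n, (i : nat) = k & (x ord0 i)%:E = a i].
    apply/seteqP; split => x /= [k _]; first by move=> xk; exists (k : nat) => //; exists k.
    by move=> [i _ xi]; exists i.
  apply: negligible_bigcup => k.
  have [kn|kn] := ltnP k n; last first.
    apply: (negligibleS _ (negligible_set0 _)) => x [i ik _].
    by have := ltn_ord i; rewrite ik ltnNge kn.
  pose i := Ordinal kn.
  apply: (negligibleS (A := [set x : V | x ord0 i = fine (a i)])).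
    move=> x [j jk]; have -> : j = i by exact: val_inj.
    by move=> /(congr1 fine).
  apply/negligibleP; last exact: lebesgue_hyperplane.
  rewrite -[X in measurable X]setTI.
  exact: (@measurable_coord R n i measurableT [set fine (a i)]).
have aecvg : {ae mu, forall x, cube 0 N x ->
    (`|I (x + z k) - I x|%:E)%E @[k --> \oo] --> (cst 0%E : V -> \bar R) x}.
  apply: negligibleS bad0 => x /= /not_implyP[_ nc]; apply: contrapT => nb.
  apply: nc; apply: cvg_near_cst.
  have xa i : (x ord0 i)%:E != a i by apply/eqP => xi; apply: nb; exists i.
  by apply: filterS (near_orthant xa z0) => k; rewrite -/I => ->; rewrite subrr normr0.
have i1 : mu.-integrable (cube 0 N) (cst 1%E : V -> \bar R).
  apply: (@ge0_integrable _ _ _ mu (cube 0 N) (cst 1)) => //.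
  have cN : (mu (cube (0 : V) N) < +oo)%E by rewrite lebesgue_cube ?ltry// ltW.
  by rewrite (eq_integral (cst 1%E))// integral_cst// mul1e.
have dom : {ae mu, forall x, (forall k : nat, cube 0 N x -> (`|(`|I (x + z k) - I x|)%:E| <= cst 1%E x)%E)}.
  apply: aeW => x k _; rewrite lee_fin normr_id /I !indicE.
  by case: (_ \in _); case: (_ \in _); rewrite ?subrr ?subr0 ?sub0r ?normrN ?normr0 ?normr1.
have [_ _ +] := @dominated_convergence _ _ _ mu (cube 0 N) mN
  (fun k x => (`|I (x + z k) - I x|)%:E) (cst 0%E) (cst 1%E)
  (fun k => measurable_funTS (measurableT_comp (@EFin_measurable _ setT) (measurable_tdiff (z k) mI)))
  (measurable_cst _) aecvg i1 dom.
rewrite integral0 => c.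
have ne : nbhs (0%:E : \bar R) [set y | (y < e%:E)%E].
  exact: (@nbhs_open_ereal_lt R 0 (fun=> e) e0).
have near_lt : \forall k \near \oo, (tdiff I N (z k) < e%:E)%E by exact: (c _ ne).
by apply: filterS near_lt => k /ltW.
Qed.

Lemma tcont_setC A : tcont (\1_A) -> tcont (\1_(~` A)).
Proof.
move=> cA N z N0 z0 e e0.
apply: filterS (cA N z N0 z0 e e0) => k.
suff -> : tdiff (\1_(~` A)) N (z k) = tdiff (\1_A) N (z k) by [].
apply: eq_integral => x _; congr EFin.
rewrite !indicE !in_setC; case: (_ \in A); case: (_ \in A);
  by rewrite ?subrr ?subr0 ?sub0r ?normrN.
Qed.

Lemma tcont_indicT : tcont (\1_[set: V]).
Proof.
suff <- : orthant (fun=> -oo%E) = setT by exact: tcont_orthant.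
by apply/seteqP; split => // x _ i; exact: ltNyr.
Qed.

Lemma tcont_bigsetU (F : nat -> set V) (m : nat) :
  (forall i, measurable (F i)) -> (forall i, tcont (\1_(F i))) ->
  tcont (\1_(\big[setU/set0]_(i < m) F i)).
Proof.
move=> mF cF; elim: m => [|m IH].
  by rewrite big_ord0 -setCT; apply: tcont_setC; exact: tcont_indicT.
rewrite big_ord_recr/=.
set S := \big[setU/set0]_(i < m) F i.
have mS : measurable S by exact: bigsetU_measurable.
apply: (@tcont_le (\1_S) (\1_(F m))) => //; try exact: measurable_indic.
  by apply: measurable_indic; exact: measurableU.
move=> x y; rewrite !indicE !in_setU.
case: (x \in S); case: (x \in F m); case: (y \in S); case: (y \in F m);
  by rewrite /= ?subrr ?subr0 ?sub0r ?normrN ?normr0 ?normr1 ?addr0 ?add0r ?lerDl.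
Qed.

(** Dynkin's theorem: countable unions are approximated by finite ones, since the
    part of the tail inside a cube has small measure. *)
Lemma tcont_indic A : measurable A -> tcont (\1_A).
Proof.
rewrite orthant_generate.
apply: (@dynkin_induction _ _ orthants (fun A => tcont (\1_A)) orthant_generate
  setI_closed_orthants).
- exact: tcont_indicT.
- by move=> _ [a _ <-]; exact: tcont_orthant.
- by move=> S _; exact: tcont_setC.
move=> F mF _ cF.
have mU : measurable (\bigcup_k F k) by exact: bigcupT_measurable.
apply: tcont_approx => [|N e N0 e0]; first exact: measurable_indic.
pose S m := \big[setU/set0]_(i < m) F i.
have mS m : measurable (S m) by exact: bigsetU_measurable.
pose T m := cube 0 N `&` (\bigcup_k F k `\` S m).
have mN : measurable (cube (0 : V) N) by exact: measurable_cube.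
have mT m : measurable (T m) by apply: measurableI => //; exact: measurableD.
have T0 : \bigcap_m T m = set0.
  apply/seteqP; split => // x h.
  have [_ [[k _ Fk] _]] := h 0%N I; have [_ [_]] := h k.+1 I; apply.
  by rewrite /S big_ord_recr/=; right.
have T0oo : (mu (T 0%N) < +oo)%E.
  apply: (@le_lt_trans _ _ (mu (cube 0 N))); first by apply: le_measure; rewrite ?inE// => x [].
  by rewrite lebesgue_cube ?ltry// ltW.
have mT0 : measurable (\bigcap_m T m) by rewrite T0.
have ndT : {homo T : n m / (n <= m)%N >-> (m <= n)%O}.
  move=> i j ij; apply/subsetPset; apply: setIS => x [Ux nS]; split => //.
  by apply: contra_not nS; apply: subset_bigsetU.
have c := nonincreasing_cvg_mu T0oo mT mT0 ndT.
rewrite T0 measure0 in c.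
have ne : nbhs (0%:E : \bar R) [set y | (y < e%:E)%E].
  exact: (@nbhs_open_ereal_lt R 0 (fun=> e) e0).
have : \forall m \near \oo, (mu (T m) < e%:E)%E by exact: (c _ ne).
move=> [m _ /(_ m (leqnn m)) Tm].
exists (\1_(S m)); split.
- exact: measurable_indic.
- exact: tcont_bigsetU.
apply: le_trans (ltW Tm).
rewrite (eq_integral (fun x => (\1_(\bigcup_k F k `\` S m) x)%:E)); last first.
  move=> x _; congr EFin; rewrite !indicE in_setD.
  have [xS|xS] := boolP (x \in S m); last by rewrite subr0 andbT normr_nat.
  rewrite (_ : x \in _ = true) ?subrr ?normr0 ?andbF//.
  by apply/mem_set; move/set_mem : xS; exact: bigsetU_bigcup.
have mUS : measurable (\bigcup_k F k `\` S m) by exact: measurableD.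
by rewrite (integral_indic mu mN mUS) [X in mu X]setIC.
Qed.

(** Layer cake: the sum counts the positive multiples of [1 / m] up to [t]. *)
Lemma layer_cake_le (t : R) (m : nat) : (0 < m)%N -> 0 <= t <= 1 ->
  `|t - m%:R^-1 * \sum_(j < m) (j.+1%:R / m%:R <= t)%R%:R| <= m%:R^-1.
Proof.
move=> m0 /andP[t0 t1]; have mR : 0 < m%:R :> R by rewrite ltr0n.
pose l := Num.trunc (m%:R * t).
have mt0 : 0 <= m%:R * t by rewrite mulr_ge0// ltW.
have lm : (l <= m)%N.
  rewrite -(ler_nat R) (@le_trans _ _ (m%:R * t))//; first by have /andP[] := truncn_itv mt0.
  by rewrite ler_piMr// ltW.
have -> : \sum_(j < m) ((j.+1%:R / m%:R <= t)%R%:R : R) = l%:R.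
  transitivity (\sum_(j < m) ((j < l)%N%:R : R)).
    by apply: eq_bigr => j _; rewrite ler_pdivrMr// mulrC -truncn_gt_nat.
  rewrite -natr_sum; congr (_%:R).
  by rewrite -big_mkcond/= -(big_ord_widen _ (fun=> 1%N) lm)/= sum1_card card_ord.
have /andP[l1 l2] := truncn_itv mt0.
rewrite -/l in l1 l2.
have -> : t - m%:R^-1 * l%:R = m%:R^-1 * (m%:R * t - l%:R).
  by rewrite mulrBr mulKf// gt_eqF.
rewrite normrM gtr0_norm ?invr_gt0// ler_piMr ?invr_ge0 ?(ltW mR)//.
rewrite ger0_norm ?subr_ge0// lerBlDl -natr1 in l2 *.
by rewrite ltW.
Qed.

Lemma tcont_sum (I : Type) (r : seq I) (F : I -> V -> R) :
  (forall i, measurable_fun setT (F i)) -> (forall i, tcont (F i)) ->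
  tcont (fun x => \sum_(i <- r) F i x).
Proof.
move=> mF cF; elim: r => [|i r IH].
  move=> N z N0 z0 e e0; apply: nearW => k.
  rewrite /tdiff integral0_eq ?lee_fin ?(ltW e0)// => x _.
  by rewrite !big_nil subrr normr0.
apply: (@tcont_le (F i) (fun x => \sum_(j <- r) F j x)) => //.
- exact: measurable_sum.
- exact: measurable_sum.
- move=> x y; rewrite !big_cons opprD addrACA; exact: ler_normD.
Qed.

Lemma tcont_scale (c : R) f : 0 <= c <= 1 -> measurable_fun setT f -> tcont f ->
  tcont (fun x => c * f x).
Proof.
move=> /andP[c0 c1] mf cf; apply: (@tcont_le f (cst 0)) => //.
- exact: measurable_funM.
- move=> x y; rewrite subrr normr0 addr0 -mulrBr normrM ger0_norm// ler_piMl//.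
move=> N z N0 z0 e e0; apply: nearW => k.
by rewrite /tdiff integral0_eq ?lee_fin ?(ltW e0)// => x _; rewrite subrr normr0.
Qed.

Lemma tcont_unit f : measurable_fun setT f -> (forall x, 0 <= f x <= 1) -> tcont f.
Proof.
move=> mf f01; apply: tcont_approx => // N e N0 e0.
have mN : measurable (cube (0 : V) N) by exact: measurable_cube.
pose c := (N *+ 2) ^+ n.
have c0 : 0 <= c by rewrite exprn_ge0// mulrn_wge0// ltW.
have [m _ /(_ m (leqnn m))/= mc] := near_infty_natSinv_lt (PosNum (divr_gt0 e0 (ltr_pwDr ltr01 c0))).
pose L (j : 'I_m.+1) := [set x | j.+1%:R / m.+1%:R <= f x].
have mL j : measurable (L j).
  rewrite -[X in measurable X]setTI (_ : L j = f @^-1` `[j.+1%:R / m.+1%:R, +oo[%classic).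
    exact: mf.
  by apply/seteqP; split => x /=; rewrite in_itv/= andbT.
have mI j : measurable_fun setT (\1_(L j) : V -> R) by exact: measurable_indic.
have mS : measurable_fun setT (fun x => \sum_(j < m.+1) (\1_(L j) x : R)) by exact: measurable_sum.
exists (fun x => m.+1%:R^-1 * \sum_(j < m.+1) \1_(L j) x); split.
- exact: measurable_funM.
- apply: tcont_scale => //; first by rewrite invr_ge0 ler0n/= invf_le1 ?ler1n.
  by apply: tcont_sum => // j; exact: tcont_indic.
apply: (@le_trans _ _ (\int[mu]_(x in cube 0 N) (m.+1%:R^-1)%:E)%E).
  apply: ge0_le_integral_EFin => //.
    by apply: measurableT_comp => //; apply: measurable_funB => //; exact: measurable_funM.
  move=> x _; rewrite (_ : \sum_(j < m.+1) \1_(L j) x = \sum_(j < m.+1) ((j.+1%:R / m.+1%:R <= f x)%R%:R : R)).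
    exact: layer_cake_le.
  apply: eq_bigr => j _; rewrite indicE.
  by have -> : (x \in L j) = (j.+1%:R / m.+1%:R <= f x) by apply/idP/idP => [/set_mem//|h]; exact: mem_set.
rewrite integral_cst// [X in (_ * X)%E](lebesgue_cube 0 (ltW N0)) -EFinM lee_fin -/c.
rewrite ltr_pdivlMr// in mc; last by rewrite ltr_pwDr.
apply: le_trans (ltW mc); rewrite ler_wpM2l//; lra.
Qed.

(** Since [f] has bounded support, only one cube matters, and continuity along
    all sequences gives a uniform radius. *)
Lemma translation_continuity f (N : R) : 0 < N -> measurable_fun setT f ->
  (forall x, 0 <= f x <= 1) -> (forall x, ~ cube 0 N x -> f x = 0) ->
  forall e : R, 0 < e -> exists2 d : R, 0 < d &
    forall z, `|z| < d -> (\int[mu]_x `|f (x + z) - f x|%:E <= e%:E)%E.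
Proof.
move=> N0 mf f01 f0 e e0; apply: contrapT => nd.
have ex (k : nat) : exists z : V, `|z| < k.+1%:R^-1 /\
    ~ (\int[mu]_x `|f (x + z) - f x|%:E <= e%:E)%E.
  apply: contrapT => /forallNP h; apply: nd; exists k.+1%:R^-1.
    by rewrite invr_gt0.
  by move=> z zk; have /not_andP[//|/contrapT] := h z.
have /choice[z Hz] := ex.
have z0 : z k @[k --> \oo] --> (0 : V).
  apply/cvgrPdist_lt => d d0; near=> k; rewrite sub0r normrN.
  by apply: lt_trans (Hz k).1 _; near: k; exact: (near_infty_natSinv_lt (PosNum d0)).
have N1 : 0 < N + 1 by rewrite addr_gt0.
have [k _ /(_ k (leqnn k)) hk] := tcont_unit mf f01 N1 z0 e0.
apply: (Hz k).2; apply: le_trans hk.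
rewrite /tdiff -[leRHS]integral_indic_mul.
have md := measurable_tdiff (z k) mf.
have mi : measurable_fun setT (\1_(cube 0 (N + 1)) : V -> R).
  by apply: measurable_indic; exact: measurable_cube.
apply: ge0_le_integral_EFin => //; first exact: measurable_funM.
move=> x _; rewrite indicE; case: (boolP (x \in _)) => [_|/negP xN]; first by rewrite mul1r.
have zk1 : `|z k| < 1.
  by apply: lt_le_trans (Hz k).1 _; rewrite invf_le1 ?ler1n// ltr0n.
have xN' : ~ (`|x| < N + 1).
  by move=> h; apply: xN; apply/mem_set; rewrite cubeE//= subr0.
rewrite (f0 x) ?(f0 (x + z k)) ?subrr ?normr0 ?mulr0//.
  rewrite cubeE//= subr0 => h; apply: xN'.
  rewrite -[x](addrK (z k)) (le_lt_trans (ler_normB _ _))// ltrD//.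
rewrite cubeE//= subr0 => h; apply: xN'; rewrite (lt_trans h)// ltrDl//.
Unshelve. all: by end_near. Qed.

End translation_continuity.

(** * Averages over small translations *)

Section pair_measure.
Context (R : realType) (n : nat).
Local Notation mu := (lebesgue_rV R n).

(** The product measure under a name that carries its sigma-finiteness, for
    Tonelli's theorem with a third variable. *)
Definition pair_measure : set ('rV[R]_n * 'rV[R]_n) -> \bar R := (mu \x mu)%E.

HB.instance Definition _ := Measure.on pair_measure.

Let cube_cover : sigma_finite setT pair_measure.
Proof.
exists (fun k => cube 0 k.+1%:R `*` cube 0 k.+1%:R).
  rewrite predeqE => -[x y]; split => // _.
  exists (Num.truncn (Num.max `|x| `|y|)) => //; rewrite cubeE//.
  have b : Num.max `|x| `|y| < (Num.truncn (Num.max `|x| `|y|)).+1%:R.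
    exact: truncnS_gt.
  by split; rewrite /= subr0 (le_lt_trans _ b)// le_max lexx ?orbT.
move=> k; have mc := @measurable_cube R n 0 k.+1%:R.
split; first exact: measurableX.
rewrite /pair_measure [ltLHS]product_measure1E//.
have -> : mu (cube 0 k.+1%:R) = ((k.+1%:R *+ 2) ^+ n)%:E by exact: lebesgue_cube.
rewrite [X in (X * _)%E](_ : _ = ((k.+1%:R *+ 2) ^+ n)%:E); last exact: lebesgue_cube.
by rewrite -EFinM ltry.
Qed.

HB.instance Definition _ := Measure_isSigmaFinite.Build _ _ _ pair_measure cube_cover.

End pair_measure.

Section average.
Context (R : realType) (n : nat).
Local Notation mu := (lebesgue_rV R n).
Local Notation V := ('rV[R]_n).
Variables (W : V -> R) (eps : R).
Hypothesis W0 : forall z, 0 <= W z.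
Hypothesis iW : mu.-integrable setT (EFin \o W).
Hypothesis W1 : Rintegral mu setT W = 1.
Hypothesis Wout : forall z, eps <= `|z| -> W z = 0.
Variable eta : V -> R.
Hypothesis meta : measurable_fun setT eta.
Hypothesis eta01 : forall x, 0 <= eta x <= 1.

Let mW : measurable_fun setT W.
Proof. by have /measurable_EFinP := measurable_int _ iW. Qed.

Definition average (x : V) : R := Rintegral mu setT (fun z => eta (x + z) * W z).

Lemma measurable_add (x : V) (f : V -> R) : measurable_fun setT f ->
  measurable_fun setT (fun z : V => f (x + z)).
Proof.
move=> mf; have := measurable_shift_fun x mf.
by under eq_fun do rewrite addrC.
Qed.

Lemma integrable_boundedM (f : V -> R) (c : R) : measurable_fun setT f ->
  (forall z, `|f z| <= c) -> mu.-integrable setT (EFin \o (fun z => f z * W z)).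
Proof.
move=> mf fc; apply: (le_integrable measurableT) (integrableZl measurableT c iW).
  by apply/measurable_EFinP; exact: measurable_funM.
move=> z _ /=; rewrite lee_fin !normrM ler_wpM2r//.
exact: le_trans (fc z) (ler_norm _).
Qed.

Let eta_le1 x : `|eta x| <= 1.
Proof. by have /andP[? ?] := eta01 x; rewrite ger0_norm. Qed.

Let ie x : mu.-integrable setT (EFin \o (fun z => eta (x + z) * W z)).
Proof. by apply: (@integrable_boundedM _ 1) => //; exact: measurable_add. Qed.

Lemma average01 x : 0 <= average x <= 1.
Proof.
apply/andP; split.
  by apply: Rintegral_ge0 => z _; rewrite mulr_ge0//; have /andP[] := eta01 (x + z).
rewrite -W1; apply: le_Rintegral => // z _.
by rewrite ler_piMl//; have /andP[] := eta01 (x + z).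
Qed.

Lemma average_eq0 x : (forall z, `|z| < eps -> eta (x + z) = 0) -> average x = 0.
Proof.
move=> h; transitivity (Rintegral mu setT (cst 0 : V -> R)); last first.
  by rewrite Rintegral_cst// mul0r.
apply: eq_Rintegral => z _ /=.
by have [/Wout->|/h->] := leP eps `|z|; rewrite ?mulr0 ?mul0r.
Qed.

Lemma average_sub_cst x (c : R) :
  average x - c = Rintegral mu setT (fun z => (eta (x + z) - c) * W z).
Proof.
transitivity (Rintegral mu setT (fun z => eta (x + z) * W z - c * W z)); last first.
  by apply: eq_Rintegral => z _; rewrite mulrBl.
rewrite RintegralB//; last exact: (integrableZl measurableT c iW).
by rewrite RintegralZl// W1 mulr1.
Qed.

Lemma average_sub x y :
  average x - average y = Rintegral mu setT (fun z => (eta (x + z) - eta (y + z)) * W z).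
Proof.
rewrite -RintegralB//.
by apply: eq_Rintegral => z _; rewrite mulrBl.
Qed.

Let dist_le1 x y : `|eta x - eta y| <= 1.
Proof.
have /andP[? ?] := eta01 x; have /andP[? ?] := eta01 y.
by rewrite ler_norml; apply/andP; split; lra.
Qed.

Let mdist x y : measurable_fun setT (fun z : V => eta (x + z) - eta (y + z)).
Proof. by apply: measurable_funB; exact: measurable_add. Qed.

Let mdistc x (c : R) : measurable_fun setT (fun z : V => eta (x + z) - c).
Proof. by apply: measurable_funB; [exact: measurable_add|exact: measurable_cst]. Qed.

Lemma average_dist_le x :
  (`|average x - eta x|%:E <= \int[mu]_z (`|eta (x + z) - eta x| * W z)%:E)%E.
Proof.
rewrite average_sub_cst.
have i1 : mu.-integrable setT (EFin \o (fun z => (eta (x + z) - eta x) * W z)).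
  by apply: (@integrable_boundedM _ 1) => //.
have i2 : mu.-integrable setT (EFin \o (fun z => `|eta (x + z) - eta x| * W z)).
  apply: (@integrable_boundedM _ 1) => [|z]; first exact: measurableT_comp.
  by rewrite normr_id.
rewrite (integrable_RintegralE i2) lee_fin.
apply: le_trans (le_normr_Rintegral measurableT i1) _.
rewrite le_eqVlt; apply/orP; left; apply/eqP; apply: eq_Rintegral => z _.
by rewrite normrM (ger0_norm (W0 z)).
Qed.

Lemma measurable_addition : measurable_fun setT (fun q : V * V => q.1 + q.2).
Proof.
apply/measurable_fun_rVP => i; under eq_fun do rewrite mxE.
apply: measurable_funD.
  exact: (measurable_comp1 (measurable_coord i)).
exact: (measurable_comp2 (measurable_coord i)).
Qed.

(** By Tonelli's theorem, the error in mean is at most the average of the errors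
    in mean of the translates. *)
Lemma integral_average_dist (e : R) : 0 <= e ->
  (forall z, `|z| < eps -> (\int[mu]_x `|eta (x + z) - eta x|%:E <= e%:E)%E) ->
  measurable_fun setT average ->
  (\int[mu]_x `|average x - eta x|%:E <= e%:E)%E.
Proof.
move=> e0 he mav.
pose F (q : V * V) : R := `|eta (q.1 + q.2) - eta q.1| * W q.2.
have mF : measurable_fun setT F.
  apply: measurable_funM; last exact: measurable_comp2.
  apply: measurableT_comp => //; apply: measurable_funB; last exact: measurable_comp1.
  exact: (measurableT_comp meta measurable_addition).
have F0 q : 0 <= F q by rewrite mulr_ge0.
have mFE : measurable_fun setT (EFin \o F) by exact/measurable_EFinP.
apply: (@le_trans _ _ (\int[mu]_x fubini_F mu (EFin \o F) x)%E).
  apply: ge0_le_integral => //.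
  - by apply/measurable_EFinP; apply: measurableT_comp => //; exact: measurable_funB.
  - by apply: measurable_fun_fubini_tonelli_F.
  - by move=> x _; exact: average_dist_le.
rewrite fubini_tonelli//.
apply: (@le_trans _ _ (\int[mu]_z (e * W z)%:E)%E); last first.
  rewrite (integrable_RintegralE (integrableZl measurableT e iW)).
  by rewrite RintegralZl// W1 mulr1.
apply: ge0_le_integral => //.
- by move=> z _; apply: integral_ge0 => x _; rewrite lee_fin.
- exact: measurable_fun_fubini_tonelli_G.
- by apply/measurable_EFinP; exact: measurable_funM.
move=> z _; rewrite /fubini_G/= /F/=.
under eq_integral do rewrite EFinM.
rewrite ge0_integralZr//; last 2 first.
- apply/measurable_EFinP; apply: measurableT_comp => //; apply: measurable_funB => //.
  exact: measurable_shift_fun.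
- by rewrite lee_fin.
rewrite EFinM; have [/Wout->|ze] := leP eps `|z|; first by rewrite !mule0.
by apply: lee_wpmul2r; [rewrite lee_fin|exact: he].
Qed.

(** Jensen's inequality up to a constant. Writing [b] for the left-hand increment,
    [b^p = b^(p-1) * b] is at most the average of [b^(p-1) * d], with [d] the
    translated increments; Young's inequality bounds this by [b^p / 2] plus a
    multiple of the average of [d^p], and the first term is absorbed. *)
Lemma average_powR_le (p : R) x y : 1 < p ->
  ((`|average x - average y| `^ p)%:E <=
    (2 `^ p)%:E * \int[mu]_z (`|eta (x + z) - eta (y + z)| `^ p * W z)%:E)%E.
Proof.
move=> p1; have p0 : 0 < p by lra.
pose d z := `|eta (x + z) - eta (y + z)|.
have d0 z : 0 <= d z by exact: normr_ge0.
have d1 z : d z <= 1 by exact: dist_le1.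
have md : measurable_fun setT d by apply: measurableT_comp => //; exact: mdist.
have i2 : mu.-integrable setT (EFin \o (fun z => d z `^ p * W z)).
  apply: (@integrable_boundedM _ 1) => [|z]; first exact: measurable_powR_fun.
  rewrite ger0_norm ?powR_ge0// -[leRHS](_ : 1 `^ p = 1); last by rewrite powR1.
  by apply: ge0_ler_powR; rewrite ?nnegrE ?(ltW p0) ?d0 ?d1.
have i1 : mu.-integrable setT (EFin \o (fun z => d z * W z)).
  by apply: (@integrable_boundedM _ 1) => // z; rewrite normr_id.
have i0 : mu.-integrable setT (EFin \o (fun z => (eta (x + z) - eta (y + z)) * W z)).
  by apply: (@integrable_boundedM _ 1) => // z.
rewrite (integrable_RintegralE i2) -EFinM lee_fin.
set b := `|average x - average y|; set B := Rintegral _ _ _.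
have b0 : 0 <= b by exact: normr_ge0.
have bd : b <= Rintegral mu setT (fun z => d z * W z).
  rewrite /b average_sub; apply: le_trans (le_normr_Rintegral measurableT i0) _.
  rewrite le_eqVlt; apply/orP; left; apply/eqP; apply: eq_Rintegral => z _.
  by rewrite normrM (ger0_norm (W0 z)).
have half0 : 0 < (2^-1 : R) by rewrite invr_gt0.
have key : b `^ p <= 2^-1 * b `^ p + 2 `^ (p - 1) * B.
  rewrite -{1}(mulr_powRB1 b0 p0) mulrC.
  apply: (@le_trans _ _ (b `^ (p - 1) * Rintegral mu setT (fun z => d z * W z))).
    by rewrite ler_wpM2l// powR_ge0.
  rewrite -RintegralZl//.
  have -> : 2^-1 * b `^ p + 2 `^ (p - 1) * B =
      Rintegral mu setT (fun z => (2^-1 * b `^ p) * W z + 2 `^ (p - 1) * (d z `^ p * W z)).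
    rewrite RintegralD//; last 2 first.
    - exact: (integrableZl measurableT _ iW).
    - exact: (integrableZl measurableT _ i2).
    by rewrite !RintegralZl// W1 mulr1.
  apply: le_Rintegral => //.
  - exact: (integrableZl measurableT _ i1).
  - exact: (integrableD measurableT (integrableZl measurableT (2^-1 * b `^ p) iW)
     (integrableZl measurableT (2 `^ (p - 1)) i2)).
  move=> z _; rewrite !mulrA -mulrDl ler_wpM2r//.
  have := young_split p1 half0 b0 (normr_ge0 (eta (x + z) - eta (y + z))).
  by rewrite -powR_inv1// -powRrM (_ : -1 * (1 - p) = p - 1)//; ring.
have -> : 2 `^ p = 2 * 2 `^ (p - 1) by rewrite mulr_powRB1.
move: key; rewrite -mulrA; move: (b `^ p) (_ * B) => u v; lra.
Qed.

(** Translating both points by the same vector does not change their distance, so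
    the pointwise inequality can be integrated against the singular kernel. *)
Lemma gagliardo_average (s p : R) (U U' : set V) : 1 < p ->
  measurable U -> measurable U' ->
  (forall x z, U x -> `|z| < eps -> U' (x + z)) ->
  measurable_fun setT average ->
  (gagliardo s p U average <= (2 `^ p)%:E * gagliardo s p U' eta)%E.
Proof.
move=> p1 mU mU' UU' mav.
pose D := fun q : V * V => enorm (q.1 - q.2) `^ (n%:R + s * p).
pose F (q : (V * V) * V) : R :=
  \1_(U `*` U) q.1 * (gagliardo_density s p (fun x => eta (x + q.2)) q.1 * W q.2).
have mUU : measurable (U `*` U) by exact: measurableX.
have mUU' : measurable (U' `*` U') by exact: measurableX.
have F0 q : 0 <= F q by do 2 apply: mulr_ge0 => //; exact: gagliardo_density_ge0.
have m11 : measurable_fun setT (fun q : (V * V) * V => q.1.1).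
  exact: (measurableT_comp measurable_fst measurable_fst).
have m12 : measurable_fun setT (fun q : (V * V) * V => q.1.2).
  exact: (measurableT_comp measurable_snd measurable_fst).
have mF : measurable_fun setT F.
  apply: measurable_funM.
    by apply: (measurableT_comp _ measurable_fst); exact: measurable_indic.
  apply: measurable_funM; last exact: (measurableT_comp mW measurable_snd).
  rewrite /gagliardo_density; under eq_fun do rewrite -powRN.
  apply: measurable_funM; apply: measurable_powR_fun; last first.
    exact: (measurableT_comp (@measurable_enorm_diff R n) measurable_fst).
  apply: measurableT_comp => //; apply: measurable_funB.
    apply: (measurableT_comp meta).
    exact: (measurableT_comp measurable_addition (measurable_fun_pair m11 measurable_snd)).
  apply: (measurableT_comp meta).
  exact: (measurableT_comp measurable_addition (measurable_fun_pair m12 measurable_snd)).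
have mFE : measurable_fun setT (EFin \o F) by exact/measurable_EFinP.
have m2 : measurable_fun setT (fun z => fubini_F mu (EFin \o F) z).
  exact: measurable_fun_fubini_tonelli_F.
have p20 : (0 <= (2 `^ p)%:E :> \bar R)%E by rewrite lee_fin powR_ge0.
apply: (@le_trans _ _ ((2 `^ p)%:E * \int[mu \x mu]_z fubini_F mu (EFin \o F) z)%E).
  rewrite -ge0_integralZl//; last by move=> z _; apply: integral_ge0 => ? _; rewrite lee_fin.
  rewrite /gagliardo -integral_indic_mul.
  apply: ge0_le_integral => //.
  - by move=> z _; rewrite lee_fin mulr_ge0// gagliardo_density_ge0.
  - apply/measurable_EFinP; apply: measurable_funM; first exact: measurable_indic.
    exact: measurable_gagliardo_density.
  - by apply: emeasurable_funM.
  move=> [x y] _; rewrite /fubini_F/= /F/=.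
  have [xy|xy] := boolP ((x, y) \in U `*` U); last first.
    rewrite indicE (negbTE xy) mul0r mule_ge0//.
    by apply: integral_ge0 => z _; rewrite mul0r.
  rewrite indicE xy mul1r.
  under [X in (_ <= _ * X)%E]eq_integral do rewrite mul1r.
  rewrite /gagliardo_density/=.
  set E := enorm (x - y) `^ _.
  have E0 : 0 <= E^-1 by rewrite invr_ge0 powR_ge0.
  rewrite EFinM; under [X in (_ <= _ * X)%E]eq_integral do rewrite mulrAC EFinM.
  rewrite ge0_integralZr//; last 2 first.
  - apply/measurable_EFinP; apply: measurable_funM => //; apply: measurable_powR_fun.
    by apply: measurableT_comp => //; exact: mdist.
  - by move=> z _; rewrite lee_fin mulr_ge0 ?powR_ge0.
  rewrite muleA; apply: lee_wpmul2r; first by rewrite lee_fin.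
  exact: average_powR_le.
apply: lee_wpmul2l => //.
have F0E z : (0 <= (EFin \o F) z)%E by rewrite lee_fin.
have swap := @fubini_tonelli _ _ _ _ R (@pair_measure R n) mu (EFin \o F) mFE F0E.
rewrite [leLHS]swap {swap}.
apply: (@le_trans _ _ (\int[mu]_z ((W z)%:E * gagliardo s p U' eta))%E); last first.
  rewrite ge0_integralZr//; last 2 first.
  - by move=> z _; rewrite lee_fin.
  - by apply: integral_ge0 => z _; rewrite lee_fin gagliardo_density_ge0.
  - by rewrite (integrable_RintegralE iW) W1 mul1e.
  - exact/measurable_EFinP.
apply: ge0_le_integral => //.
- by move=> z _; apply: integral_ge0 => x _; rewrite lee_fin.
- exact: measurable_fun_fubini_tonelli_G.
- by apply: emeasurable_funM => //; exact/measurable_EFinP.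
move=> z _; rewrite /fubini_G/= /F/=.
have [/Wout Wz|ze] := leP eps `|z|.
  rewrite Wz mul0e integral0_eq// => q _.
  by rewrite mulr0 mulr0.
under eq_integral do rewrite mulrA EFinM.
rewrite ge0_integralZr//; last 3 first.
- apply/measurable_EFinP; apply: measurable_funM; first exact: measurable_indic.
  by apply: measurable_gagliardo_density; exact: measurable_shift_fun.
- by move=> q _; rewrite lee_fin mulr_ge0// gagliardo_density_ge0.
- by rewrite lee_fin.
rewrite muleC; apply: lee_wpmul2l; first by rewrite lee_fin.
have mg : measurable_fun setT (fun q => \1_(U' `*` U') q * gagliardo_density s p eta q).
  by apply: measurable_funM; [exact: measurable_indic|exact: measurable_gagliardo_density].
rewrite /gagliardo -[leRHS]integral_indic_mul.
rewrite -[leRHS](@ge0_integral_shift2 _ _ z); last 2 first.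
- exact/measurable_EFinP.
- by move=> q; rewrite lee_fin mulr_ge0// gagliardo_density_ge0.
pose f (q : V * V) : R := \1_(U `*` U) q * gagliardo_density s p (fun x => eta (x + z)) q.
pose g (q : V * V) : R := \1_(U' `*` U') q * gagliardo_density s p eta q.
have mf : measurable_fun setT f.
  apply: measurable_funM; first exact: measurable_indic.
  by apply: measurable_gagliardo_density; exact: measurable_shift_fun.
have mgz : measurable_fun setT (fun q : V * V => g (q.1 + z, q.2 + z)).
  apply: (measurableT_comp mg); apply: measurable_fun_pair.
    exact: (measurableT_comp (@measurable_rV_shift R n z) measurable_fst).
  exact: (measurableT_comp (@measurable_rV_shift R n z) measurable_snd).
apply: (@ge0_le_integral_EFin _ _ R (mu \x mu)%E setT f (fun q => g (q.1 + z, q.2 + z)) measurableT mf mgz).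
  by move=> q; rewrite /f mulr_ge0// gagliardo_density_ge0.
move=> [x y] _; rewrite /f /g /=.
have -> : gagliardo_density s p eta (x + z, y + z) =
    gagliardo_density s p (fun x => eta (x + z)) (x, y).
  by rewrite /gagliardo_density/= opprD addrACA subrr addr0.
apply: ler_wpM2r; first exact: gagliardo_density_ge0.
rewrite !indicE; case: (boolP ((x, y) \in _)) => [/set_mem[/= Ux Uy]|_]; last by [].
by rewrite mem_set//; split; exact: UU'.
Qed.

End average.

(** * Approximation by smooth functions *)

Lemma ge0_integral_eq0_ae d (T : measurableType d) (R : realType)
    (mu : {measure set T -> \bar R}) (f : T -> R) :
  measurable_fun setT f -> (forall x, 0 <= f x) ->
  (\int[mu]_x (f x)%:E = 0)%E -> {ae mu, forall x, f x = 0}.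
Proof.
move=> mf f0 If.
have mfE : measurable_fun setT (EFin \o f) by exact/measurable_EFinP.
have /(ae_eq_integral_abs mu measurableT mfE) :
    (\int[mu]_x `|(EFin \o f) x| = 0)%E.
  rewrite -[RHS]If; apply: eq_integral => x _ /=.
  by rewrite ger0_norm.
by apply: filterS => x /(_ I)/= [].
Qed.

Section mollifier.
Context (R : realType) (n : nat).
Local Notation mu := (lebesgue_rV R n).
Local Notation V := ('rV[R]_n).
Variable eps : R.
Hypothesis eps0 : 0 < eps.

Let chi (j : nat) (t : R) : R := eps^-1 ^+ j * bump_deriv j (eps^-1 * t).

Let dchi j (t : R) : is_derive t 1 (chi j) (chi j.+1 t).
Proof.
have d1 : is_derive t 1 (fun x : R => eps^-1 * x) eps^-1.
  by apply: is_deriv_eq (is_deriveZ eps^-1 (is_derive_id t 1)) _; rewrite /GRing.scale/= mulr1.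
apply: is_deriv_eq (is_deriveZ (eps^-1 ^+ j) (is_derive1_comp (is_derive_bump j _) d1)) _.
by rewrite /chi exprS /GRing.scale/=; ring.
Qed.

Let bound : exists M : nat -> R, forall j t, `|chi j t| <= M j.
Proof.
have /choice[B HB] := @bounded_bump R.
exists (fun j => eps^-1 ^+ j * B j) => j t.
have e0 : 0 <= eps^-1 ^+ j by rewrite exprn_ge0// invr_ge0 ltW.
by rewrite /chi normrM (ger0_norm e0) ler_wpM2l.
Qed.

Let Phi (w : V) : R := tensor chi (fun=> 0%N) w.

Let scaled (t : R) : `|eps^-1 * t| < 1 = (`|t| < eps).
Proof.
by rewrite normrM (gtr0_norm (_ : 0 < eps^-1)) ?invr_gt0// mulrC ltr_pdivrMr ?mul1r.
Qed.

Let Phi_ge0 w : 0 <= Phi w.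
Proof. by apply: prodr_ge0 => i _; rewrite /chi expr0 mul1r bump_ge0. Qed.

Let Phi_gt0 w : `|w| < eps -> 0 < Phi w.
Proof.
move=> /(norm_lt_coord _ eps0) we; apply: prodr_gt0 => i _.
by rewrite /chi expr0 mul1r bump_gt0// scaled.
Qed.

Let Phi_out w : eps <= `|w| -> Phi w = 0.
Proof.
move=> we; apply/eqP; apply: contraTT we => Pw; rewrite -ltNge.
apply/(norm_lt_coord _ eps0) => i; rewrite ltNge; apply: contra Pw => wi.
rewrite /Phi /tensor (bigD1 i)//= /chi bump_out ?mulr0 ?mul0r//.
by rewrite leNgt scaled -leNgt.
Qed.

Let mPhi : measurable_fun setT Phi.
Proof.
have [M bM] := bound.
by apply: continuous_measurable_rV; exact: (continuous_tensor dchi).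
Qed.

Let mPhiN : measurable_fun setT (fun z : V => Phi (- z)).
Proof.
apply: (measurableT_comp mPhi); apply/measurable_fun_rVP => i.
under eq_fun do rewrite mxE.
by apply: measurableT_comp => //; exact: measurable_coord.
Qed.

Let iPhiN : mu.-integrable setT (EFin \o (fun z : V => Phi (- z))).
Proof.
have [M bM] := bound.
have iC : mu.-integrable (cube 0 eps) (EFin \o (fun z : V => Phi (- z))).
  apply: measurable_bounded_integrable.
  - exact: measurable_cube.
  - by rewrite [ltLHS](lebesgue_cube 0 (ltW eps0)) ltry.
  - exact: measurable_funTS.
  exists (\prod_(i < n) M 0%N); split; first exact: num_real.
  by move=> B MB z _ /=; exact: le_trans (norm_tensor_le bM _ _) (ltW MB).
apply: (integrable_eqT (integrable_indic_mul (measurable_cube _ _) iC)) => z /=.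
rewrite indicE; case: (boolP (z \in _)) => [|/negP zc]; first by rewrite mul1r.
rewrite mul0r Phi_out// normrN leNgt; apply/negP => ze; apply: zc.
by rewrite inE cubeE//= subr0.
Qed.

Let c : R := Rintegral mu setT (fun z : V => Phi (- z)).

Let c_gt0 : 0 < c.
Proof.
have c0 : 0 <= c by apply: Rintegral_ge0.
rewrite lt_neqAle c0 andbT; apply/eqP => cE.
have I0 : (\int[mu]_z (Phi (- z))%:E = 0)%E by rewrite integrable_RintegralE// -/c -cE.
have [N [mN N0 PN]] := ge0_integral_eq0_ae mPhiN (fun z => Phi_ge0 (- z)) I0.
have mc := @measurable_cube R n 0 eps.
have : (mu (cube 0 eps) <= mu N)%E.
  apply: le_measure; rewrite ?inE// => z; rewrite cubeE//= subr0 => ze.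
  by apply: PN => /= /eqP; apply/negP; rewrite gt_eqF// Phi_gt0// normrN.
rewrite [leRHS]N0 [leLHS](lebesgue_cube 0 (ltW eps0)) lee_fin leNgt.
by rewrite exprn_gt0// mulrn_wgt0.
Qed.

(** The averages against a rescaled product bump are convolutions with it, so
    they are smooth. *)
Lemma smooth_averages : exists W : V -> R,
  [/\ forall z, 0 <= W z, mu.-integrable setT (EFin \o W),
    Rintegral mu setT W = 1, forall z, eps <= `|z| -> W z = 0 &
    forall eta : V -> R, mu.-integrable setT (EFin \o eta) -> (forall x, 0 <= eta x) ->
      Cinfty (average W eta)].
Proof.
have [M bM] := bound.
have ci0 : 0 <= c^-1 by rewrite invr_ge0 ltW.
exists (fun z : V => c^-1 * Phi (- z)); split.
- by move=> z; rewrite mulr_ge0.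
- exact: (integrableZl measurableT c^-1 iPhiN).
- by rewrite RintegralZl// -/c mulVf// gt_eqF.
- by move=> z ze; rewrite Phi_out ?mulr0// normrN.
move=> eta ieta eta0 k.
have /measurable_EFinP meta := measurable_int _ ieta.
have ieta' := integrableZl measurableT c^-1 ieta.
suff -> : average (fun z : V => c^-1 * Phi (- z)) eta =
    convolve chi (fun x => c^-1 * eta x) (fun=> 0%N).
  exact: (Ck_conv dchi bM ieta').
apply/funext => x; rewrite /average /convolve /Rintegral; congr fine.
pose f y := ((c^-1 * eta y) * Phi (x - y))%:E.
rewrite -[RHS](@ge0_integral_shift _ _ x f).
- by apply: eq_integral => z _; rewrite /f (addrC z x) opprD addrA subrr sub0r; congr EFin; ring.
- apply/measurable_EFinP; apply: measurable_funM; first exact: measurable_funM.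
  exact: (measurable_tensor_sub dchi).
- by move=> y; rewrite lee_fin !mulr_ge0.
Qed.

End mollifier.

Section approximation.
Context (R : realType) (n : nat).
Local Notation mu := (lebesgue_rV R n).
Local Notation V := ('rV[R]_n).

(** The series of the errors has a finite integral, so it converges almost
    everywhere and its terms tend to 0. *)
Lemma summable_ae_cvg d (T : measurableType d) (m : {measure set T -> \bar R})
    (f : nat -> T -> R) (g : T -> R) :
  (forall k, measurable_fun setT (f k)) -> measurable_fun setT g ->
  (forall k, (\int[m]_x `|f k x - g x|%:E <= (1 / (2 ^ k.+1)%:R)%:E)%E) ->
  {ae m, forall x, f k x @[k --> \oo] --> g x}.
Proof.
move=> mf mg fg; pose u k x := `|f k x - g x|%:E.
have mu k : measurable_fun setT (u k).
  by apply/measurable_EFinP; apply: measurableT_comp => //; exact: measurable_funB.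
have u0 k x : (0 <= u k x)%E by rewrite lee_fin.
have S0 x : (0 <= \sum_(k <oo) u k x)%E by exact: nneseries_ge0.
have mS : measurable_fun setT (fun x => \sum_(k <oo) u k x)%E.
  exact: ge0_emeasurable_sum.
have iS : m.-integrable setT (fun x => \sum_(k <oo) u k x)%E.
  apply/integrableP; split => //.
  under eq_integral do rewrite gee0_abs//.
  rewrite integral_nneseries//.
  apply: (@le_lt_trans _ _ (\sum_(k <oo) (1 / (2 ^ k.+1)%:R)%:E)%E).
    by apply: lee_nneseries => k; [move=> _ _; exact: integral_ge0|move=> _; exact: fg].
  by rewrite (le_lt_trans (epsilon_trick0 xpredT ler01))// ltry.
apply: filterS (integrable_ae measurableT iS) => x /(_ I) Sx.
have Soo : (\sum_(k <oo) u k x < +oo)%E by rewrite -ge0_fin_numE.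
have tail := nneseries_tail_cvg Soo (fun k _ => u0 k x).
apply/cvgrPdist_lt => e e0.
have near_e : \forall N \near \oo, (\sum_(N <= k <oo) u k x < e%:E)%E.
  exact: (tail _ (@nbhs_open_ereal_lt R 0 (fun=> e) e0)).
apply: filterS near_e => k ke; rewrite distrC -lte_fin; apply: le_lt_trans ke.
rewrite (nneseries_split _ 1)// addn1 big_nat1 leeDl//.
exact: nneseries_ge0.
Qed.

Variables (A : set V) (N r : R) (eta : V -> R).
Hypotheses (N0 : 0 <= N) (AN : forall x, A x -> `|x| <= N) (r0 : 0 < r).
Hypothesis meta : measurable_fun setT eta.
Hypothesis eta01 : forall x, 0 <= eta x <= 1.
Hypothesis eta_out : forall x, ~ A x -> eta x = 0.

Let ieta : mu.-integrable setT (EFin \o eta).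
Proof.
have mT := measurable_thicken A r.
have iT : mu.-integrable (thicken A r) (EFin \o eta).
  apply: measurable_bounded_integrable => //.
  - by rewrite (@thicken_lty _ _ A r N).
  - exact: measurable_funTS.
  exists 1; split; first exact: num_real.
  move=> B B1 x _ /=; have /andP[? ?] := eta01 x.
  by rewrite ger0_norm// (le_trans _ (ltW B1)).
apply: (integrable_eqT (integrable_indic_mul mT iT)) => x /=.
rewrite indicE; case: (boolP (x \in _)) => [|/negP xA]; first by rewrite mul1r.
rewrite mul0r eta_out// => Ax; apply: xA; rewrite inE; exact: sub_thicken.
Qed.

(** By continuity of translations, the radii of averaging can be chosen so that
    the errors in mean are summable, which gives convergence almost everywhere. *)
Lemma smooth_approximation (s p : R) : 1 < p ->
  exists etak : nat -> V -> R,
  [/\ forall k, Cinfty (etak k), forall k x, 0 <= etak k x <= 1,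
    forall k x, ~ thicken A r x -> etak k x = 0,
    {ae mu, forall x, etak k x @[k --> \oo] --> eta x} &
    forall k, (gagliardo s p (thicken A (2 * r)) (etak k) <=
      (2 `^ p)%:E * gagliardo s p (thicken A (3 * r)) eta)%E].
Proof.
move=> p1.
have N10 : 0 < N + 1 by rewrite ltr_wpDl.
have cube_out x : ~ cube 0 (N + 1) x -> eta x = 0.
  move=> xN; apply: eta_out => Ax; apply: xN; rewrite cubeE//= subr0.
  by rewrite (le_lt_trans (AN Ax))// ltrDl.
have tc := translation_continuity N10 meta eta01 cube_out.
have step k : exists f : V -> R, [/\ Cinfty f, forall x, 0 <= f x <= 1,
    forall x, ~ thicken A r x -> f x = 0,
    (\int[mu]_x `|f x - eta x|%:E <= (1 / (2 ^ k.+1)%:R)%:E)%E &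
    (gagliardo s p (thicken A (2 * r)) f <=
      (2 `^ p)%:E * gagliardo s p (thicken A (3 * r)) eta)%E].
  have e0 : 0 < 1 / (2 ^ k.+1)%:R :> R by rewrite divr_gt0// ltr0n expn_gt0.
  have [d d0 dP] := tc _ e0.
  have eps0 : 0 < Num.min d r by rewrite lt_min d0.
  have [W [W0 iW W1 Wout smoothW]] := smooth_averages n eps0.
  have Ck := smoothW _ ieta (fun x => (andP (eta01 x)).1).
  have mf := continuous_measurable_rV (Ck 0%N).
  exists (average W eta); split => //.
  - exact: average01.
  - move=> x xA; apply: (average_eq0 Wout) => z; rewrite lt_min => /andP[_ zr].
    apply: eta_out => Axz; apply: xA; exists (x + z) => //.
    by rewrite opprD addrA subrr sub0r normrN.
  - apply: (integral_average_dist W0 iW W1 Wout) => //.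
    by move=> z; rewrite lt_min => /andP[zd _]; exact: dP.
  - apply: (gagliardo_average W0 iW W1 Wout) => //; try exact: measurable_thicken.
    move=> x z Ax; rewrite lt_min => /andP[_ zr].
    have -> : 3 * r = 2 * r + r by ring.
    by apply: thicken_shift => //; exact: ltW.
have /choice[f Hf] := step.
exists f; split.
- by move=> k; have [] := Hf k.
- by move=> k; have [] := Hf k.
- by move=> k; have [] := Hf k.
- apply: summable_ae_cvg => // k; have [Cf _ _ fk _] := Hf k => //.
  exact: continuous_measurable_rV (Cf 0%N).
- by move=> k; have [] := Hf k.
Qed.

End approximation.

(** * Functions of finite energy *)

Section energy_space.
Context (R : realType) (n : nat).
Local Notation mu := (lebesgue_rV R n).
Local Notation V := ('rV[R]_n).
Variables (s p : R).
Hypothesis p0 : 0 < p.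
Implicit Types (U : set V) (f g h w : V -> R).

Definition finite_energy U f : Prop :=
  (\int[mu]_(x in U) (`|f x| `^ p)%:E < +oo)%E /\ (gagliardo s p U f < +oo)%E.

Lemma gagliardo_ae_eq U w f : {ae mu, forall x, U x -> w x = f x} ->
  gagliardo s p U w = gagliardo s p U f.
Proof.
move=> wf; apply: ae_eq_integral_gen.
by apply: filterS2 (ae_fst wf) (ae_snd wf) => z e1 e2 [/e1-> /e2->].
Qed.

Lemma Wsp_finite_energy U w f : {ae mu, forall x, U x -> w x = f x} ->
  Wsp s p U w -> finite_energy U f.
Proof.
move=> wf [_ Woo].
have pV0 : p^-1 != 0 by rewrite invr_neq0// gt_eqF.
split.
  have <- : (\int[mu]_(x in U) (`|w x| `^ p)%:E = \int[mu]_(x in U) (`|f x| `^ p)%:E)%E.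
    by apply: ae_eq_integral_gen; apply: filterS wf => x e /e ->.
  apply: (lty_poweRy pV0); apply: le_lt_trans Woo.
  by rewrite /Wsp_norm leeDl// poweR_ge0.
rewrite -(gagliardo_ae_eq wf).
apply: (lty_poweRy pV0); apply: le_lt_trans Woo.
by rewrite /Wsp_norm leeDr// poweR_ge0.
Qed.

Lemma finite_energy_Wsp U w f : measurable U -> measurable_fun setT f ->
  {ae mu, forall x, U x -> w x = f x} -> finite_energy U f -> Wsp s p U w.
Proof.
move=> mU mf wf [foo goo]; split.
  exact: (ae_completed_measurable mU mf wf).
rewrite /Wsp_norm (gagliardo_ae_eq wf).
have -> : (\int[mu]_(x in U) (`|w x| `^ p)%:E = \int[mu]_(x in U) (`|f x| `^ p)%:E)%E.
  by apply: ae_eq_integral_gen; apply: filterS wf => x e /e ->.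
by apply: lte_add_pinfty; exact: poweR_lty.
Qed.

Lemma powRD_le (a b c : R) : `|a| <= `|b| + `|c| ->
  `|a| `^ p <= 2 `^ p * (`|b| `^ p + `|c| `^ p).
Proof.
move=> abc.
have := @powR_normD_le _ (p + 1) b c; rewrite addrK ltrDr => /(_ p0); apply: le_trans.
by apply: ge0_ler_powR; rewrite ?nnegrE ?addr_ge0// ltW.
Qed.

Lemma finite_energy_dominated U f g h : measurable U ->
  measurable_fun setT f -> measurable_fun setT g -> measurable_fun setT h ->
  (forall x, `|h x| <= `|f x| + `|g x|) ->
  (forall x y, `|h x - h y| <= `|f x - f y| + `|g x - g y|) ->
  finite_energy U f -> finite_energy U g -> finite_energy U h.
Proof.
move=> mU mf mg mh hfg dhfg [f1 f2] [g1 g2].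
have mp w : measurable_fun setT w -> measurable_fun setT (fun x : V => `|w x| `^ p).
  by move=> mw; apply: measurable_powR_fun; exact: measurableT_comp.
have pp : 0 <= 2 `^ p :> R by exact: powR_ge0.
split.
  pose F x := 2 `^ p * (`|f x| `^ p + `|g x| `^ p).
  apply: (@le_lt_trans _ _ (\int[mu]_(x in U) (F x)%:E)%E).
    apply: ge0_le_integral_EFin => //; first exact: mp.
    - by apply: measurable_funM => //; apply: measurable_funD; exact: mp.
    - by move=> x _; exact: powRD_le.
  under eq_integral do rewrite /F EFinM.
  rewrite ge0_integralZl//; last first.
  - by apply/measurable_EFinP/measurable_funTS/measurable_funD; exact: mp.
  rewrite ge0_integralD_EFin//; [|exact: mp|exact: mp].
  by apply: lte_mul_pinfty => //; exact: lte_add_pinfty.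
have mUU : measurable (U `*` U) by exact: measurableX.
pose F z := 2 `^ p * (gagliardo_density s p f z + gagliardo_density s p g z).
have md := @measurable_gagliardo_density R n s p.
have d0 := @gagliardo_density_ge0 R n s p.
apply: (@le_lt_trans _ _ (\int[mu \x mu]_(z in U `*` U) (F z)%:E)%E).
  apply: (@ge0_le_integral_EFin _ _ _ _ (U `*` U) (gagliardo_density s p h) F) => //.
  - exact: md.
  - by apply: measurable_funM => //; apply: measurable_funD; exact: md.
  - move=> z _; rewrite /F /gagliardo_density -mulrDl mulrA ler_wpM2r//.
      by rewrite invr_ge0 powR_ge0.
    exact: powRD_le.
under eq_integral do rewrite /F EFinM.
rewrite ge0_integralZl//; last 2 first.
- by apply/measurable_EFinP/measurable_funTS/measurable_funD; exact: md.
- by move=> z _; rewrite lee_fin addr_ge0.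
rewrite ge0_integralD_EFin//; [|exact: md|exact: md].
by apply: lte_mul_pinfty => //; exact: lte_add_pinfty.
Qed.

End energy_space.

(** * Comparison of the forms of two functions *)

Section kernel_version.
Context (R : realType) (n : nat).
Local Notation mu := (lebesgue_rV R n).
Local Notation V := ('rV[R]_n).

(** A measurable version of the kernel, symmetrised and clamped between its two
    bounds, satisfies everywhere what the kernel satisfies almost everywhere. On
    the diagonal it is 0, because there the bounds are quotients by 0; that the
    diagonal is null follows from the lower bound on the kernel, which fails
    there. *)
Lemma kernel_version (s p Lambda : R) (K : V -> V -> R) : 0 < Lambda ->
  0 < n%:R + s * p -> admissible_kernel s p Lambda K ->
  exists k : V * V -> R,
  [/\ measurable_fun setT k,
    forall z, 0 <= k z <= Lambda / enorm (z.1 - z.2) `^ (n%:R + s * p),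
    forall z, z.1 != z.2 -> 0 < k z,
    forall z, k (z.2, z.1) = k z &
    {ae (mu \x mu)%E, forall z, K z.1 z.2 = k z}].
Proof.
move=> L0 q0 [mK K0 Ksym Kb]; set q := n%:R + s * p in q0 Kb *.
have [k0 mk0 Kk0] := completed_measurable_ae measurableT mK.
pose e (z : V * V) := (enorm (z.1 - z.2) `^ q)^-1.
have e0 z : 0 <= e z by rewrite invr_ge0 powR_ge0.
have esym z : e (z.2, z.1) = e z by rewrite /e/= -enormN opprB.
have Li0 : 0 < Lambda^-1 by rewrite invr_gt0.
pose k1 z := (k0 z + k0 (z.2, z.1)) / 2.
pose k z := Num.min (Lambda * e z) (Num.max (Lambda^-1 * e z) (k1 z)).
have me : measurable_fun setT e.
  rewrite /e; under eq_fun do rewrite -powRN.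
  by apply: measurable_powR_fun; exact: measurable_enorm_diff.
have mk1 : measurable_fun setT k1.
  apply: measurable_funM => //; apply: measurable_funD => //.
  by apply: (measurableT_comp mk0); exact: measurable_swap.
exists k; split.
- apply: measurable_minr; first exact: measurable_funM.
  by apply: measurable_maxr => //; exact: measurable_funM.
- move=> z; rewrite /k ge_min lexx/= andbT le_min le_max.
  have := mulr_ge0 (ltW L0) (e0 z); have := mulr_ge0 (ltW Li0) (e0 z).
  by move=> -> ->.
- move=> z z12; have e1 : 0 < e z.
    rewrite invr_gt0 powR_gt0// (lt_le_trans _ (norm_le_enorm _))//.
    by rewrite normr_gt0 subr_eq0.
  by have:= mulr_gt0 L0 e1; have := mulr_gt0 Li0 e1; rewrite /k lt_min lt_max => -> ->.
- by move=> z; rewrite /k /k1 !esym/= addrC; case: z.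
apply: filterS3 (Kk0) (ae_swap Kk0) (Kb) => z /(_ I) E1 /(_ I)/= E2 /andP[b1 b2].
have k1E : k1 z = K z.1 z.2.
  by rewrite /k1 -E2 Ksym; case: z E1 {E2 b1 b2} => x y /= <-; field.
have p0 : 0 < enorm (z.1 - z.2) `^ q.
  rewrite lt_neqAle powR_ge0 andbT eq_sym; apply/eqP => E.
  by move: b1; rewrite E mulr0 leNgt Li0.
rewrite /k k1E max_r ?min_r//.
  by rewrite /e ler_pdivlMr.
by rewrite /e ler_pdivrMr.
Qed.

End kernel_version.

Section forms.
Context (R : realType) (n : nat).
Local Notation mu := (lebesgue_rV R n).
Local Notation V := ('rV[R]_n).

Lemma integral_swap (f : V * V -> \bar R) : measurable_fun setT f ->
  (\int[mu \x mu]_z f (z.2, z.1) = \int[mu \x mu]_z f z)%E.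
Proof.
move=> mf; rewrite integralE [RHS]integralE; congr (_ - _)%E.
  have /= <- := @ge0_integral_swap _ n (f^\+%E) (measurable_funepos mf) (fun z => funepos_ge0 f z).
  by apply: eq_integral => z _; rewrite !funeposE.
have /= <- := @ge0_integral_swap _ n (f^\-%E) (measurable_funeneg mf) (fun z => funeneg_ge0 f z).
by apply: eq_integral => z _; rewrite !funenegE.
Qed.

(** The two mixed regions contribute equally by symmetry, whence the factor 2, and
    [f] vanishes on the pairs of points outside [O'], since these lie outside
    [O]. *)
Lemma integral_split_symmetric (f : V * V -> R) (O O' : set V) :
  measurable O -> measurable O' -> O `<=` O' ->
  (mu \x mu)%E.-integrable setT (EFin \o f) ->
  (forall z, f (z.2, z.1) = f z) ->
  (forall z, ~ O z.1 -> ~ O z.2 -> f z = 0) ->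
  (\int[mu \x mu]_z (f z)%:E = \int[mu \x mu]_(z in O' `*` O') (f z)%:E +
    2%:E * \int[mu \x mu]_(z in O `*` ~` O') (f z)%:E)%E.
Proof.
move=> mO mO' OO' fi fsym f0.
have mA : measurable (O' `*` O') by exact: measurableX.
have mB : measurable (O `*` ~` O') by apply: measurableX => //; exact: measurableC.
have iA : (mu \x mu)%E.-integrable setT (fun z => (\1_(O' `*` O') z * f z)%:E).
  by apply: integrable_indic_mul => //; exact: integrableS fi.
have iB : (mu \x mu)%E.-integrable setT (fun z => (\1_(O `*` ~` O') z * f z)%:E).
  by apply: integrable_indic_mul => //; exact: integrableS fi.
pose b z := \1_(O `*` ~` O') z * f z.
have mbE : measurable_fun setT (EFin \o b) := measurable_int _ iB.
have iB' : (mu \x mu)%E.-integrable setT (fun z => (b (z.2, z.1))%:E).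
  have /integrableP[_ boo] := iB.
  apply/integrableP; split.
    by apply: (measurableT_comp mbE); exact: measurable_swap.
  rewrite (@integral_swap (fun z => `|(b z)%:E|)%E)//.
  exact: measurableT_comp.
have E z : (f z)%:E =
    ((\1_(O' `*` O') z * f z)%:E + ((b z)%:E + (b (z.2, z.1))%:E))%E.
  rewrite -!EFinD; congr EFin.
  have i1 (S : set (V * V)) w : S w -> \1_S w = 1 :> R by move=> Sw; rewrite indicE mem_set.
  have i0 (S : set (V * V)) w : ~ S w -> \1_S w = 0 :> R by move=> Sw; rewrite indicE memNset.
  have fz := f0 z; rewrite /b fsym; case: z fz => x y /= fz.
  have [x1|x1] := pselect (O' x); have [y1|y1] := pselect (O' y).
  - rewrite [in X in _ = X + _]i1// [in X in _ = _ + (X + _)]i0; last by case.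
    by rewrite i0 ?mul1r ?mul0r ?addr0//; case.
  - rewrite [in X in _ = X + _]i0; last by case.
    rewrite [in X in _ = _ + (_ + X)]i0; last by case.
    rewrite !mul0r add0r addr0.
    have [Ox|Ox] := pselect (O x); first by rewrite i1// mul1r.
    by rewrite fz ?mulr0// => /OO'.
  - rewrite [in X in _ = X + _]i0; last by case.
    rewrite [in X in _ = _ + (X + _)]i0; last by case.
    rewrite !mul0r !add0r.
    have [Oy|Oy] := pselect (O y); first by rewrite i1// mul1r.
    by rewrite fz ?mulr0// => /OO'.
  - by rewrite fz ?mulr0 ?addr0// => /OO'.
under eq_integral do rewrite E.
rewrite integralD//; last exact: integrableD.
rewrite integralD//.
have -> : (\int[mu \x mu]_z (b (z.2, z.1))%:E = \int[mu \x mu]_z (b z)%:E)%E.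
  exact: (integral_swap mbE).
rewrite integral_indic_mul; congr (_ + _)%E.
by rewrite /b integral_indic_mul mule_natl mule2n.
Qed.

(** The points where [f] does not vanish form with those of [A] a null rectangle. *)
Lemma ae_pair_eq0 (f : V -> R) (A : set V) : measurable_fun setT f ->
  measurable A -> (0 < mu A)%E -> (forall x, A x -> f x = 0) ->
  {ae (mu \x mu)%E, forall z, f z.1 = f z.2} -> {ae mu, forall x, f x = 0}.
Proof.
move=> mf mA A0 fA [N [mN N0 fN]].
pose P : set V := [set x | f x != 0].
have mP : measurable P.
  rewrite (_ : P = f @^-1` (~` [set 0])).
    by rewrite -[X in measurable X]setTI; apply: mf => //; exact: measurableC.
  by apply/seteqP; split => x /= /eqP.
have PA : (mu \x mu)%E (P `*` A) = 0%E.
  apply/eqP; rewrite eq_le measure_ge0 andbT -[leRHS]N0.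
  apply: le_measure; rewrite ?inE//; first exact: measurableX.
  move=> z [/= Pz Az]; apply: fN => /= fz; move: Pz; rewrite /P/= fz (fA _ Az).
  by rewrite eqxx.
exists P; split => //.
  apply/eqP; move: PA; rewrite product_measure1E// => /eqP.
  rewrite mule_eq0 => /orP[//|/eqP A00]; move: A0; rewrite [ltRHS]A00.
  by rewrite ltxx.
by move=> x /= /eqP.
Qed.

Variables (p : R) (k : V * V -> R) (u v : V -> R).
Hypothesis p1 : 1 < p.
Hypothesis kpos : forall z, z.1 != z.2 -> 0 < k z.
Hypotheses (meas_u : measurable_fun setT u) (meas_v : measurable_fun setT v).

Definition excess x : R := Num.min (Num.max (u x - v x) 0) 1.

(** The key monotonicity: the excess is a nondecreasing function of [u - v]. *)
Lemma excess_le x y : excess y < excess x -> v x - v y < u x - u y.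
Proof.
rewrite /excess; move: (u x) (u y) (v x) (v y) => a b c d.
rewrite /Num.min /Num.max; do 4 case: ifPn; rewrite -?leNgt; lra.
Qed.

Lemma excess01 x : 0 <= excess x <= 1.
Proof.
by rewrite /excess le_min le_max lexx orbT ler01/= ge_min lexx orbT.
Qed.

Lemma measurable_excess : measurable_fun setT excess.
Proof.
apply: measurable_minr => //; apply: measurable_maxr => //.
exact: measurable_funB.
Qed.

Lemma excess_eq0 x : excess x = 0 -> u x <= v x.
Proof.
rewrite /excess /Num.min /Num.max; do 2 case: ifPn; rewrite -?leNgt; lra.
Qed.

Lemma excess_out x : u x <= v x -> excess x = 0.
Proof.
by move=> uv; rewrite /excess max_r ?subr_le0// min_l.
Qed.

Let gap z := form_density p k u excess z - form_density p k v excess z.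

Let gap_gt0 z : excess z.1 != excess z.2 -> 0 < gap z.
Proof.
move=> e12; have kz : 0 < k z by apply: kpos; apply: contraNneq e12 => ->.
have -> : gap z = (Lpow p (u z.1) (u z.2) - Lpow p (v z.1) (v z.2)) *
    ((excess z.1 - excess z.2) * k z) by rewrite /gap /form_density; ring.
case: (ltgtP (excess z.1) (excess z.2)) e12 => // e _.
  have := excess_le e; rewrite -(ltrN2 (u _ - _)) !opprB => /(Lpow_lt p1) lt1.
  by rewrite nmulr_rgt0 ?subr_lt0// nmulr_rlt0 ?subr_lt0.
have /(Lpow_lt p1) lt1 := excess_le e.
by rewrite !mulr_gt0// subr_gt0.
Qed.

Let gap_ge0 z : 0 <= gap z.
Proof.
have [e|/gap_gt0/ltW//] := eqVneq (excess z.1) (excess z.2).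
by rewrite /gap /form_density e subrr !mulr0 !mul0r subrr.
Qed.

(** The difference of the two form densities is nonnegative with nonpositive
    integral, so it vanishes almost everywhere; but it is positive wherever the
    excess takes different values. *)
Lemma form_comparison (A : set V) : measurable A -> (0 < mu A)%E ->
  (forall x, A x -> u x <= v x) ->
  (mu \x mu)%E.-integrable setT (EFin \o form_density p k u excess) ->
  (mu \x mu)%E.-integrable setT (EFin \o form_density p k v excess) ->
  (\int[mu \x mu]_z (form_density p k u excess z)%:E <= 0)%E ->
  (0 <= \int[mu \x mu]_z (form_density p k v excess z)%:E)%E ->
  {ae mu, forall x, u x <= v x}.
Proof.
move=> mA A0 uvA iu iv Iu Iv.
have /measurable_EFinP mfu := measurable_int _ iu.
have /measurable_EFinP mfv := measurable_int _ iv.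
have gap0 : (\int[mu \x mu]_z (gap z)%:E = 0)%E.
  apply/eqP; rewrite eq_le integral_ge0 ?andbT; last by move=> z _; rewrite lee_fin.
  rewrite /gap; under eq_integral do rewrite EFinB.
  rewrite integralB//; move: Iu Iv.
  rewrite !integrable_RintegralE// -EFinB !lee_fin; move: (Rintegral _ _ _) (Rintegral _ _ _) => a b; lra.
have mg : measurable_fun setT gap by exact: measurable_funB.
have := ge0_integral_eq0_ae mg gap_ge0 gap0.
move=> gap_ae; have : {ae (mu \x mu)%E, forall z, excess z.1 = excess z.2}.
  apply: filterS gap_ae => z gz; apply/eqP; apply: contraPT gz => e12.
  by apply/eqP; rewrite gt_eqF// gap_gt0.
move=> /(ae_pair_eq0 measurable_excess mA A0 (fun x Ax => excess_out (uvA x Ax))).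
by apply: filterS => x /excess_eq0.
Qed.

End forms.

(** * Testing supersolutions with bounded functions *)

Section kernel_form.
Context (R : realType) (n : nat).
Local Notation mu := (lebesgue_rV R n).
Local Notation V := ('rV[R]_n).
Variables (s p Lambda N r : R) (k : V * V -> R) (A : set V).
Hypotheses (s0 : 0 < s) (p1 : 1 < p) (L0 : 0 < Lambda).
Hypothesis mk : measurable_fun setT k.
Hypothesis kb : forall z, 0 <= k z <= Lambda / enorm (z.1 - z.2) `^ (n%:R + s * p).
Hypotheses (N0 : 0 <= N) (AN : forall x, A x -> `|x| <= N) (r0 : 0 < r).

Local Notation C := (thicken A r).
Local Notation U := (thicken A (2 * r)).
Local Notation wt := (fun y : V => (1 + enorm y) `^ (- n%:R - s * p)).

(** The integrability that makes the form of [w] against functions supported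
    near [A] an absolutely convergent integral. *)
Definition form_domain (w : V -> R) : Prop :=
  [/\ (gagliardo s p U w < +oo)%E,
    (\int[mu]_(x in C) (`|w x| `^ (p - 1))%:E < +oo)%E &
    (\int[mu]_(y in ~` U) (`|w y| `^ (p - 1) * wt y)%:E < +oo)%E].

Lemma gagliardoS (X Y : set V) (w : V -> R) : measurable X -> measurable Y ->
  X `<=` Y -> measurable_fun setT w -> (gagliardo s p X w <= gagliardo s p Y w)%E.
Proof.
move=> mX mY XY mw; apply: ge0_subset_integral; try exact: measurableX.
- by apply/measurable_EFinP/measurable_funTS; exact: measurable_gagliardo_density.
- by move=> z _; rewrite lee_fin; exact: gagliardo_density_ge0.
- by move=> z [/XY ? /XY ?].
Qed.

Let mpow (w : V -> R) q : measurable_fun setT w -> measurable_fun setT (fun x : V => `|w x| `^ q).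
Proof. by move=> mw; apply: measurable_powR_fun; exact: measurableT_comp. Qed.

Let mC : measurable C. Proof. exact: measurable_thicken. Qed.
Let mU : measurable U. Proof. exact: measurable_thicken. Qed.
Let CU : C `<=` U. Proof. by apply: thickenS; move: r0; lra. Qed.

(** The complement of [U] lies outside [A], where the two functions agree. *)
Lemma tail_setC_lty (w w' : V -> R) : tail_space s p w ->
  {ae mu, forall x, ~ A x -> w x = w' x} -> measurable_fun setT w' ->
  (\int[mu]_(y in ~` U) (`|w' y| `^ (p - 1) * wt y)%:E < +oo)%E.
Proof.
move=> [[cw _] tw] ww' mw'.
have [w0 mw0 ww0] := completed_measurable_ae measurableT cw.
have mf0 : measurable_fun setT (fun y => `|w0 y| `^ (p - 1) * wt y).
  by apply: measurable_funM; [exact: mpow|exact: measurable_weight].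
apply: (@le_lt_trans _ _ (\int[mu]_y (`|w0 y| `^ (p - 1) * wt y)%:E)%E).
  rewrite (@ae_eq_integral_gen _ _ _ mu (~` U) _ (fun y => (`|w0 y| `^ (p - 1) * wt y)%:E)).
    apply: ge0_subset_integral => //; first exact: measurableC.
    - exact/measurable_EFinP.
    - by move=> y _; rewrite lee_fin mulr_ge0 ?powR_ge0.
  apply: filterS2 ww' ww0 => y e1 /(_ I) e2 yU; rewrite -e1 ?e2// => Ay; apply: yU.
  by apply: sub_thicken => //; rewrite mulr_gt0.
rewrite -(@ae_eq_integral_gen _ _ _ mu setT (fun y => (`|w y| `^ (p - 1) * wt y)%:E))//.
by apply: filterS ww0 => y /(_ I) ->.
Qed.

(** On the bounded set [C], [|w|^(p-1) <= 1 + |w|^p]. *)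
Lemma form_domain_of_energy (Y : set V) (w : V -> R) : measurable Y -> U `<=` Y ->
  measurable_fun setT w -> finite_energy s p Y w ->
  (\int[mu]_(y in ~` U) (`|w y| `^ (p - 1) * wt y)%:E < +oo)%E ->
  form_domain w.
Proof.
move=> mY UY mw [w1 w2] w3; split => //.
  exact: le_lt_trans (gagliardoS mU mY UY mw) w2.
pose F x := 1 + `|w x| `^ p.
have p1' := p1.
apply: (@le_lt_trans _ _ (\int[mu]_(x in C) (F x)%:E)%E).
  apply: ge0_le_integral_EFin => //; first exact: mpow.
  - by apply: measurable_funD => //; exact: mpow.
  - move=> x _; rewrite /F; have [w_le1|w_gt1] := leP `|w x| 1.
      apply: (@le_trans _ _ 1); last by rewrite lerDl powR_ge0.
      rewrite -[leRHS](_ : 1 `^ (p - 1) = 1); last by rewrite powR1.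
      by apply: ge0_ler_powR; rewrite ?nnegrE// subr_ge0 ltW.
    apply: (@le_trans _ _ (`|w x| `^ p)); last by rewrite lerDr.
    by rewrite ler_powR ?(ltW w_gt1)//; lra.
rewrite /F ge0_integralD_EFin//; last exact: mpow.
apply: lte_add_pinfty.
  rewrite integral_cst// mul1e; exact: (thicken_lty r0 N0 AN).
apply: le_lt_trans w1; apply: ge0_subset_integral => //.
- by apply/measurable_EFinP/measurable_funTS; exact: mpow.
- by move=> x /CU/UY.
Qed.

(** The local hypotheses on a supersolution apply because [U] and [C] have compact
    closures, the former inside [O]. *)
Lemma form_domain_of_supersolution (O : set V) (K : V -> V -> R) (v v' : V -> R) :
  closure U `<=` O -> weak_supersolution s p K O v -> measurable_fun setT v' ->
  {ae mu, forall x, v x = v' x} -> form_domain v'.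
Proof.
move=> UO [vloc vtail _] mv' vv'; split.
- have cU : compactly_contained U O by split => //; exact: (compact_closure_thicken (r := 2 * r) AN).
  have p0 : 0 < p by rewrite (lt_trans ltr01).
  have vv'U : {ae mu, forall x, U x -> v x = v' x} by apply: filterS vv' => x e _.
  by have [] := Wsp_finite_energy p0 vv'U (vloc _ (@open_thicken _ _ A (2 * r)) cU).
- have := vtail.1.2 _ (compact_closure_thicken (r := r) AN).
  apply: le_lt_trans.
  rewrite (@ae_eq_integral_gen _ _ _ mu (closure C) _ (fun y => (`|v' y| `^ (p - 1))%:E)); last first.
    by apply: filterS vv' => x ->.
  apply: ge0_subset_integral => //.
  + rewrite -[closure C]setCK; apply: measurableC; apply: open_measurable_rV.
    by apply: closed_openC; exact: closed_closure.
  + by apply/measurable_EFinP/measurable_funTS; exact: mpow.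
  + exact: subset_closure.
- by apply: (tail_setC_lty vtail) => //; apply: filterS vv' => x e _.
Qed.

Variable eta : V -> R.
Hypothesis meta : measurable_fun setT eta.
Hypothesis eta01 : forall x, 0 <= eta x <= 1.
Hypothesis eta_out : forall x, ~ A x -> eta x = 0.
Hypothesis geta : (gagliardo s p (thicken A (3 * r)) eta < +oo)%E.

Let k0 z : 0 <= k z. Proof. by have /andP[] := kb z. Qed.
Let kle z : k z <= Lambda / enorm (z.1 - z.2) `^ (n%:R + s * p).
Proof. by have /andP[] := kb z. Qed.
Let Coo : (mu C < +oo)%E. Proof. exact: (thicken_lty r0 N0 AN). Qed.

Let norm01 (f : V -> R) x : 0 <= f x <= 1 -> `|f x| <= 1.
Proof. by move=> /andP[? ?]; rewrite ger0_norm. Qed.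

Let eta_outC x : ~ C x -> eta x = 0.
Proof. by move=> Cx; apply: eta_out => Ax; apply: Cx; exact: sub_thicken. Qed.

Let getaU : (gagliardo s p U eta < +oo)%E.
Proof.
apply: le_lt_trans geta; apply: gagliardoS => //; first exact: measurable_thicken.
by apply: thickenS; move: r0; lra.
Qed.

Lemma integrable_form (w : V -> R) : measurable_fun setT w -> form_domain w ->
  (mu \x mu)%E.-integrable setT (EFin \o form_density p k w eta).
Proof.
move=> mw [w1 w2 w3]; have [c c0 far] := far_enorm r0 N0 AN.
exact: (integrable_form_density s0 p1 L0 c0 k0 mk kle mC mU CU far Coo mw w1 w2 w3
  meta (fun x => norm01 (eta01 x)) eta_outC getaU).
Qed.

(** Supersolutions may be tested with bounded functions of finite energy, which
    are approximated by smooth ones. *)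
Lemma supersolution_form_ge0 (O : set V) (K : V -> V -> R) (v v' : V -> R) :
  thicken A (3 * r) `<=` O -> weak_supersolution s p K O v -> measurable_fun setT v' ->
  {ae mu, forall x, v x = v' x} ->
  {ae (mu \x mu)%E, forall z, K z.1 z.2 = k z} ->
  (0 <= \int[mu \x mu]_z (form_density p k v' eta z)%:E)%E.
Proof.
move=> AO vsup mv' vv' Kk.
have UO : closure U `<=` O.
  by apply: subset_trans AO; apply: closure_thicken; move: r0; lra.
have [v1 v2 v3] := form_domain_of_supersolution UO vsup mv' vv'.
have [c c0 far] := far_enorm r0 N0 AN.
have [ek [ek1 ek2 ek3 ek4 ek5]] := smooth_approximation N0 AN r0 meta eta01 eta_out s p1.
pose B := fine ((2 `^ p)%:E * gagliardo s p (thicken A (3 * r)) eta)%E.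
have BE : (B%:E = (2 `^ p)%:E * gagliardo s p (thicken A (3 * r)) eta)%E.
  rewrite fineK// fin_numM// ge0_fin_numE//.
  by apply: integral_ge0 => z _; rewrite lee_fin; exact: gagliardo_density_ge0.
apply: (@form_density_limit R n s p Lambda c k C U s0 p1 L0 c0 k0 mk kle mC mU CU far Coo
  v' mv' v1 v2 v3 eta ek B meta (fun x => norm01 (eta01 x)) eta_outC getaU) => //.
- by move=> j; exact: continuous_measurable_rV (ek1 j 0%N).
- by move=> j x; exact: norm01.
- by move=> j; rewrite BE.
move=> j; have [_ _ vtest] := vsup.
have supp : Cinfty0 O (ek j).
  have sC : [set x | ek j x != 0] `<=` C.
    by move=> x /= ex; apply: contrapT => /ek3 e0; move: ex; rewrite e0 eqxx.
  have tC : tsupport (ek j) `<=` closure C by exact: closureS.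
  split => //.
    apply: (subclosed_compact _ (compact_closure_thicken (r := r) AN) tC).
    exact: closed_closure.
  by apply: (subset_trans tC); apply: (subset_trans (closureS CU)).
have := vtest _ supp (fun x => (andP (ek2 j x)).1).
rewrite (@ae_eq_integral_gen _ _ _ (mu \x mu)%E setT _
  (fun z => (form_density p k v' (ek j) z)%:E))//.
by apply: filterS3 (ae_fst vv') (ae_snd vv') Kk => z e1 e2 e3 _; rewrite e1 e2 e3.
Qed.

End kernel_form.

(** * The comparison principle *)

Section obstacle.
Context (R : realType) (n : nat).
Local Notation mu := (lebesgue_rV R n).
Local Notation V := ('rV[R]_n).
Implicit Types (u v g : V -> R).

(** This expression, with [min u v] in place of [v], shows that the excess
    inherits a finite energy from [u] and [min u v]; [v] itself need not have one
    on the whole set on which the obstacle problem is posed. *)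
Lemma excess_sub u v x : excess u v x = Num.min (u x - Num.min (u x) (v x)) 1.
Proof.
rewrite /excess /Num.min /Num.max; do !case: ifPn; rewrite -?leNgt; lra.
Qed.

Lemma excess_dist u v x y :
  `|excess u v x - excess u v y| <= `|u x - u y| +
    `|Num.min (u x) (v x) - Num.min (u y) (v y)|.
Proof.
rewrite !excess_sub; move: (u x) (u y) (Num.min (u x) _) (Num.min (u y) _) => a b c d.
apply: (@le_trans _ _ `|(a - b) - (c - d)|); last exact: ler_normB.
have lip (t t' : R) : t' <= t -> `|Num.min t 1 - Num.min t' 1| <= `|t - t'|.
  move=> tt'; rewrite [leRHS]ger0_norm ?subr_ge0// ger0_norm.
    by rewrite /Num.min; do 2 case: ifPn; rewrite -?leNgt; lra.
  by rewrite /Num.min; do 2 case: ifPn; rewrite -?leNgt; lra.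
have -> : a - b - (c - d) = (a - c) - (b - d) by ring.
have [h|/ltW h] := leP (b - d) (a - c); first exact: lip.
by rewrite distrC [leRHS]distrC; exact: lip.
Qed.

Lemma excess_norm u v x : `|excess u v x| <= `|u x| + `|Num.min (u x) (v x)|.
Proof.
have /andP[e0 _] := excess01 u v x.
rewrite ger0_norm// excess_sub; apply: le_trans (ler_normB _ _).
by rewrite ge_min ler_norm.
Qed.

Lemma min_le_sub_excess u v x : Num.min (u x) (v x) <= u x - excess u v x.
Proof. by rewrite excess_sub lerBrDr -lerBrDl ge_min lexx. Qed.

Lemma form_density_swap (p : R) (k : V * V -> R) (w zeta : V -> R) z :
  (forall z, k (z.2, z.1) = k z) ->
  form_density p k w zeta (z.2, z.1) = form_density p k w zeta z.
Proof.
move=> ksym; rewrite /form_density ksym/= /Lpow (distrC (w z.2)).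
by move: (_ `^ _) => a; ring.
Qed.

Lemma form_density_oppr (p : R) (k : V * V -> R) (w zeta : V -> R) z :
  form_density p k w (fun x => - zeta x) z = - form_density p k w zeta z.
Proof. by rewrite /form_density; move: (Lpow _ _ _) => a; ring. Qed.

(** Outside [O] the test function vanishes and [u] agrees with [g], so each of the
    two mixed regions of the full double integral contributes the second integral
    of the obstacle form. *)
Lemma obstacle_formE (p : R) (K : V -> V -> R) (k : V * V -> R) (O O' : set V)
    (g u u' zeta phi : V -> R) :
  measurable O -> measurable O' -> O `<=` O' ->
  (forall z, k (z.2, z.1) = k z) ->
  {ae (mu \x mu)%E, forall z, K z.1 z.2 = k z} ->
  {ae mu, forall x, u x = u' x} -> {ae mu, forall x, ~ O x -> u x = g x} ->
  phi =1 zeta -> (forall x, ~ O x -> zeta x = 0) ->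
  (mu \x mu)%E.-integrable setT (EFin \o form_density p k u' zeta) ->
  (obstacle_form p K O O' g u phi =
    \int[mu \x mu]_z (form_density p k u' zeta z)%:E)%E.
Proof.
move=> mO mO' OO' ksym Kk uu' ug /funext -> zO fi.
rewrite (integral_split_symmetric mO mO' OO' fi); last 2 first.
- by move=> z; exact: form_density_swap.
- by move=> z z1 z2; rewrite /form_density !zO// subrr mulr0 mul0r.
rewrite /obstacle_form; congr (_ + 2%:E * _)%E; apply: ae_eq_integral_gen.
  by apply: filterS3 (ae_fst uu') (ae_snd uu') Kk => z e1 e2 e3 _; rewrite e1 e2 e3.
apply: filterS2 (filterI (ae_fst uu') (ae_snd uu')) (filterI Kk (ae_snd ug)).
move=> z [e1 e2] [e3 e4] [z1 z2]; have z2O : ~ O z.2 by move=> /OO'.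
by rewrite e1 -e4// e2 e3 /form_density (zO _ z2O) subr0.
Qed.

End obstacle.

Theorem proposition1 (R : realType) (n : nat) (n_gt0 : (0 < n)%N)
    (s p Lambda : R) (s01 : 0 < s < 1) (p_gt1 : 1 < p) (Lambda_ge1 : 1 <= Lambda)
    (K : 'rV[R]_n -> 'rV[R]_n -> R) (K_adm : admissible_kernel s p Lambda K)
    (Omega Omega' Omega'' : set 'rV[R]_n)
    (Omega_open : open Omega) (Omega_bounded : bounded_set Omega)
    (Omega'_open : open Omega') (Omega'_bounded : bounded_set Omega')
    (Omega_cc : compactly_contained Omega Omega')
    (h : 'rV[R]_n -> \bar R) (h_ltoo : forall x, (h x < +oo)%E)
    (g : 'rV[R]_n -> R) (g_Wsp : Wsp s p Omega' g) (g_tail : tail_space s p g)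
    (class_neq0 : obstacle_class s p Omega Omega' g h !=set0)
    (Omega''_open : open Omega'') (Omega_cc'' : compactly_contained Omega Omega'')
    (Omega''_sub : Omega'' `<=` Omega')
    (u v : 'rV[R]_n -> R)
    (u_sol : obstacle_solution s p K Omega Omega' g h u)
    (v_super : weak_supersolution s p K Omega'' v)
    (min_class :
      obstacle_class s p Omega Omega' g h (fun x => Num.min (u x) (v x))) :
  {ae lebesgue_rV R n, forall x, u x <= v x}.

Proof.
have [s0 _] := andP s01.
have p0 : 0 < p by rewrite (lt_trans ltr01).
have L0 : 0 < Lambda by rewrite (lt_le_trans ltr01).
have q0 : 0 < n%:R + s * p by rewrite ltr_wpDl// mulr_gt0.
have [k [mk kb kpos ksym Kk]] := kernel_version L0 q0 K_adm.
have mO := open_measurable_rV Omega_open.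
have mO' := open_measurable_rV Omega'_open.
have OO' : Omega `<=` Omega' := subset_trans (@subset_closure _ Omega) Omega_cc.2.
have [N N0 ON] : exists2 N : R, 0 <= N & forall x, Omega x -> `|x| <= N.
  have [N' [_ HN]] := Omega_bounded.
  exists (Num.max 0 (N' + 1)); first by rewrite le_max lexx.
  by apply: HN; rewrite lt_max ltrDl ltr01 orbT.
have [rho rho0 rhoO''] := thicken_sub Omega_cc''.1 Omega_cc''.2 Omega''_open.
(* neighbourhoods of radius up to [3 r] are used, and they must lie in [Omega''] *)
pose r := rho / 4; have r0 : 0 < r by rewrite divr_gt0.
have O3 : thicken Omega (3 * r) `<=` Omega''.
  by apply: subset_trans rhoO''; apply: thickenS; rewrite /r; lra.
have O2 : thicken Omega (2 * r) `<=` Omega''.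
  by apply: subset_trans O3; apply: thickenS; lra.
have [[uW _ ug] umin] := u_sol.
have [mW mh _] := min_class.
have [uo muo Euo] := completed_measurable_ae mO' uW.1.
have [g' mg' Eg] := completed_measurable_ae measurableT g_tail.1.1.
have [_ v_tail _] := v_super.
have [vo mvo Evo] := completed_measurable_ae measurableT v_tail.1.1.
have mOc : measurable (~` Omega) by exact: measurableC.
(* [u] is measurable on [Omega'] and equal to [g] outside [Omega]; [v'] is raised
   so that [u' <= v'] holds outside [Omega] without exception, which alters [v]
   on a null set because [min u v = g = u] almost everywhere there *)
pose u' x := \1_Omega x * uo x + \1_(~` Omega) x * g' x.
pose v' x := \1_Omega x * vo x + \1_(~` Omega) x * Num.max (vo x) (u' x).
have in1 (S : set 'rV[R]_n) x : S x -> \1_S x = 1 :> R by move=> Sx; rewrite indicE mem_set.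
have in0 (S : set 'rV[R]_n) x : ~ S x -> \1_S x = 0 :> R by move=> Sx; rewrite indicE memNset.
have u'in x : Omega x -> u' x = uo x by move=> Ox; rewrite /u' in1// in0 ?mul1r ?mul0r ?addr0.
have u'out x : ~ Omega x -> u' x = g' x by move=> Ox; rewrite /u' in0// in1 ?mul1r ?mul0r ?add0r.
have v'in x : Omega x -> v' x = vo x by move=> Ox; rewrite /v' in1// in0 ?mul1r ?mul0r ?addr0.
have v'out x : ~ Omega x -> v' x = Num.max (vo x) (u' x).
  by move=> Ox; rewrite /v' in0// in1 ?mul1r ?mul0r ?add0r.
have mu' : measurable_fun setT u'.
  by apply: measurable_funD; apply: measurable_funM => //; exact: measurable_indic.
have mv' : measurable_fun setT v'.
  apply: measurable_funD; apply: measurable_funM => //; try exact: measurable_indic.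
  exact: measurable_maxr.
have uu' : {ae lebesgue_rV R n, forall x, u x = u' x}.
  apply: filterS3 Euo Eg ug => x e1 /(_ I) e2 e3.
  have [Ox|Ox] := pselect (Omega x); first by rewrite u'in// e1//; exact: OO'.
  by rewrite u'out// e3.
have uv_out x : ~ Omega x -> u' x <= v' x by move=> Ox; rewrite v'out// le_max lexx orbT.
have vv' : {ae lebesgue_rV R n, forall x, v x = v' x}.
  have [_ _ ming] := min_class.
  apply: filterS2 (filterI Evo uu') (filterI ug ming) => x [/(_ I) e1 e2] [e3 e4].
  have [Ox|Ox] := pselect (Omega x); first by rewrite v'in.
  rewrite v'out// max_l// -e1 -e2 e3// -(e4 Ox).
  by rewrite ge_min lexx orbT.
pose m' x := Num.min (u' x) (v' x).
have mm' : measurable_fun setT m' by exact: measurable_minr.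
have minm' : {ae lebesgue_rV R n, forall x, Num.min (u x) (v x) = m' x}.
  by apply: filterS2 uu' vv' => x -> ->.
have onO' (P : 'rV[R]_n -> Prop) : {ae lebesgue_rV R n, forall x, P x} ->
  {ae lebesgue_rV R n, forall x, Omega' x -> P x} by apply: filterS => x Px _.
have fu := Wsp_finite_energy p0 (onO' _ uu') uW.
have fm := Wsp_finite_energy p0 (onO' _ minm') mW.
pose eta := excess u' v'.
have meta : measurable_fun setT eta by exact: measurable_excess.
have eta01 x : 0 <= eta x <= 1 by exact: excess01.
have eta_out x : ~ Omega x -> eta x = 0 by move=> /uv_out; exact: excess_out.
have feta : finite_energy s p Omega' eta.
  apply: (finite_energy_dominated p0 mO' mu' mm' meta _ _ fu fm).
    exact: excess_norm.
  exact: excess_dist.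
have mue : measurable_fun setT (fun x => u' x - eta x) by exact: measurable_funB.
have fue : finite_energy s p Omega' (fun x => u' x - eta x).
  apply: (finite_energy_dominated p0 mO' mu' meta mue _ _ fu feta).
    by move=> x; exact: ler_normB.
  move=> x y; have -> : u' x - eta x - (u' y - eta y) = (u' x - u' y) - (eta x - eta y) by ring.
  exact: ler_normB.
have competitor : obstacle_class s p Omega Omega' g h (fun x => u x - eta x).
  split.
  - apply: (finite_energy_Wsp mO' mue _ fue).
    by apply: onO'; apply: filterS uu' => x ->.
  - apply: filterS3 mh uu' minm' => x hx e1 e2 Ox; apply: le_trans (hx Ox) _.
    by rewrite lee_fin e2 e1; exact: min_le_sub_excess.
  - by apply: filterS ug => x e Ox; rewrite eta_out// subr0 e.
have geta : (gagliardo s p (thicken Omega (3 * r)) eta < +oo)%E.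
  apply: le_lt_trans feta.2; apply: gagliardoS => //; first exact: measurable_thicken.
  exact: subset_trans O3 Omega''_sub.
have domu : form_domain s p r Omega u'.
  apply: (form_domain_of_energy p_gt1 N0 ON r0 mO' _ mu' fu).
    exact: subset_trans O2 Omega''_sub.
  apply: (tail_setC_lty r0 g_tail _ mu').
  by apply: filterS2 uu' ug => x e1 e2 Ox; rewrite -e1 e2.
have UO'' : closure (thicken Omega (2 * r)) `<=` Omega''.
  by apply: subset_trans O3; apply: closure_thicken; lra.
have domv := form_domain_of_supersolution p_gt1 ON r0 UO'' v_super mv' vv'.
have iu := integrable_form s0 p_gt1 L0 mk kb N0 ON r0 meta eta01 eta_out geta mu' domu.
have iv := integrable_form s0 p_gt1 L0 mk kb N0 ON r0 meta eta01 eta_out geta mv' domv.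
have Iv := supersolution_form_ge0 s0 p_gt1 L0 mk kb N0 ON r0 meta eta01 eta_out geta
  O3 v_super mv' vv' Kk.
have Iu : (\int[lebesgue_rV R n \x lebesgue_rV R n]_z
    (form_density p k u' eta z)%:E <= 0)%E.
  have iuN : (lebesgue_rV R n \x lebesgue_rV R n)%E.-integrable setT
      (EFin \o form_density p k u' (fun x => - eta x)).
    apply: (integrable_eqT (integrableN iu)) => z /=.
    by rewrite form_density_oppr EFinN.
  have := umin _ competitor.
  rewrite (obstacle_formE (zeta := fun x => - eta x) mO mO' OO' ksym Kk uu' ug _ _ iuN).
  - under eq_integral do rewrite form_density_oppr EFinN.
    rewrite integralN; last exact: integrable_add_def.
    by rewrite oppe_ge0.
  - by move=> x; ring.
  - by move=> x Ox; rewrite eta_out// oppr0.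
have := form_comparison p_gt1 kpos mu' mv' mOc (setC_bounded_pos n_gt0 mO ON) uv_out iu iv Iu Iv.
by move=> uv; apply: filterS3 uu' vv' uv => x -> ->.
Qed.
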